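(* Let $\mu\ge 0$ be real, $\beta>0$, $N\ge1$ an integer, and let $u$ be a function on $\mathbb R$ with $u\cdot(1+x^2)^{\mu/2}\in L^2(\mathbb R)$. Set $\omega=|x|^{2\mu}$, $M=\frac{\sqrt N}{2\sqrt3\,\beta}$ and $B=\frac{\sqrt N\,\beta}{2\sqrt3}$. Then there is a constant $C_\mu$ depending only on $\mu$ (not on $u,\beta,N$) such that $$\bigl\|u-\widehat\Pi_N^{(\mu,\beta)} u\bigr\|_\omega \le C_\mu\Bigl( \bigl\|u \cdot \mathbb{I}_{\{|x|>M\}}\bigr\|_\omega +B^{-\mu+\frac{1}{2}} \bigl\| \mathcal{F}[u](B \,\cdot) \bigr\|_{H^{\mu}(\mathbb{R}\setminus [-1,1])} +e^{-\frac{N}{24}}\bigl(\|u\|_\omega+\|u\| \, M^\mu\bigr)\Bigr),$$ where $\|\mathcal{F}[u](B\,\cdot)\|_{H^{\mu}(\mathbb{R}\setminus[-1,1])}$ is the Sobolev $H^\mu$ norm, on the set $\mathbb R\setminus[-1,1]$, of the function $\xi\mapsto\mathcal F[u](B\xi)$.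
   Context: $P_N$ is the space of polynomials of degree at most $N$; $\|f\|_w=(\int |f|^2w)^{1/2}$ for a weight $w$, and $\|f\|$ is the unweighted $L^2(\mathbb R)$ norm. $\mathbb I_A$ is the indicator function of $A$. The Fourier transform is $\mathcal F[f](\xi)=\frac{1}{\sqrt{2\pi}}\int_{\mathbb R}e^{-i\xi x}f(x)\,dx$. $H^\mu$ denotes the (possibly fractional-order) Sobolev space. For $\mu>-\tfrac12$, $\beta>0$, $\widehat{\Pi}_N^{(\mu,\beta)}$ is the orthogonal projection of $L^2_{|x|^{2\mu}}(\mathbb R)$ (inner product $\int_{\mathbb R} f\bar g|x|^{2\mu}dx$) onto $\widehat P_N^{\beta,H}=\{e^{-\beta^2x^2/2}p(x):p\in P_N\}$, which is the span of the first $N+1$ scaled generalized Hermite functions $\widehat H_n^{(\mu)}(\beta x)$, $0\le n\le N$. *)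

(* Defs.v *)
(* R : realType, complex numbers R[i] (mathcomp-real-closed). *)
From mathcomp Require Import all_boot all_order all_algebra.
From mathcomp Require Import all_classical all_reals all_analysis.
From mathcomp Require Export complex.
Set Implicit Arguments. Unset Strict Implicit. Unset Printing Implicit Defensive.
Import Order.TTheory GRing.Theory Num.Theory.
Local Open Scope ring_scope.
Local Open Scope classical_set_scope.
Local Open Scope complex_scope.

Section Defs.
Context {R : realType}.

(* Lebesgue measure on R *)
Definition leb := (@lebesgue_measure R).

(* |z|^2 for z complex, as a real number *)
Definition cabs2 (z : R[i]) : R := complex.Re z ^+ 2 + complex.Im z ^+ 2.

(* square root on the extended reals (+oo for +oo) *)
Definition esqrt (x : \bar R) : \bar R :=
  match x with EFin r => (Num.sqrt r)%:E | +oo%E => +oo%E | -oo%E => 0%E end.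

(* Lebesgue measurability of a complex-valued function on R *)
Definition cmeasurable (f : R -> R[i]) : Prop :=
  measurable_fun setT (fun x => complex.Re (f x)) /\ measurable_fun setT (fun x => complex.Im (f x)).

(* weighted L^2 norm ||f||_w = (\int |f|^2 w)^(1/2), with values in \bar R *)
Definition wnorm (w : R -> R) (f : R -> R[i]) : \bar R :=
  esqrt (\int[leb]_x ((cabs2 (f x) * w x)%:E))%E.

(* unweighted L^2(R) norm *)
Definition l2norm (f : R -> R[i]) : \bar R := wnorm (fun _ => 1) f.

(* the weight |x|^{2 mu} *)
Definition hweight (mu : R) (x : R) : R := `|x| `^ (2 * mu).

(* Lebesgue integral of a complex-valued function over A *)
Definition cint (A : set R) (f : R -> R[i]) : R[i] :=
  (Rintegral leb A (fun x => complex.Re (f x))) +i* (Rintegral leb A (fun x => complex.Im (f x))).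

(* e^{i t} *)
Definition expi (t : R) : R[i] := (cos t) +i* (sin t).

(* truncated Fourier integral (2 pi)^{-1/2} \int_{-n}^{n} e^{-i xi x} u(x) dx *)
Definition ft_trunc (u : R -> R[i]) (n : nat) (xi : R) : R[i] :=
  ((Num.sqrt (2 * pi))^-1)%:C *
  cint `[(- n%:R)%R, n%:R] (fun x => expi (- (xi * x)) * u x).

(* g is (a representative of) the L^2 (Plancherel) Fourier transform F[u] of
   u in L^2(R): the truncated integrals converge to g in L^2. *)
Definition is_fourier (u g : R -> R[i]) : Prop :=
  cmeasurable g /\
  ((fun n : nat => \int[leb]_xi ((cabs2 (ft_trunc u n xi - g xi))%:E)) @ \oo
     --> 0%E)%E.

(* the set R \ [-1, 1] *)
Definition Omega : set R := [set x | 1 < `|x|].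

(* Sobolev H^mu(R \ [-1,1]) norm (restriction / quotient norm):
   inf of ||(1+eta^2)^{mu/2} F[G]||_{L^2} over all G in L^2(R) with G = f a.e.
   on R \ [-1,1]; +oo if there is no such G in H^mu(R). *)
Definition hnorm_ext (mu : R) (f : R -> R[i]) : \bar R :=
  ereal_inf [set e : \bar R | exists G g : R -> R[i],
    [/\ cmeasurable G,
        (\int[leb]_x ((cabs2 (G x))%:E) < +oo)%E,
        {ae leb, forall x, Omega x -> G x = f x},
        is_fourier G g &
        e = esqrt (\int[leb]_eta (((1 + eta ^+ 2) `^ mu * cabs2 (g eta))%:E))%E]].

(* \hat P_N^{beta,H} = { e^{-beta^2 x^2 / 2} p(x) : p in P_N } (complex coefficients) *)
Definition hspace (beta : R) (N : nat) : set (R -> R[i]) :=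
  [set v | exists p : {poly R[i]}, (size p <= N.+1)%N /\
     v = (fun x => (expR (- (beta ^+ 2 * x ^+ 2) / 2))%:C * p.[x%:C])].

(* v = \hat Pi_N^{(mu,beta)} u : v lies in \hat P_N^{beta,H} and u - v is orthogonal
   to \hat P_N^{beta,H} in L^2_{|x|^{2mu}} (inner product \int f conj(g) |x|^{2mu}). *)
Definition is_wproj (mu beta : R) (N : nat) (u v : R -> R[i]) : Prop :=
  hspace beta N v /\
  forall phi, hspace beta N phi ->
    Rintegral leb setT (fun x => complex.Re ((u x - v x) * (phi x)^*) * hweight mu x) = 0 /\
    Rintegral leb setT (fun x => complex.Im ((u x - v x) * (phi x)^*) * hweight mu x) = 0.

End Defs.

(* Main.v *)
Require Import Defs.
From mathcomp Require Import all_boot all_order all_algebra.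
From mathcomp Require Import all_classical all_reals all_analysis.
From mathcomp Require Import complex ring lra zify.
Set Implicit Arguments.
Unset Strict Implicit.
Unset Printing Implicit Defensive.
Import Order.TTheory GRing.Theory Num.Theory.
Import numFieldNormedType.Exports.
Import measurable_realfun.
Local Open Scope ring_scope.
Local Open Scope classical_set_scope.

(** The complex problem is reduced to a real one by means of the Hartley transform
    [f |-> (2 pi)^(-1/2) int f(x) cas(xi x) dx], [cas = cos + sin], which maps real
    functions to real functions, is its own inverse on [L^2], and determines the
    Fourier transform by taking even and odd parts.

    Let [h] be the Hartley transform of a real [f], let [G] extend [h(B .)] from
    [|xi| > 1] to the line and let [k] be the transform of [G].  Then
    [f = B k(B .) + f2], where [f2] is the transform of [d = h - G(./B)], a function
    supported in [-B, B].  The first part has weighted norm at most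
    [B^(1/2 - mu) || (1 + x^2)^(mu/2) k ||].  For the second, put
    [l = beta^2 x^2 / 2] and [X(l) = e^(-l) sum_(j <= N/8) l^j / j!].  By the Chernoff
    bound [0 <= 1 - X <= e^(-N/24)] for [l <= N/24], that is for [|x| <= M], and
    replacing [cas] in [f2] by a Taylor polynomial turns [X f2] into
    [e^(-l) P(x)], [deg P <= N], up to an error
    [O(e^(-N/12) ||d||_1 e^(-beta^2 x^2 / 24))].  The theorem follows by writing
    [f - e^(-l) P = (1 - X) f + X (f - f2) + (X f2 - e^(-l) P)] and because the
    projection is the best approximation. *)

(** * Square-integrable functions on the line *)

(** The projection enters through orthogonality alone, so a single explicit element e^(-l) P of the
    space suffices. The obstacle is that a Taylor polynomial of [cas] is useful only for |x| of the
    order of M, while the norm is taken over the whole line. Multiplying by X cures this within the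
    space: X is close to 1 on [-M, M], and it is at most 4^K e^(-3l/4), K = N/8, which beats the
    growth of the Taylor error. The price is that the degree N is shared, 2K for X and N - 2K for
    the Taylor polynomial.

    Everything is proved for squared norms, where e^(-N/24) becomes e^(-N/12); M and B enter through
    12 B^2 = N beta^2 and M = B / beta^2. The Sobolev norm is an infimum over extensions, so G stays
    arbitrary until the very end.

    On L^2 the transform is handled by duality with indicators of intervals: their Poisson integrals
    are explicit, and by Lebesgue differentiation they determine an L^2 function almost
    everywhere. *)

Section L2.
Context {R : realType}.
Local Notation mu := (@lebesgue_measure R).
Local Notation int f := (Rintegral mu setT f).
Implicit Types f g h : R -> R.

Definition intg f := mu.-integrable setT (EFin \o f).

Definition sqint f := measurable_fun setT f /\ intg (fun x => f x ^+ 2).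

Lemma intg_measurable f : intg f -> measurable_fun setT f.
Proof. by move=> /integrableP[/measurable_EFinP]. Qed.

Lemma intg_bd f g : measurable_fun setT f -> intg g ->
  (forall x, `|f x| <= g x) -> intg f.
Proof.
move=> mf ig fg; apply: le_integrable ig => //; first exact/measurable_EFinP.
by move=> x _ /=; rewrite lee_fin (le_trans (fg x))// ler_norm.
Qed.

Lemma intgD f g : intg f -> intg g -> intg (fun x => f x + g x).
Proof. by move=> /integrableD-/[apply]; apply. Qed.

Lemma intgB f g : intg f -> intg g -> intg (fun x => f x - g x).
Proof. by move=> /integrableB-/[apply]; apply. Qed.

Lemma intgZ k f : intg f -> intg (fun x => k * f x).
Proof. by move=> /(integrableZl measurableT) => /(_ k). Qed.

Lemma intgM_bd f g M : intg f -> measurable_fun setT g ->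
  (forall x, `|g x| <= M) -> intg (fun x => f x * g x).
Proof.
move=> fi mg gM; apply: (@intg_bd _ (fun x => M * `|f x|)).
- by apply: measurable_funM => //; exact: intg_measurable.
- by apply: intgZ; exact: (integrable_abse fi).
- by move=> x; rewrite normrM mulrC ler_wpM2r.
Qed.

Lemma sqint_mul f g : sqint f -> sqint g -> intg (fun x => f x * g x).
Proof.
move=> [mf f2] [mg g2]; apply: (intg_bd _ (intgD f2 g2)) => [|x].
  exact: measurable_funM.
rewrite normrM -(real_normK (num_real (f x))) -(real_normK (num_real (g x))).
by have := sqr_ge0 (`|f x| - `|g x|); nra.
Qed.

Lemma sqint_bd f g : measurable_fun setT f -> sqint g ->
  (forall x, `|f x| <= `|g x|) -> sqint f.
Proof.
move=> mf [mg g2] fg; split=> //; apply: (intg_bd _ g2) => [|x].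
  exact: measurable_funX.
by rewrite ger0_norm ?sqr_ge0// -(real_normK (num_real (f x)))
  -(real_normK (num_real (g x))) lerXn2r ?nnegrE.
Qed.

Lemma sqintD f g : sqint f -> sqint g -> sqint (fun x => f x + g x).
Proof.
move=> [mf f2] [mg g2]; split; first exact: measurable_funD.
apply: (intg_bd _ (intgZ 2 (intgD f2 g2))) => [|x].
  by apply: measurable_funX; exact: measurable_funD.
by rewrite ger0_norm ?sqr_ge0//; have := sqr_ge0 (f x - g x); nra.
Qed.

Lemma sqintZ k f : sqint f -> sqint (fun x => k * f x).
Proof.
move=> [mf f2]; split; first exact: measurable_funM.
have := intgZ (k ^+ 2) f2.
by apply: eq_integrable => // x _ /=; rewrite exprMn.
Qed.

Lemma sqintB f g : sqint f -> sqint g -> sqint (fun x => f x - g x).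
Proof.
move=> f2 /(sqintZ (-1)) g2; have := sqintD f2 g2.
by under eq_fun do rewrite mulN1r.
Qed.

Lemma intZ k f : intg f -> int (fun x => k * f x) = k * int f.
Proof. by move=> fi; rewrite RintegralZl. Qed.

Lemma intD f g : intg f -> intg g -> int (fun x => f x + g x) = int f + int g.
Proof. by move=> fi gi; rewrite RintegralD. Qed.

Lemma intB f g : intg f -> intg g -> int (fun x => f x - g x) = int f - int g.
Proof. by move=> fi gi; rewrite RintegralB. Qed.

Lemma int_ge0 f : (forall x, 0 <= f x) -> 0 <= int f.
Proof. by move=> f0; apply: Rintegral_ge0. Qed.

Lemma EFin_int f : intg f -> (int f)%:E = (\int[mu]_x (f x)%:E)%E.
Proof. by move=> fi; rewrite /Rintegral fineK//; exact: integrable_fin_num. Qed.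

Lemma le_int f g : intg f -> intg g -> (forall x, f x <= g x) -> int f <= int g.
Proof. by move=> fi gi fg; apply: le_Rintegral. Qed.

Lemma cauchy_schwarz f g : sqint f -> sqint g ->
  int (fun x => f x * g x) ^+ 2 <= int (fun x => f x ^+ 2) * int (fun x => g x ^+ 2).
Proof.
move=> fs gs; have fg := sqint_mul fs gs.
set a := int (fun x => f x ^+ 2); set b := int (fun x => g x ^+ 2).
set c := int (fun x => f x * g x).
have key s t : 0 <= s ^+ 2 * a + 2 * (s * t) * c + t ^+ 2 * b.
  have -> : s ^+ 2 * a + 2 * (s * t) * c + t ^+ 2 * b =
      int (fun x => (s * f x + t * g x) ^+ 2).
    rewrite -!intZ//; [|exact: gs.2|exact: fs.2].
    rewrite -!intD//.
    - by apply: eq_Rintegral => x _; rewrite sqrrD !exprMn; ring.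
    - by apply: intgD; [apply: intgZ; exact: fs.2|exact: intgZ].
    - by apply: intgZ; exact: gs.2.
    - by apply: intgZ; exact: fs.2.
    - exact: intgZ.
  by apply: int_ge0 => x; exact: sqr_ge0.
have a0 : 0 <= a by apply: int_ge0 => x; exact: sqr_ge0.
have b0 : 0 <= b by apply: int_ge0 => x; exact: sqr_ge0.
have [b00|bn0] := eqVneq b 0.
  have [->|cn0] := eqVneq c 0; first by rewrite expr0n mulr_ge0.
  (* With [b = 0] the form at this point equals [- c ^+ 2], which is negative. *)
  have := key c (- (a + 1) / 2); rewrite b00 mulr0 addr0.
  have c20 : 0 < c ^+ 2 by rewrite exprn_even_gt0.
  by move=> H; exfalso; nra.
have bp : 0 < b by rewrite lt_neqAle eq_sym bn0.
have := key b (- c).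
have -> : b ^+ 2 * a + 2 * (b * - c) * c + (- c) ^+ 2 * b = b * (a * b - c ^+ 2).
  by ring.
by rewrite pmulr_rge0// subr_ge0.
Qed.

(** The extended integral allows a limit [h] not yet known to be square integrable; [L2cvg_sqint]
    recovers this from the finiteness of one of the integrals. *)
Definition L2cvg (F : nat -> R -> R) h :=
  (\int[mu]_x ((F n x - h x) ^+ 2)%:E @[n --> \oo] --> 0)%E.

Lemma L2cvg_real F h : (forall n, sqint (F n)) -> sqint h -> L2cvg F h ->
  int (fun x => (F n x - h x) ^+ 2) @[n --> \oo] --> (0:R).
Proof. by move=> Fs hs Fh; apply: fine_cvg. Qed.

Lemma sqint_lty f : measurable_fun setT f ->
  (\int[mu]_x (f x ^+ 2)%:E < +oo)%E -> sqint f.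
Proof.
move=> mf f2; split=> //; apply/integrableP; split.
  by apply/measurable_EFinP; exact: measurable_funX.
rewrite (le_lt_trans _ f2)//; apply: ge0_le_integral => //.
- by apply: measurableT_comp => //; apply/measurable_EFinP; exact: measurable_funX.
- by apply/measurable_EFinP; exact: measurable_funX.
- by move=> x _ /=; rewrite lee_fin ger0_norm// sqr_ge0.
Qed.

Lemma L2cvg_sqint F h : (forall n, sqint (F n)) -> measurable_fun setT h ->
  L2cvg F h -> sqint h.
Proof.
move=> Fs mh /fine_cvgP[Ffin _].
case: Ffin => n _ /(_ n (leqnn n)) fin.
have mFh : measurable_fun setT (fun x => F n x - h x).
  by apply: measurable_funB => //; exact: (Fs n).1.
have sFh : sqint (fun x => F n x - h x).
  by apply: sqint_lty => //; rewrite -ge0_fin_numE//; apply: integral_ge0 => x _;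
    rewrite lee_fin sqr_ge0.
have := sqintB (Fs n) sFh.
by under eq_fun do rewrite opprB addrC subrK.
Qed.

Lemma cvg_sqr_le (a b : nat -> R) (l c : R) :
  (forall n, (a n - l) ^+ 2 <= b n * c) -> b n @[n --> \oo] --> (0:R) ->
  a n @[n --> \oo] --> l.
Proof.
move=> ab b0; apply/subr_cvg0.
have s0 : Num.sqrt (b n * c) @[n --> \oo] --> (0 : R).
  rewrite -[X in _ --> X](@sqrtr0 R) -[in X in _ --> X](mul0r c).
  apply: continuous_cvg; first exact: sqrt_continuous.
  by apply: cvgM => //; exact: cvg_cst.
have Ns0 : - Num.sqrt (b n * c) @[n --> \oo] --> (0 : R).
  by rewrite -[X in _ --> X]oppr0; exact: cvgN.
apply: (squeeze_cvgr _ Ns0 s0); apply: nearW => n.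
rewrite -ler_norml -sqrtr_sqr ler_sqrt//.
by rewrite (le_trans _ (ab n))// sqr_ge0.
Qed.

Lemma L2cvg_int F h J : (forall n, sqint (F n)) -> sqint h -> sqint J ->
  L2cvg F h ->
  int (fun x => F n x * J x) @[n --> \oo] --> int (fun x => h x * J x).
Proof.
move=> Fs hs Js Fh.
apply: (cvg_sqr_le (b := fun n => int (fun x => (F n x - h x) ^+ 2))
   (c := int (fun x => J x ^+ 2))); last exact: L2cvg_real.
move=> n; rewrite -intB//; [|exact: sqint_mul|exact: sqint_mul].
under eq_Rintegral do rewrite -mulrBl.
by apply: cauchy_schwarz => //; exact: sqintB.
Qed.

(** Testing the convergence against [h] itself: the pairings of [F n] with [h] tend to the squared
    norm [a] of [h], and Cauchy-Schwarz bounds their squares by [c * a]. *)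
Lemma L2cvg_norm_le F h c : (forall n, sqint (F n)) -> sqint h -> L2cvg F h ->
  (forall n, int (fun x => F n x ^+ 2) <= c) -> int (fun x => h x ^+ 2) <= c.
Proof.
move=> Fs hs Fh Fc; set a := int _.
have a0 : 0 <= a by apply: int_ge0 => x; exact: sqr_ge0.
have Fha : int (fun x => F n x * h x) ^+ 2 @[n --> \oo] --> a ^+ 2.
  by have H := L2cvg_int Fs hs hs Fh; rewrite !expr2; exact: cvgM.
have le : a ^+ 2 <= c * a.
  apply: (closed_cvg_le _ _ Fha) || apply: (cvgr_le _ Fha) || idtac.
  apply: limr_le_cst || idtac.
  have : (\forall n \near \oo, int (fun x => F n x * h x) ^+ 2 <= c * a).
    apply: nearW => n; rewrite (le_trans (cauchy_schwarz (Fs n) hs))// ler_wpM2r//.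
  by move=> H; rewrite -(cvg_lim _ Fha)//; apply: limr_le => //; apply: cvgP Fha.
have [->|an0] := eqVneq a 0.
  by rewrite (le_trans _ (Fc 0%N))// int_ge0// => x; exact: sqr_ge0.
by rewrite -(@ler_pM2r _ a) ?lt_neqAle ?[_ == a]eq_sym ?an0// -expr2.
Qed.

(** * Affine changes of variable *)

Lemma ge0_int_affine (F : R -> \bar R) (c d : R) : c != 0 ->
  measurable_fun setT F -> (forall x, 0 <= F x)%E ->
  (\int[mu]_x F (c * x + d)%R = `|c|^-1%:E * \int[mu]_x F x)%E.
Proof.
move=> c0 mF F0.
have nc : 0 < `|c| by rewrite normr_gt0.
pose c' : {nonneg R} := NngNum (ltW nc).
pose phi : R -> R := fun x => c * x + d.
have mphi : measurable_fun (setT : set (measurableTypeR R))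
   (phi : R -> measurableTypeR R).
  by apply: measurable_funD => //; exact: measurable_funM.
(* By uniqueness of Lebesgue measure, [|c|] times its image under [phi] is Lebesgue measure again:
   both agree on half-open intervals. *)
pose nu := mscale c'
  (measure_function_pushforward__canonical__measure_function_Measure mu mphi).
have E X : measurable X -> mu X = nu X.
  apply: (@lebesgue_measure_unique R nu) => _ [[a b] _ <-].
  rewrite [RHS](_ : _ = (`|c|%:E * mu (phi @^-1` `]a, b]))%E)//.
  (* A negative slope reverses the interval and moves its closed end to the left; the length is not
     affected. *)
  move: c0; rewrite neq_lt => /orP[c0|c0].
    have -> : phi @^-1` `]a, b] = `[(b - d) / c, (a - d) / c[.
      apply/seteqP; split => x /=; rewrite !in_itv/= /phi => /andP[h1 h2]; apply/andP; split.
      - by rewrite ler_ndivrMr// mulrC lerBrDr.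
      - by rewrite ltr_ndivlMr// mulrC ltrBlDr.
      - by rewrite -ltrBlDr mulrC -ltr_ndivlMr.
      - by rewrite -lerBrDr mulrC -ler_ndivrMr.
    rewrite !lebesgue_measure_itv/= !lte_fin ltr_ndivrMr// divfK ?lt_eqF// ltrD2r.
    case: ifPn => // _; last by rewrite mule0.
    rewrite -!EFinD -EFinM ltr0_norm//; congr EFin; field; rewrite lt_eqF//.
  have -> : phi @^-1` `]a, b] = `](a - d) / c, (b - d) / c].
    apply/seteqP; split => x /=; rewrite !in_itv/= /phi => /andP[h1 h2]; apply/andP; split.
    - by rewrite ltr_pdivrMr// mulrC ltrBlDr.
    - by rewrite ler_pdivlMr// mulrC lerBrDr.
    - by rewrite -ltrBlDr mulrC -ltr_pdivrMr.
    - by rewrite -lerBrDr mulrC -ler_pdivlMr.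
  rewrite !lebesgue_measure_itv/= !lte_fin ltr_pdivrMr// divfK ?gt_eqF// ltrD2r.
  case: ifPn => // _; last by rewrite mule0.
  rewrite -!EFinD -EFinM gtr0_norm//; congr EFin; field; rewrite gt_eqF//.
have -> : (\int[mu]_x F x = \int[nu]_x F x)%E.
  by apply: eq_measure_integral => A mA _; exact: E.
rewrite /nu ge0_integral_mscale// (ge0_integral_pushforward mphi)//.
by rewrite muleA -EFinM mulVf ?gt_eqF// mul1e.
Qed.

Lemma measurable_affine c d : measurable_fun (setT : set R) (fun x : R => c * x + d).
Proof. by apply: measurable_funD => //; exact: measurable_funM. Qed.

Lemma intg_ge0P f : measurable_fun setT f -> 
  (\int[mu]_x (`|f x|)%:E < +oo)%E -> intg f.
Proof. by move=> mf foo; apply/integrableP; split=> //; exact/measurable_EFinP. Qed.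

Lemma intg_affine f c d : c != 0 -> intg f -> intg (fun x => f (c * x + d)).
Proof.
move=> c0 fi; have mf := intg_measurable fi; apply: intg_ge0P.
  by apply: measurableT_comp => //; exact: measurable_affine.
rewrite (ge0_int_affine d c0 (F := fun x => `|f x|%:E)).
- by have /integrableP[_ foo] := fi; rewrite lte_mul_pinfty.
- by apply/measurable_EFinP; exact: measurableT_comp.
- by move=> x; rewrite lee_fin.
Qed.

Lemma int_affine f c d : c != 0 -> intg f ->
  int (fun x => f (c * x + d)) = `|c|^-1 * int f.
Proof.
move=> c0 fi; apply: EFin_inj; rewrite EFinM !EFin_int//; last exact: intg_affine.
rewrite [LHS]integralE [in RHS]integralE muleBr//; last first.
  apply: fin_num_adde_defl; rewrite fin_numN.
  by apply: integrable_fin_num => //; exact: integrable_funeneg.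
have mf : measurable_fun setT (fun x => (f x)%:E) by case/integrableP: fi.
rewrite -(ge0_int_affine d c0 (F := (fun x => (f x)%:E)^\+%E))//; last exact: measurable_funepos.
rewrite -(ge0_int_affine d c0 (F := (fun x => (f x)%:E)^\-%E))//; last exact: measurable_funeneg.
by congr (_ - _)%E; apply: eq_integral => x _; rewrite ?funeposE ?funenegE.
Qed.

Lemma negligible_affine (A : set R) c d : c != 0 ->
  mu.-negligible A -> mu.-negligible [set x | A (c * x + d)].
Proof.
move=> c0 [B [mB B0 AB]]; exists [set x | B (c * x + d)]; split.
- by rewrite -[X in measurable X]setTI; exact: measurable_affine.
- have H := ge0_int_affine d c0 (F := fun x => (\1_B x)%:E).
  rewrite -[X in mu X]setIT -integral_indic//.
    rewrite [LHS]H//; last by apply/measurable_EFinP; exact: measurable_indic.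
    rewrite [X in (_ * X)%E](_ : _ = mu B); first by rewrite B0 mule0.
    by rewrite integral_indic// setIT.
  by rewrite -[X in measurable X]setTI; exact: measurable_affine.
- by move=> x /= /AB.
Qed.

(** * Almost everywhere statements and limit theorems *)

Lemma ae_impl (P Q : R -> Prop) : (forall x, P x -> Q x) ->
  {ae mu, forall x, P x} -> {ae mu, forall x, Q x}.
Proof.
by move=> PQ; apply: filterS; [exact: (ae_filter_ringOfSetsType mu)|exact: PQ].
Qed.

Lemma ae_and (P Q : R -> Prop) : {ae mu, forall x, P x} ->
  {ae mu, forall x, Q x} -> {ae mu, forall x, P x /\ Q x}.
Proof. by move=> h1 h2; apply: filterI => //; exact: (ae_filter_ringOfSetsType mu). Qed.

Lemma int_fatou (g : nat -> R -> R) f (C : \bar R) :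
  (forall n, measurable_fun setT (g n)) -> (forall n x, 0 <= g n x) ->
  measurable_fun setT f ->
  {ae mu, forall x, g n x @[n --> \oo] --> f x} ->
  (forall n, \int[mu]_x (g n x)%:E <= C)%E -> (\int[mu]_x (f x)%:E <= C)%E.
Proof.
move=> mg g0 mf gf gC.
have mgE n : measurable_fun setT (fun x => (g n x)%:E) by exact/measurable_EFinP.
have -> : (\int[mu]_x (f x)%:E =
    \int[mu]_x limn_einf (fun n => (g n x)%:E))%E.
  apply: ae_eq_integral => //.
  - exact/measurable_EFinP.
  - apply: measurableT_comp => //; apply: measurable_fun_limn_esup => n.
    by apply: measurableT_comp => //; exact: mgE.
  - apply: ae_impl gf => x gx _.
    have gEx : (g n x)%:E @[n --> \oo] --> (f x)%:E by apply: cvg_EFin => //; exact: nearW.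
    by rewrite is_cvg_limn_einfE; [exact/esym/cvg_lim|exact: cvgP gEx].
apply: (le_trans (fatou mu measurableT mgE _)).
  by move=> n x _; rewrite lee_fin.
rewrite limn_einf_lim; apply: lime_le; first exact: is_cvg_einfs.
apply: nearW => n; apply: (@le_trans _ _ (\int[mu]_x (g n x)%:E)%E) => //.
by apply: ereal_inf_lbound; exists n => //=.
Qed.

Lemma int_dominated (g : nat -> R -> R) f k :
  (forall n, measurable_fun setT (g n)) -> measurable_fun setT f -> intg k ->
  {ae mu, forall x, g n x @[n --> \oo] --> f x} ->
  (forall n x, `|g n x| <= k x) ->
  intg f /\ int (g n) @[n --> \oo] --> int f.
Proof.
move=> mg mf ik gf gk.
have mgE n : measurable_fun setT (fun x => (g n x)%:E) by exact/measurable_EFinP.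
have [|||if_ _ cv] := @dominated_convergence _ _ _ mu setT measurableT
  (fun n x => (g n x)%:E) (fun x => (f x)%:E) (fun x => (k x)%:E) mgE _ _ ik.
- exact/measurable_EFinP.
- by apply: ae_impl gf => x gx _; apply: cvg_EFin => //; exact: nearW.
- by apply/aeW => x n _; rewrite lee_fin.
split=> //; apply: fine_cvg; rewrite fineK//.
by have /integrable_fin_num := if_; apply.
Qed.

(** * Integrals with a parameter and Fubini for bounded kernels *)

Lemma measurable_int_param (k : R * R -> R) :
  measurable_fun setT k -> 
  measurable_fun setT (fun x => int (fun y => k (x, y))).
Proof.
move=> mk; rewrite /Rintegral; apply: measurableT_comp => //.
pose kE z := (k z)%:E.
have mkE : measurable_fun setT kE by exact/measurable_EFinP.
have H1 := measurable_fun_fubini_tonelli_F (m2 := mu) _ (measurable_funepos mkE)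
  (fun=> funepos_ge0 _ _).
have H2 := measurable_fun_fubini_tonelli_F (m2 := mu) _ (measurable_funeneg mkE)
  (fun=> funeneg_ge0 _ _).
(* Tonelli makes the integral of each of the two parts measurable, whether or not it is finite. *)
rewrite [X in measurable_fun _ X](_ : _ =
    fubini_F mu kE^\+ \- fubini_F mu kE^\-)%E.
  exact: emeasurable_funB.
apply/funext => x; rewrite [LHS]integralE.
by congr (_ - _)%E; rewrite /fubini_F; apply: eq_integral => y _;
  rewrite ?funeposE ?funenegE.
Qed.

Section fubini_bd.
Variables (a b : R -> R) (k : R * R -> R) (M : R).
Hypotheses (ia : intg a) (ib : intg b) (mk : measurable_fun setT k)
  (kM : forall z, `|k z| <= M).

Let mk1 x : measurable_fun setT (fun y => k (x, y)).
Proof. exact: measurableT_comp. Qed.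

Let mk2 y : measurable_fun setT (fun x => k (x, y)).
Proof. exact: measurableT_comp. Qed.

Lemma intg_kernel1 x : intg (fun y => b y * k (x, y)).
Proof. by apply: intgM_bd => //; exact: (fun y => kM (x, y)). Qed.

Lemma intg_kernel2 y : intg (fun x => a x * k (x, y)).
Proof. by apply: intgM_bd => //; exact: (fun x => kM (x, y)). Qed.

Let f := fun z : R * R => (a z.1 * (b z.2 * k z))%:E.

Let mf : measurable_fun setT f.
Proof.
apply/measurable_EFinP; apply: measurable_funM.
  by apply: measurableT_comp => //; exact: intg_measurable.
by apply: measurable_funM => //; apply: measurableT_comp => //; exact: intg_measurable.
Qed.

Let M0 : 0 <= M. Proof. exact: le_trans (kM (0, 0)). Qed.

Let if_ : (mu \x mu)%E.-integrable setT f.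
Proof.
apply/integrable12ltyP => //.
have ib' : intg (fun y => `|b y|) by exact: (integrable_abse ib).
have ia' : intg (fun y => `|a y|) by exact: (integrable_abse ia).
have mE (h : R -> R) : intg h -> measurable_fun setT (EFin \o h) by move=> /integrableP[].
have iaM := intgZ (M * int (fun y => `|b y|)) ia'.
(* The integral in [y] of the absolute value is at most [M * |a x|] times the L^1 norm of [b]. *)
apply: (@le_lt_trans _ _ (\int[mu]_x ((M * int (fun y => `|b y|)) * `|a x|)%:E)%E).
  apply: ge0_le_integral => //.
  - by move=> x _; apply: integral_ge0 => y _; exact: abse_ge0.
  - apply: (@measurable_fun_fubini_tonelli_F _ _ _ _ _ mu (abse \o f)) => //.
      exact: measurableT_comp.
    by move=> z; exact: abse_ge0.
  - exact: mE.
  - move=> x _; rewrite mulrAC; set Max := M * `|a x|.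
    have iM := intgZ Max ib'.
    rewrite -intZ// EFin_int//.
    have iK := integrable_abse (intgZ (a x) (intg_kernel1 x)).
    apply: ge0_le_integral => //.
    + by case/integrableP : iK.
    + exact: mE.
    + move=> y _; rewrite /f /= lee_fin !normrM /Max -mulrA mulrCA mulrC -!mulrA.
      by rewrite mulrCA ler_wpM2r ?mulr_ge0//; exact: kM.
by rewrite -EFin_int// ltry.
Qed.

Let inner1 x : (\int[mu]_y f (x, y) = (a x * int (fun y => b y * k (x, y)))%:E)%E.
Proof.
by rewrite -intZ ?EFin_int//; [exact/intgZ/intg_kernel1|exact: intg_kernel1].
Qed.

Let inner2 y : (\int[mu]_x f (x, y) = (b y * int (fun x => a x * k (x, y)))%:E)%E.
Proof.
rewrite -intZ ?EFin_int//; [|exact/intgZ/intg_kernel2|exact: intg_kernel2].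
by apply: eq_integral => x _; rewrite /f /= mulrCA.
Qed.

Lemma intg_fubini : intg (fun x => a x * int (fun y => b y * k (x, y))).
Proof.
have := integrable_fubini_F if_; apply: eq_integrable => // x _.
by rewrite /= -inner1.
Qed.

Lemma fubini_bd : int (fun x => a x * int (fun y => b y * k (x, y))) =
  int (fun y => b y * int (fun x => a x * k (x, y))).
Proof.
have := Fubini if_; rewrite /Rintegral => H; congr fine.
under eq_integral do rewrite -inner1.
by under [RHS]eq_integral do rewrite -inner2.
Qed.

End fubini_bd.

End L2.

(** * Abel summation and the Poisson kernel *)

Section Hartley.
Context {R : realType}.
Local Notation mu := (@lebesgue_measure R).
Local Notation int f := (Rintegral mu setT f).
Implicit Types f g h : R -> R.

Definition cas (t : R) : R := cos t + sin t.

Lemma cas_norm t : `|cas t| <= 2.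
Proof.
rewrite (le_trans (ler_normD _ _))// -[leRHS]/(1 + 1) lerD//; [exact: cos_max|exact: sin_max].
Qed.

Lemma continuous_cas : continuous cas.
Proof. by move=> x; apply: cvgD; [exact: continuous_cos|exact: continuous_sin]. Qed.

Lemma measurable_cas : measurable_fun setT cas.
Proof. exact: continuous_measurable_fun continuous_cas. Qed.

(** The sine is odd in [t], so against an even weight in [t] only the dependence on [x - y]
    survives, and a convolution kernel results. *)
Lemma casM x y t : cas (t * x) * cas (t * y) = cos (t * (x - y)) + sin (t * (x + y)).
Proof. by rewrite (mulrBr t x y) (mulrDr t x y) cosB sinD /cas; ring. Qed.

Definition abel (e : R) (t : R) : R := expR (- (e * `|t|)).

(** The cosine transform of [abel e] over the line, that is [2 * pi] times the usual Poisson kernel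
    of the half-plane. *)
Definition poisson (e : R) (t : R) : R := 2 * e / (e ^+ 2 + t ^+ 2).

Lemma abel_ge0 e t : 0 <= abel e t. Proof. exact: expR_ge0. Qed.

Lemma continuous_abel e : continuous (abel e).
Proof.
move=> x; apply: continuous_comp; last exact: continuous_expR.
by apply: cvgN; apply: cvgM; [exact: cvg_cst|exact: norm_continuous].
Qed.

(** The summand 1 makes the integrand nonnegative, so that the fundamental theorem of calculus
    applies on the half-line before integrability is known. The integral of the cosine alone is
    obtained later by subtracting [int_abel]. *)
Lemma integral_abel_cos1 e t : 0 < e ->
  (\int[mu]_xi (abel e xi * (1 + cos (t * xi)))%:E = (2 / e + poisson e t)%:E)%E.
Proof.
move=> e0.
have et : e ^+ 2 + t ^+ 2 != 0 by rewrite gt_eqF// ltr_wpDr ?sqr_ge0// exprn_gt0.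
have en0 : e != 0 by rewrite gt_eqF.
have cc : continuous (fun xi => abel e xi * (1 + cos (t * xi)) : R).
  move=> x; apply: cvgM; first exact: continuous_abel.
  apply: cvgD; first exact: cvg_cst.
  apply: continuous_comp; last exact: continuous_cos.
  by apply: cvgM; [exact: cvg_cst|exact: cvg_id].
have pos xi : 0 <= abel e xi * (1 + cos (t * xi)).
  by rewrite mulr_ge0 ?abel_ge0// -lerBlDl sub0r cos_geN1.
rewrite ge0_symfun_integralT//; last first.
  by move=> x /=; rewrite /abel normrN mulrN cosN.
(* A primitive on the half-line that tends to 0 at infinity. *)
pose F xi : R := expR (- (e * xi)) *
   (- e^-1 + (t * sin (t * xi) - e * cos (t * xi)) / (e ^+ 2 + t ^+ 2)).
have dF (x : R) : is_derive x 1 F (expR (- (e * x)) * (1 + cos (t * x))).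
  by apply: is_derive_eq => /=; rewrite /GRing.scale/=; field; rewrite et en0.
rewrite -set_itvcy.
rewrite (@ge0_continuous_FTC2y _ (fun xi => abel e xi * (1 + cos (t * xi))) F 0 0).
- rewrite /F /poisson mulr0 oppr0 expR0 mul1r mulr0 sin0 cos0 -EFinB -EFinM; congr EFin.
  by field; rewrite et en0.
- by move=> x _.
- exact: continuous_subspaceT.
- have [M MP] : exists M, forall xi, `|- e^-1 + (t * sin (t * xi) - e * cos (t * xi)) / (e ^+ 2 + t ^+ 2)| <= M.
    exists (e^-1 + (`|t| + e) / (e ^+ 2 + t ^+ 2)) => xi.
    rewrite (le_trans (ler_normD _ _))// lerD ?normrN ?(@gtr0_norm _ e^-1) ?invr_gt0//.
    rewrite normrM normfV (@ger0_norm _ (e ^+ 2 + _)) ?addr_ge0 ?sqr_ge0//.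
    rewrite ler_wpM2r ?invr_ge0 ?addr_ge0 ?sqr_ge0//.
    rewrite (le_trans (ler_normB _ _))// !normrM lerD//.
      by rewrite ler_piMr// sin_max.
    by rewrite (gtr0_norm e0) ler_piMr ?(ltW e0)// cos_max.
  have E0 : expR (- (e * x)) * M @[x --> +oo] --> (0 : R).
    rewrite -[X in _ --> X](mul0r M); apply: cvgM; last exact: cvg_cst.
    apply: (cvg_comp (fun x => e * x) (fun x => expR (- x)) _ (cvgr_expR (R := R))).
    by apply: gt0_cvgMry => //; exact: cvg_id.
  have NE0 : - (expR (- (e * x)) * M) @[x --> +oo] --> (0 : R).
    by rewrite -[X in _ --> X]oppr0; exact: cvgN.
  apply: (squeeze_cvgr _ NE0 E0); apply: nearW => x.
  by rewrite -ler_norml normrM (ger0_norm (expR_ge0 _)) ler_wpM2l ?expR_ge0.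
- by move=> x x0; apply: (@ex_derive _ _ _ _ _ _ _ (dF x)).
- apply: cvg_at_right_filter.
  apply: differentiable_continuous; apply/derivable1_diffP.
  exact: (@ex_derive _ _ _ _ _ _ _ (dF 0)).
- move=> x; rewrite in_itv/= andbT => x0.
  by rewrite derive1E (@derive_val _ _ _ _ _ _ _ (dF x)) /abel gtr0_norm.
Qed.

Lemma intg_abel_cos1 e t : 0 < e -> intg (fun xi => abel e xi * (1 + cos (t * xi))).
Proof.
move=> e0; apply: intg_ge0P.
  apply: measurable_funM; first by apply: continuous_measurable_fun; exact: continuous_abel.
  apply: measurable_funD => //; apply: measurableT_comp; last exact: measurable_funM.
  by apply: continuous_measurable_fun => x; exact: continuous_cos.
under eq_integral => xi _.
  rewrite ger0_norm; last by rewrite mulr_ge0 ?abel_ge0// -lerBlDl sub0r cos_geN1.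
  over.
by rewrite integral_abel_cos1// ltry.
Qed.

Lemma int_abel_cos1 e t : 0 < e ->
  int (fun xi => abel e xi * (1 + cos (t * xi))) = 2 / e + poisson e t.
Proof. by move=> e0; rewrite /Rintegral integral_abel_cos1. Qed.

Lemma intg_abel e : 0 < e -> intg (abel e).
Proof.
move=> /(intg_abel_cos1 0) /(intgZ 2^-1); apply: eq_integrable => // x _ /=.
by rewrite mul0r cos0 mulrCA mulVf// mulr1.
Qed.

Lemma int_abel e : 0 < e -> int (abel e) = 2 / e.
Proof.
move=> e0; have := int_abel_cos1 0 e0.
under eq_Rintegral do rewrite mul0r cos0 mulrC.
rewrite intZ; last exact: intg_abel.
move=> H; apply: (@mulfI _ 2) => //; rewrite H /poisson; field; rewrite gt_eqF//.
Qed.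

Lemma intg_abelM e h M : 0 < e -> measurable_fun setT h -> (forall x, `|h x| <= M) ->
  intg (fun x => abel e x * h x).
Proof. by move=> e0 mh hM; apply: intgM_bd mh hM; exact: intg_abel. Qed.

Lemma measurable_cosM t : measurable_fun setT (fun x : R => cos (t * x)).
Proof.
apply: measurableT_comp; last exact: measurable_funM.
by apply: continuous_measurable_fun => x; exact: continuous_cos.
Qed.

Lemma measurable_sinM t : measurable_fun setT (fun x : R => sin (t * x)).
Proof.
apply: measurableT_comp; last exact: measurable_funM.
by apply: continuous_measurable_fun => x; exact: continuous_sin.
Qed.

Lemma int_abel_cas e x y : 0 < e ->
  int (fun xi => abel e xi * cas (xi * x) * cas (xi * y)) = poisson e (x - y).
Proof.
move=> e0.
have ic t : intg (fun xi => abel e xi * cos (t * xi)).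
  by apply: (intg_abelM e0); [exact: measurable_cosM|move=> ?; exact: cos_max].
have is_ t : intg (fun xi => abel e xi * sin (t * xi)).
  by apply: (intg_abelM e0); [exact: measurable_sinM|move=> ?; exact: sin_max].
have -> : int (fun xi => abel e xi * cas (xi * x) * cas (xi * y)) =
    int (fun xi => abel e xi * cos ((x - y) * xi)) + int (fun xi => abel e xi * sin ((x + y) * xi)).
  rewrite -intD//; apply: eq_Rintegral => xi _.
  by rewrite -mulrA casM mulrDr ![xi * (_ + _)]mulrC.
(* The reflection of [xi] turns this integral into its opposite. *)
have -> : int (fun xi => abel e xi * sin ((x + y) * xi)) = 0.
  have := @int_affine R (fun xi => abel e xi * sin ((x + y) * xi)) (-1) 0 _ (is_ _).
  rewrite oppr_eq0 oner_eq0 normrN1 invr1 mul1r => /(_ isT).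
  under eq_Rintegral do rewrite addr0 mulN1r mulrN sinN /abel normrN mulrN -mulN1r.
  by rewrite intZ//; set I := int _; move=> ?; lra.
have := int_abel_cos1 (x - y) e0.
under eq_Rintegral do rewrite mulrDr mulr1.
by rewrite intD//; [|exact: intg_abel]; rewrite int_abel// addr0 => /addrI.
Qed.

Lemma poisson_ge0 e t : 0 < e -> 0 <= poisson e t.
Proof. by move=> e0; rewrite divr_ge0 ?addr_ge0 ?sqr_ge0// mulr_ge0// ltW. Qed.

Lemma poisson_le e t : 0 < e -> `|poisson e t| <= 2 / e.
Proof.
move=> e0; rewrite ger0_norm ?poisson_ge0//.
have p : 0 < e ^+ 2 + t ^+ 2 by rewrite ltr_wpDr ?sqr_ge0// exprn_gt0.
rewrite ler_pdivrMr// mulrAC ler_pdivlMr// expr2.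
by have := sqr_ge0 t; nra.
Qed.

Lemma is_derive_poisson e (y x : R) : 0 < e ->
  is_derive x 1 (fun x => 2 * atan ((x - y) / e)) (poisson e (x - y)).
Proof.
move=> e0; have en0 : e != 0 by rewrite gt_eqF.
have p : e ^+ 2 + (x - y) ^+ 2 != 0.
  by rewrite gt_eqF// ltr_wpDr ?sqr_ge0// exprn_gt0.
have d2 := is_derive1_atan ((x - y) / e).
have d1 : is_derive x 1 (fun x => (x - y) / e) e^-1.
  by apply: is_derive_eq; rewrite /GRing.scale/=; ring.
have d3 := @is_derive1_comp _ atan (fun x => (x - y) / e) x _ _ d2 d1.
have d4 := is_deriveZ 2 d3.
apply: (is_derive_eq d4); rewrite /GRing.scale/= /poisson.
by field; rewrite en0 p.
Qed.

Lemma continuous_poisson e y : 0 < e -> continuous (fun x : R => poisson e (x - y)).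
Proof.
move=> e0 x; apply: cvgM; first exact: cvg_cst.
apply: cvgV; first by rewrite gt_eqF// ltr_wpDr ?sqr_ge0// exprn_gt0.
apply: cvgD; first exact: cvg_cst.
apply: (@continuous_comp _ _ _ (fun x => x - y) (fun x => x ^+ 2)).
  by apply: cvgB; [exact: cvg_id|exact: cvg_cst].
exact: exprn_continuous.
Qed.

Lemma integral_poisson e : 0 < e ->
  (\int[mu]_t (poisson e t)%:E = (2 * pi)%:E)%E.
Proof.
move=> e0.
have cp : continuous (poisson e).
  by have := @continuous_poisson e 0 e0; under eq_fun do rewrite subr0.
rewrite ge0_symfun_integralT//; last 2 first.
- by move=> t; exact: poisson_ge0.
- by move=> t; rewrite /= /poisson sqrrN.
rewrite -set_itvcy (@ge0_continuous_FTC2y _ _ (fun x => 2 * atan ((x - 0) / e)) 0 pi).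
- by rewrite subr0 mul0r atan0 mulr0 -EFinB -EFinM subr0.
- by move=> x _; exact: poisson_ge0.
- exact: continuous_subspaceT.
- rewrite [X in _ --> X](_ : _ = 2 * (pi / 2)); last by rewrite mulrC divfK.
  apply: cvgM; first exact: cvg_cst.
  apply: (cvg_comp (fun x => (x - 0) / e) _ _ (cvgy_atan (R := R))).
  under eq_fun do rewrite subr0 mulrC.
  have ie0 : 0 < e^-1 by rewrite invr_gt0.
  exact: (gt0_cvgMry ie0 (@cvg_id _ (pinfty_nbhs R))).
- by move=> x x0; apply: (@ex_derive _ _ _ _ _ _ _ (is_derive_poisson 0 x e0)).
- apply: cvg_at_right_filter.
  have : {for (0 : R), continuous (fun x : R => 2 * atan ((x - 0) / e) : R)}.
    apply: differentiable_continuous; apply/derivable1_diffP.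
    exact: (@ex_derive _ _ _ _ _ _ _ (is_derive_poisson 0 0 e0)).
  exact.
- move=> x _; rewrite derive1E (@derive_val _ _ _ _ _ _ _ (is_derive_poisson 0 x e0)).
  by rewrite subr0.
Qed.

Lemma int_poisson_itv e a b y : 0 < e -> a < b ->
  (\int[mu]_(x in `[a, b]) (poisson e (x - y)))%R =
  2 * (atan ((b - y) / e) - atan ((a - y) / e)).
Proof.
move=> e0 ab.
have dP x := @ex_derive _ _ _ _ _ _ _ (is_derive_poisson y x e0).
have cP x : {for x, continuous (fun x => 2 * atan ((x - y) / e))}.
  by apply: differentiable_continuous; apply/derivable1_diffP; exact: dP.
rewrite /Rintegral (@continuous_FTC2 _ _ (fun x => 2 * atan ((x - y) / e)))//=.
- by rewrite mulrBr.
- by apply: continuous_subspaceT; exact: continuous_poisson.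
- split=> [x _||]; first exact: dP.
    by apply: cvg_at_right_filter; exact: cP.
  by apply: cvg_at_left_filter; exact: cP.
- by move=> x _; rewrite derive1E (@derive_val _ _ _ _ _ _ _ (is_derive_poisson y x e0)).
Qed.

End Hartley.

(** * Parseval's identity for the Hartley transform *)

Section Parseval.
Context {R : realType}.
Local Notation mu := (@lebesgue_measure R).
Local Notation int f := (Rintegral mu setT f).
Implicit Types f g h phi : R -> R.

Definition hartley0 f (xi : R) : R := int (fun x => f x * cas (xi * x)).

Let kc (z : R * R) : R := cas (z.1 * z.2).

Let mkc : measurable_fun setT kc.
Proof. by apply: measurableT_comp; [exact: measurable_cas|exact: measurable_funM]. Qed.

Let kcM z : `|kc z| <= 2. Proof. exact: cas_norm. Qed.

Lemma measurable_casM (x : R) : measurable_fun setT (fun xi : R => cas (xi * x)).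
Proof.
by apply: measurableT_comp; [exact: measurable_cas|exact: measurable_funM].
Qed.

Lemma measurable_hartley0 f : measurable_fun setT f -> measurable_fun setT (hartley0 f).
Proof.
move=> mf; apply: (@measurable_int_param R (fun z => f z.2 * kc z)).
by apply: measurable_funM => //; exact: measurableT_comp.
Qed.

Lemma hartley0_norm f xi : intg f -> `|hartley0 f xi| <= 2 * int (fun x => `|f x|).
Proof.
move=> fi; have ifc := intg_kernel1 fi mkc kcM xi.
rewrite (le_trans (le_normr_Rintegral measurableT ifc))// -intZ.
  apply: le_int.
  - exact: (integrable_abse ifc).
  - by apply: intgZ; exact: (integrable_abse fi).
  - by move=> x; rewrite normrM mulrC ler_wpM2r// kcM.
exact: (integrable_abse fi).
Qed.

(** The transform of an integrable function is only known to be bounded; the Abel factor makes both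
    exchanges of integrals legitimate. The first brings out the variable of [f], the second that of
    [phi], and [int_abel_cas] evaluates what is left. *)
Lemma parseval_abel e f phi : 0 < e -> intg f -> intg phi ->
  int (fun xi => abel e xi * hartley0 phi xi * hartley0 f xi) =
  int (fun x => f x * int (fun y => phi y * poisson e (x - y))).
Proof.
move=> e0 fi phii.
have ia : intg (fun xi => abel e xi * hartley0 phi xi).
  apply: (intg_abelM e0); first by apply: measurable_hartley0; exact: intg_measurable.
  by move=> xi; exact: hartley0_norm.
rewrite [LHS](fubini_bd ia fi mkc kcM); apply: eq_Rintegral => x _; congr (_ * _).
have ic : intg (fun xi => abel e xi * cas (xi * x)).
  apply: (intg_abelM e0); first exact: measurable_casM.
  by move=> xi; exact: cas_norm.
under eq_Rintegral do rewrite mulrAC.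
rewrite [LHS](fubini_bd ic phii mkc kcM); apply: eq_Rintegral => y _; congr (_ * _).
exact: int_abel_cas.
Qed.

Lemma poissonN e t : poisson e (- t) = poisson e t :> R.
Proof. by rewrite /poisson sqrrN. Qed.

Lemma continuous_poisson0 e : 0 < e -> continuous (poisson e : R -> R).
Proof. by move=> e0; have := @continuous_poisson R e 0 e0; under eq_fun do rewrite subr0. Qed.

Lemma measurable_poisson e : 0 < e -> measurable_fun setT (poisson e : R -> R).
Proof. by move=> e0; apply: continuous_measurable_fun; exact: continuous_poisson0. Qed.

Let kp e (z : R * R) : R := poisson e (z.1 - z.2).

Let mkp e : 0 < e -> measurable_fun setT (kp e).
Proof.
move=> e0; apply: measurableT_comp; first exact: measurable_poisson.
exact: measurable_funB.
Qed.

Let kpM e z : 0 < e -> `|kp e z| <= 2 / e. Proof. exact: poisson_le. Qed.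

Lemma intg_poisson e : 0 < e -> intg (poisson e : R -> R).
Proof.
move=> e0; apply: intg_ge0P; first exact: measurable_poisson.
under eq_integral do rewrite ger0_norm ?poisson_ge0//.
by rewrite integral_poisson// ltry.
Qed.

Lemma intg_poissonB e x : 0 < e -> intg (fun y : R => poisson e (x - y)).
Proof.
move=> e0; have := @intg_affine R (poisson e) (-1) x _ (intg_poisson e0).
rewrite oppr_eq0 oner_eq0 => /(_ isT).
by under eq_fun do rewrite mulN1r addrC.
Qed.

Lemma int_poissonB e x : 0 < e -> int (fun y : R => poisson e (x - y)) = 2 * pi.
Proof.
move=> e0; have := @int_affine R (poisson e) (-1) x _ (intg_poisson e0).
rewrite oppr_eq0 oner_eq0 normrN1 invr1 mul1r => /(_ isT).
under eq_Rintegral do rewrite mulN1r addrC.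
by move=> ->; rewrite /Rintegral integral_poisson.
Qed.

(* Schur's test for the Poisson kernel *)
Lemma poisson_form_le e f : 0 < e -> intg f -> sqint f ->
  int (fun x => f x * int (fun y => f y * poisson e (x - y))) <=
  2 * pi * int (fun x => f x ^+ 2).
Proof.
move=> e0 fi [mf f2].
have mk := mkp e0; have kM := fun z => kpM z e0.
pose S x := int (fun y => f y ^+ 2 * poisson e (x - y)).
have iS1 x : intg (fun y => f y ^+ 2 * poisson e (x - y)) by exact: (intg_kernel1 f2 mk kM).
have mS : measurable_fun setT S.
  apply: (@measurable_int_param R (fun z => f z.2 ^+ 2 * kp e z)).
  by apply: measurable_funM => //; apply: measurable_funX; exact: measurableT_comp.
have S0 x : 0 <= S x by apply: int_ge0 => y; rewrite mulr_ge0 ?sqr_ge0// poisson_ge0.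
have intS : (\int[mu]_x (S x)%:E = (2 * pi * int (fun x => f x ^+ 2))%:E)%E.
  under eq_integral => x _ do rewrite EFin_int//.
  rewrite (@fubini_tonelli _ _ _ _ _ mu mu (fun z => (f z.2 ^+ 2 * kp e z)%:E)); last 2 first.
  - apply/measurable_EFinP; apply: measurable_funM => //.
    by apply: measurable_funX; exact: measurableT_comp.
  - by move=> z; rewrite lee_fin mulr_ge0 ?sqr_ge0// poisson_ge0.
  have i2 : intg (fun y => 2 * pi * f y ^+ 2) by exact: intgZ.
  rewrite -intZ// EFin_int//; apply: eq_integral => y _ /=.
  under eq_integral do rewrite /kp /= -opprB poissonN.
  rewrite -EFin_int; last exact/intgZ/intg_poissonB.
  by rewrite intZ ?int_poissonB// 1?mulrC//; exact: intg_poissonB.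
have iS : intg S.
  apply: intg_ge0P => //; under eq_integral do rewrite ger0_norm//.
  by rewrite intS ltry.
have intS' : int S = 2 * pi * int (fun x => f x ^+ 2) by rewrite /Rintegral intS.
(* Half of the bound is written with [f ^+ 2] and half with [S], which has integral [2 * pi] times
   that of [f ^+ 2]. The claim then holds pointwise, from 2 f(x) f(y) <= f(x)^2 + f(y)^2 under the
   kernel. *)
have -> : 2 * pi * int (fun x => f x ^+ 2) = int (fun x => pi * f x ^+ 2 + 2^-1 * S x).
  rewrite intD ?intZ// ?intS'; [|exact: intgZ|exact: intgZ].
  by field.
apply: le_int.
- exact: (intg_fubini fi fi mk kM).
- by apply: intgD; exact: intgZ.
move=> x; rewrite -intZ; last exact: (intg_kernel1 fi mk kM x).
have iP := intg_poissonB x e0.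
have -> : pi * f x ^+ 2 + 2^-1 * S x =
  int (fun y => 2^-1 * f x ^+ 2 * poisson e (x - y) + 2^-1 * (f y ^+ 2 * poisson e (x - y))).
  have i1 := intgZ (2^-1 * f x ^+ 2) iP; have i2 := intgZ 2^-1 (iS1 x).
  by rewrite intD// (intZ _ iP) (intZ _ (iS1 x)) int_poissonB// -/(S x); field.
apply: le_int.
- by apply: intgZ; exact: (intg_kernel1 fi mk kM x).
- by apply: intgD; exact: intgZ.
move=> y; have p0 := poisson_ge0 (x - y) e0.
rewrite -subr_ge0 [X in 0 <= X](_ : _ = 2^-1 * (f x - f y) ^+ 2 * poisson e (x - y)).
  by apply: mulr_ge0 => //; apply: mulr_ge0; rewrite ?sqr_ge0// invr_ge0.
by field.
Qed.

Lemma cvg_abel (xi : R) : abel (harmonic n) xi @[n --> \oo] --> (1 : R).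
Proof.
rewrite -[X in _ --> X](@expR0 R); apply: continuous_cvg; first exact: continuous_expR.
rewrite -oppr0; apply: cvgN; rewrite -[X in _ --> X](mul0r `|xi|).
by apply: cvgM; [exact: cvg_harmonic|exact: cvg_cst].
Qed.

Lemma harmonic_gt0' n : 0 < (harmonic n : R).
Proof. by rewrite /harmonic /= invr_gt0. Qed.

Lemma abel_le1 e (t : R) : 0 < e -> abel e t <= 1.
Proof.
by move=> e0; rewrite /abel -[leRHS]expR0 ler_expR oppr_le0 mulr_ge0// ltW.
Qed.

Lemma measurable_abel (e : R) : measurable_fun setT (abel e).
Proof. by apply: continuous_measurable_fun; exact: continuous_abel. Qed.

(** With the Abel factor inserted, the integral is a Poisson form and is bounded by Schur's test;
    Fatou's lemma removes the factor and thus also yields finiteness. *)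
Lemma integral_hartley0_le f : intg f -> sqint f ->
  (\int[mu]_x (hartley0 f x ^+ 2)%:E <= (2 * pi * int (fun x => f x ^+ 2))%:E)%E.
Proof.
move=> fi f2; have mH := measurable_hartley0 (intg_measurable fi).
have mg n : measurable_fun setT (fun x => abel (harmonic n) x * hartley0 f x ^+ 2).
  by apply: measurable_funM; [exact: measurable_abel|exact: measurable_funX].
apply: (int_fatou (g := fun n x => abel (harmonic n) x * hartley0 f x ^+ 2)) => //.
- by move=> n x; rewrite mulr_ge0 ?sqr_ge0// abel_ge0.
- exact: measurable_funX.
- apply/aeW => x; rewrite -[X in _ --> X]mul1r.
  by apply: cvgM; [exact: cvg_abel|exact: cvg_cst].
- move=> n; rewrite -EFin_int ?lee_fin.
    under eq_Rintegral do rewrite expr2 mulrA.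
    by rewrite parseval_abel ?harmonic_gt0'//; apply: poisson_form_le => //; exact: harmonic_gt0'.
  apply: (intg_abelM (M := (2 * int (fun x => `|f x|)) ^+ 2)) => //.
  + exact: harmonic_gt0'.
  + exact: measurable_funX.
  + move=> x; rewrite normrX lerXn2r ?nnegrE ?hartley0_norm// (le_trans (normr_ge0 (hartley0 f x)))//.
    exact: hartley0_norm.
Qed.

Lemma sqint_hartley0 f : intg f -> sqint f -> sqint (hartley0 f).
Proof.
move=> fi f2; apply: sqint_lty; first by apply: measurable_hartley0; exact: intg_measurable.
by rewrite (le_lt_trans (integral_hartley0_le fi f2))// ltry.
Qed.

Lemma int_hartley0_le f : intg f -> sqint f ->
  int (fun x => hartley0 f x ^+ 2) <= 2 * pi * int (fun x => f x ^+ 2).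
Proof.
move=> fi f2; rewrite -lee_fin EFin_int; first exact: integral_hartley0_le.
exact: (sqint_hartley0 fi f2).2.
Qed.

(** * Parseval's identity against intervals *)

Definition itvI (a b : R) : R -> R := \1_(`[a, b]).

Lemma measurable_itvI a b : measurable_fun setT (itvI a b).
Proof. by apply: measurable_indic. Qed.

Lemma intg_itvI a b : intg (itvI a b).
Proof.
apply: intg_ge0P; first exact: measurable_itvI.
under eq_integral do rewrite ger0_norm//.
have -> : (\int[mu]_x (itvI a b x)%:E = mu `[a, b])%E by rewrite integral_indic// setIT.
rewrite lebesgue_measure_itv/=.
by case: ifPn => _; rewrite ?ltry// -EFinB ltry.
Qed.

Lemma sqint_itvI a b : sqint (itvI a b).
Proof.
split; first exact: measurable_itvI.
have := intg_itvI a b; apply: eq_integrable => // x _ /=.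
by rewrite /itvI indicE; case: (_ \in _); rewrite ?expr1n ?expr0n.
Qed.

Lemma int_itvI f a b : int (fun x => f x * itvI a b x) = \int[mu]_(x in `[a, b]) f x.
Proof.
rewrite [RHS]Rintegral_mkcond; apply: eq_Rintegral => x _.
by rewrite /itvI indicE patchE; case: (_ \in _); rewrite ?mulr1 ?mulr0.
Qed.

Lemma int_itvI_poisson e a b x : 0 < e -> a < b ->
  int (fun y => itvI a b y * poisson e (x - y)) =
  2 * (atan ((b - x) / e) - atan ((a - x) / e)).
Proof.
move=> e0 ab; rewrite -int_poisson_itv// -int_itvI; apply: eq_Rintegral => y _.
by rewrite mulrC -opprB poissonN.
Qed.

Lemma cvg_atan_harmonic (z : R) : 0 < z ->
  atan (z / harmonic n) @[n --> \oo] --> pi / 2.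
Proof.
move=> z0; under eq_fun do rewrite /harmonic/= invrK.
apply: (cvg_comp (fun n => z * n.+1%:R) _ _ (cvgy_atan (R := R))).
apply: (cvg_comp (fun n => n.+1%:R : R) (fun x => z * x)).
  apply/cvgryPge => A; near=> n; apply: (@le_trans _ _ n%:R); last by rewrite ler_nat.
  by near: n; exact: nbhs_infty_ger.
exact: (gt0_cvgMry z0 (@cvg_id _ (pinfty_nbhs R))).
Unshelve. all: by end_near. Qed.

(** The Poisson kernel is an approximate identity, read off here from the limits of [atan]. At an
    endpoint one would find half of the jump, hence the exclusion of [a] and [b]. *)
Lemma cvg_itvI_poisson a b x : a < b -> x <> a -> x <> b ->
  2 * (atan ((b - x) / harmonic n) - atan ((a - x) / harmonic n)) @[n --> \oo] -->
  2 * pi * itvI a b x.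
Proof.
move=> ab xa xb.
have pos (z : R) : 0 < z -> atan (z / harmonic n) @[n --> \oo] --> pi / 2.
  exact: cvg_atan_harmonic.
have neg (z : R) : z < 0 -> atan (z / harmonic n) @[n --> \oo] --> - (pi / 2).
  rewrite -oppr_gt0 => /pos H.
  have -> : (fun n => atan (z / harmonic n)) = (fun n => - atan (- z / harmonic n)).
    by apply/funext => n; rewrite mulNr atanN opprK.
  exact: cvgN.
have c2 : (fun=> 2 : R) @ \oo --> (2 : R) by exact: cvg_cst.
pose u n := 2 * (atan ((b - x) / harmonic n) - atan ((a - x) / harmonic n)).
suff [L uL <-] : exists2 L, u n @[n --> \oo] --> L & L = 2 * pi * itvI a b x by [].
rewrite /itvI indicE mem_setE in_itv/=.
have [xlta|ax] := ltP x a.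
  exists (2 * (pi / 2 - pi / 2)); last by rewrite subrr !mulr0.
  by apply: cvgM => //; apply: cvgB; apply: pos; rewrite subr_gt0// (lt_trans xlta).
have {}ax : a < x by rewrite lt_neqAle ax andbT eq_sym; apply/eqP.
have [xleb|bx] := leP x b.
  have {}xleb : x < b by rewrite lt_neqAle xleb andbT; apply/eqP.
  exists (2 * (pi / 2 - - (pi / 2))); last by rewrite /= mulr1; field.
  by apply: cvgM => //; apply: cvgB; [apply: pos; rewrite subr_gt0|apply: neg; rewrite subr_lt0].
exists (2 * (- (pi / 2) - - (pi / 2))); last by rewrite /= subrr !mulr0.
by apply: cvgM => //; apply: cvgB; apply: neg; rewrite subr_lt0// (lt_trans ax).
Qed.

Lemma ae_neq (a : R) : {ae mu, forall x, x <> a}.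
Proof.
exists [set a]; split => //; first exact: lebesgue_measure_set1.
by move=> x /contrapT.
Qed.

(** Dominated convergence on both sides of [parseval_abel] as the Abel parameter tends to 0. The
    choice of an interval makes the Poisson integral a difference of arctangents, bounded by
    [2 * pi]. *)
Lemma parseval_itvI0 f a b : a < b -> intg f -> sqint f ->
  int (fun xi => hartley0 (itvI a b) xi * hartley0 f xi) =
  2 * pi * int (fun x => f x * itvI a b x).
Proof.
move=> ab fi f2.
have Hs := sqint_hartley0 fi f2.
have Is := sqint_hartley0 (intg_itvI a b) (sqint_itvI a b).
have IH := sqint_mul Is Hs.
have [_ L] : intg (fun xi => hartley0 (itvI a b) xi * hartley0 f xi) /\
   int (fun xi => abel (harmonic n) xi * hartley0 (itvI a b) xi * hartley0 f xi)
     @[n --> \oo] --> int (fun xi => hartley0 (itvI a b) xi * hartley0 f xi).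
  apply: (int_dominated (k := fun xi => `|hartley0 (itvI a b) xi * hartley0 f xi|)).
  - move=> n; under eq_fun do rewrite -mulrA.
    by apply: measurable_funM; [exact: measurable_abel|exact: intg_measurable].
  - exact: intg_measurable.
  - exact: (integrable_abse IH).
  - apply/aeW => x.
    have -> : (fun n => abel (harmonic n) x * hartley0 (itvI a b) x * hartley0 f x) =
       (fun n => abel (harmonic n) x * (hartley0 (itvI a b) x * hartley0 f x)).
      by apply/funext => n; rewrite mulrA.
    rewrite -[X in _ --> X]mul1r.
    by apply: cvgM; [exact: cvg_abel|exact: cvg_cst].
  - move=> n x; rewrite -mulrA normrM ler_piMl// ger0_norm ?abel_ge0//.
    by rewrite abel_le1// harmonic_gt0'.
have mth n : measurable_fun setT (fun x : R => 2 * (atan ((b - x) / harmonic n) - atan ((a - x) / harmonic n)) : R).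
  have ma (c : R) : measurable_fun setT (fun x : R => atan ((c - x) / harmonic n)).
    apply: measurableT_comp.
      by apply: continuous_measurable_fun => x; exact: continuous_atan.
    by apply: measurable_funM => //; exact: measurable_funB.
  by apply: measurable_funM => //; exact: measurable_funB.
have [_ Rr] : intg (fun x => f x * (2 * pi * itvI a b x)) /\
   int (fun x => f x * (2 * (atan ((b - x) / harmonic n) - atan ((a - x) / harmonic n))))
     @[n --> \oo] --> int (fun x => f x * (2 * pi * itvI a b x)).
  apply: (int_dominated (k := fun x => 2 * pi * `|f x|)).
  - by move=> n; apply: measurable_funM; [exact: intg_measurable|exact: mth].
  - apply: measurable_funM; first exact: intg_measurable.
    by apply: measurable_funM => //; exact: measurable_itvI.
  - by apply: intgZ; exact: (integrable_abse fi).
  - apply: ae_impl (ae_and (ae_neq a) (ae_neq b)) => x [xa xb].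
    apply: cvgM; first exact: cvg_cst.
    exact: cvg_itvI_poisson.
  - move=> n x; rewrite normrM mulrC ler_wpM2r// normrM (@ger0_norm _ 2)// ler_wpM2l//.
    have := atan_ltpi2 ((b - x) / harmonic n); have := atan_gtNpi2 ((b - x) / harmonic n).
    have := atan_ltpi2 ((a - x) / harmonic n); have := atan_gtNpi2 ((a - x) / harmonic n).
    by move=> *; rewrite ler_norml; apply/andP; split; lra.
have E : (fun n => int (fun xi => abel (harmonic n) xi * hartley0 (itvI a b) xi * hartley0 f xi)) =
   (fun n => int (fun x => f x * (2 * (atan ((b - x) / harmonic n) - atan ((a - x) / harmonic n))))).
  apply/funext => n; rewrite parseval_abel ?harmonic_gt0'//; last exact: intg_itvI.
  by apply: eq_Rintegral => x _; rewrite int_itvI_poisson ?harmonic_gt0'.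
rewrite E in L.
have := cvg_unique (@Rhausdorff R) L Rr => ->.
under eq_Rintegral do rewrite mulrCA.
by rewrite intZ//; apply: intgM_bd fi (measurable_itvI a b) _ => x;
  rewrite /itvI ger0_norm ?indicE//; case: (_ \in _); rewrite ?lexx ?ler01.
Qed.

End Parseval.

(** * The Hartley transform on L^2 *)

Section Plancherel.
Context {R : realType}.
Local Notation mu := (@lebesgue_measure R).
Local Notation int f := (Rintegral mu setT f).
Implicit Types f g h : R -> R.

Definition hartley f (xi : R) : R := (Num.sqrt (2 * pi))^-1 * hartley0 f xi.

Definition trunc f (n : nat) (x : R) : R := f x * itvI (- n%:R) n%:R x.

(** The L^2 transform is defined through truncation to [-n, n], as in [is_fourier], so that the two
    definitions can be compared term by term. *)
Definition is_hartley f h := measurable_fun setT h /\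
  L2cvg (fun n => hartley (trunc f n)) h.

Lemma sqr_c0 : (Num.sqrt (2 * pi) : R)^-1 ^+ 2 = (2 * pi)^-1.
Proof. by rewrite exprVn sqr_sqrtr// mulr_ge0// pi_ge0. Qed.

Lemma sqint_hartley f : intg f -> sqint f -> sqint (hartley f).
Proof. by move=> fi f2; apply: sqintZ; exact: sqint_hartley0. Qed.

Lemma int_hartley_le f : intg f -> sqint f ->
  int (fun x => hartley f x ^+ 2) <= int (fun x => f x ^+ 2).
Proof.
move=> fi f2; under eq_Rintegral do rewrite exprMn sqr_c0.
rewrite intZ; last exact: (sqint_hartley0 fi f2).2.
rewrite -ler_pdivlMl ?invr_gt0 ?mulr_gt0 ?pi_gt0// invrK.
exact: int_hartley0_le.
Qed.

Lemma itvI_norm (a b x : R) : `|itvI a b x| <= 1.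
Proof. by rewrite /itvI indicE; case: (_ \in _); rewrite ?normr1 ?normr0. Qed.

Lemma sqint_trunc_itv f a b : sqint f -> sqint (fun x => f x * itvI a b x).
Proof.
move=> f2; apply: (sqint_bd _ f2).
  by apply: measurable_funM; [exact: f2.1|exact: measurable_itvI].
by move=> x; rewrite normrM ler_piMr// itvI_norm.
Qed.

Lemma intg_trunc_itv f a b : sqint f -> intg (fun x => f x * itvI a b x).
Proof. by move=> f2; apply: sqint_mul => //; exact: sqint_itvI. Qed.

Lemma cvg_trunc f x : trunc f n x @[n --> \oo] --> f x.
Proof.
have [k xk] : exists k, `|x| <= k%:R.
  by exists (Num.truncn `|x|).+1; apply: ltW; exact: truncnS_gt.
apply: cvg_near_cst; exists k => //= n /= kn.
have {}xk : `|x| <= n%:R by rewrite (le_trans xk)// ler_nat.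
rewrite /trunc /itvI indicE mem_set ?mulr1//= in_itv/=.
by rewrite -ler_norml.
Qed.

Lemma sqint_hartley_trunc f n : sqint f -> sqint (hartley (trunc f n)).
Proof. by move=> f2; apply: sqint_hartley; [exact: intg_trunc_itv|exact: sqint_trunc_itv]. Qed.

Lemma is_hartley_sqint f h : sqint f -> is_hartley f h -> sqint h.
Proof.
by move=> f2 [mh fh]; apply: (L2cvg_sqint _ mh fh) => n; exact: sqint_hartley_trunc.
Qed.

Lemma is_hartley_norm_le f h : sqint f -> is_hartley f h ->
  int (fun x => h x ^+ 2) <= int (fun x => f x ^+ 2).
Proof.
move=> f2 fh; have h2 := is_hartley_sqint f2 fh.
apply: (L2cvg_norm_le _ h2 fh.2) => n; first exact: sqint_hartley_trunc.
have tn : sqint (trunc f n) by exact: sqint_trunc_itv.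
rewrite (le_trans (int_hartley_le (intg_trunc_itv _ _ f2) tn))//.
apply: le_int; [exact: tn.2|exact: f2.2|move=> x].
rewrite /trunc exprMn ler_piMr ?sqr_ge0//.
by rewrite -real_normK ?num_real// expr_le1// itvI_norm.
Qed.

Lemma cvg_int_trunc f g : sqint f -> sqint g ->
  int (fun x => trunc f n x * g x) @[n --> \oo] --> int (fun x => f x * g x).
Proof.
move=> f2 g2; have fg := sqint_mul f2 g2.
apply: (int_dominated (k := fun x => `|f x * g x|) _ _ _ _ _).2.
- by move=> n; apply: intg_measurable; apply: sqint_mul => //; exact: sqint_trunc_itv.
- exact: intg_measurable.
- exact: (integrable_abse fg).
- by apply/aeW => x; apply: cvgM; [exact: cvg_trunc|exact: cvg_cst].
- by move=> n x; rewrite /trunc mulrAC normrM ler_piMr// itvI_norm.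
Qed.

Lemma hartley_swap f g : intg f -> intg g ->
  int (fun xi => f xi * hartley g xi) = int (fun x => g x * hartley f x).
Proof.
move=> fi gi.
have mk : measurable_fun setT (fun z : R * R => cas (z.1 * z.2)).
  by apply: measurableT_comp; [exact: measurable_cas|exact: measurable_funM].
have kM (z : R * R) : `|cas (z.1 * z.2)| <= 2 by exact: cas_norm.
have mk' : measurable_fun setT (fun z : R * R => cas (z.2 * z.1)).
  by apply: measurableT_comp; [exact: measurable_cas|exact: measurable_funM].
have kM' (z : R * R) : `|cas (z.2 * z.1)| <= 2 by exact: cas_norm.
have H := fubini_bd fi gi mk kM.
have i1 := intg_fubini fi gi mk kM; have i2 := intg_fubini gi fi mk' kM'.
have -> : int (fun xi => f xi * hartley g xi) =
    int (fun xi => (Num.sqrt (2 * pi))^-1 * (f xi * hartley0 g xi)).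
  by apply: eq_Rintegral => x _; rewrite mulrCA.
have -> : int (fun xi => g xi * hartley f xi) =
    int (fun xi => (Num.sqrt (2 * pi))^-1 * (g xi * hartley0 f xi)).
  by apply: eq_Rintegral => x _; rewrite mulrCA.
rewrite (intZ _ i1) [LHS](congr1 _ H) intZ; last first.
  apply: eq_integrable i2 => // x _ /=; congr (_ * _)%:E.
  by apply: eq_Rintegral => y _ /=; rewrite [y * x]mulrC.
congr (_ * _); apply: eq_Rintegral => x _; congr (_ * _).
by apply: eq_Rintegral => y _ /=; rewrite [y * x]mulrC.
Qed.

Lemma sqint_hartley_itvI a b : sqint (hartley (itvI a b : R -> R)).
Proof. by apply: sqint_hartley; [exact: intg_itvI|exact: sqint_itvI]. Qed.

(** Passage to the limit from the truncations of [f]. In [parseval_itvI_dual] the same passage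
    starts from the symmetry of the kernel, [hartley_swap], instead of Parseval's identity. *)
Lemma parseval_itvI f h a b : a < b -> sqint f -> is_hartley f h ->
  int (fun xi => h xi * hartley (itvI a b) xi) = int (fun x => f x * itvI a b x).
Proof.
move=> ab f2 fh; have h2 := is_hartley_sqint f2 fh.
have H := L2cvg_int (fun n => sqint_hartley_trunc n f2) h2 (sqint_hartley_itvI a b) fh.2.
apply: (cvg_unique (@Rhausdorff R) H).
have -> : (fun n => int (fun x => hartley (trunc f n) x * hartley (itvI a b) x)) =
   (fun n => int (fun x => trunc f n x * itvI a b x)).
  apply/funext => n; rewrite /hartley; under eq_Rintegral do rewrite mulrACA -expr2 sqr_c0.
  have ti := intg_trunc_itv (- n%:R) n%:R f2; have ts := sqint_trunc_itv (- n%:R) n%:R f2.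
  rewrite intZ.
    under eq_Rintegral do rewrite mulrC.
    by rewrite parseval_itvI0// mulrA mulVf ?mul1r// mulf_neq0// gt_eqF ?pi_gt0.
  apply: sqint_mul; first exact: sqint_hartley0.
  by apply: sqint_hartley0; [exact: intg_itvI|exact: sqint_itvI].
by apply: cvg_int_trunc => //; exact: sqint_itvI.
Qed.

Lemma parseval_itvI_dual f h a b : sqint f -> is_hartley f h ->
  int (fun xi => f xi * hartley (itvI a b) xi) = int (fun x => h x * itvI a b x).
Proof.
move=> f2 fh; have h2 := is_hartley_sqint f2 fh.
have H := cvg_int_trunc f2 (sqint_hartley_itvI a b).
apply: (cvg_unique (@Rhausdorff R) H).
have -> : (fun n => int (fun x => trunc f n x * hartley (itvI a b) x)) =
   (fun n => int (fun x => hartley (trunc f n) x * itvI a b x)).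
  apply/funext => n; rewrite (hartley_swap (intg_trunc_itv _ _ f2) (intg_itvI a b)).
  by apply: eq_Rintegral => x _; rewrite mulrC.
apply: L2cvg_int => //; last exact: fh.2.
  by move=> n; exact: sqint_hartley_trunc.
exact: sqint_itvI.
Qed.

(** * Transforms of intervals, Lebesgue differentiation and isometry *)

Lemma hartley0_itvI0 a b : a < b -> hartley0 (itvI a b) 0 = b - a :> R.
Proof.
move=> ab; rewrite /hartley0.
under eq_Rintegral do rewrite mul0r /cas cos0 sin0 addr0 mulr1.
have -> : int (itvI a b) = fine (mu `[a, b]) by rewrite /Rintegral integral_indic// setIT.
by rewrite lebesgue_measure_itv/= lte_fin ab.
Qed.

Lemma hartley0_itvI a b xi : a < b -> xi != 0 ->
  hartley0 (itvI a b) xi =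
  (sin (xi * b) - cos (xi * b) - (sin (xi * a) - cos (xi * a))) / xi :> R.
Proof.
move=> ab xi0; rewrite /hartley0.
under eq_Rintegral do rewrite mulrC.
rewrite int_itvI.
pose F x : R := (sin (xi * x) - cos (xi * x)) / xi.
have dF (x : R) : is_derive x 1 F (cas (xi * x)).
  by apply: is_derive_eq; rewrite /GRing.scale/= /cas; field.
have cF x : {for x, continuous F}.
  apply: differentiable_continuous; apply/derivable1_diffP.
  exact: (@ex_derive _ _ _ _ _ _ _ (dF x)).
rewrite /Rintegral (@continuous_FTC2 _ _ F)//=.
- by rewrite /F -mulrBl.
- apply: continuous_subspaceT => x; apply: continuous_comp; last exact: continuous_cas.
  by apply: cvgM; [exact: cvg_cst|exact: cvg_id].
- split=> [x _||]; first exact: (@ex_derive _ _ _ _ _ _ _ (dF x)).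
    by apply: cvg_at_right_filter; exact: cF.
  by apply: cvg_at_left_filter; exact: cF.
- by move=> x _; rewrite derive1E (@derive_val _ _ _ _ _ _ _ (dF x)).
Qed.

(** In general a translation mixes the transform at [xi] and at [- xi]; for a centred interval the
    sine part vanishes, and the translation becomes a plain factor. *)
Lemma hartley0_itvI_shift x r xi : 0 < r ->
  hartley0 (itvI (x - r) (x + r)) xi = hartley0 (itvI (- r) r) xi * cas (xi * x) :> R.
Proof.
move=> r0; have [->|xi0] := eqVneq xi 0.
  by rewrite !hartley0_itvI0 ?mul0r /cas ?cos0 ?sin0; first ring; lra.
rewrite !hartley0_itvI//; [|lra|lra].
rewrite mulrDr mulrBr mulrN sinD sinB cosD cosB sinN cosN /cas; field.
exact: xi0.
Qed.

Lemma sin_le_id (t : R) : `|sin t| <= `|t|.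
Proof.
wlog t0 : t / 0 <= t.
  move=> H; have [/H//|t0] := leP 0 t.
  by have := H (- t); rewrite sinN !normrN; apply; rewrite oppr_ge0 ltW.
have [|c _] := @MVT_segment R sin cos 0 t t0.
  by apply: continuous_subspaceT; exact: continuous_sin.
by rewrite sin0 !subr0 => ->; rewrite normrM ler_piMl// cos_max.
Qed.

Lemma hartley0_itvI_norm r xi : 0 < r -> `|hartley0 (itvI (- r) r) xi| <= 2 * r :> R.
Proof.
move=> r0; have [->|xi0] := eqVneq xi 0.
  by rewrite hartley0_itvI0 ?ger0_norm; lra.
rewrite hartley0_itvI//; last lra.
rewrite mulrN sinN cosN [X in `|X / _|](_ : _ = 2 * sin (xi * r)); last by ring.
rewrite normrM normfV ler_pdivrMr ?normr_gt0// normrM (ger0_norm (_ : 0 <= 2))//.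
rewrite -mulrA ler_wpM2l// (le_trans (sin_le_id _))// normrM mulrC.
by rewrite (gtr0_norm r0).
Qed.

Lemma locally_integrable_sqint f : sqint f -> locally_integrable setT f.
Proof.
move=> f2; split; [exact: f2.1|exact: openT|move=> K _ cK].
have [M [Mr MK]] := compact_bounded cK.
pose m : R := `|M : R| + 1.
have Km : K `<=` `[- m, m].
  move=> x Kx; rewrite /= in_itv/= -ler_norml; apply: MK => //.
  by rewrite (le_lt_trans (ler_norm M))// ltrDl.
have mK := compact_measurable cK.
have H : (\int[mu]_(x in K) `|f x|%:E <= \int[mu]_(x in `[(- m)%R, m]) `|f x|%:E)%E.
  apply: ge0_subset_integral => //.
  by apply/measurable_EFinP; apply: measurable_funTS; apply: measurableT_comp => //; exact: f2.1.
have : mu.-integrable `[- m, m] (EFin \o f).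
  apply/integrable_mkcond => //.
  have := intg_trunc_itv (- m) m f2; apply: eq_integrable => // x _ /=.
  rewrite patchE /itvI indicE; case: ifP => _; by rewrite ?mulr1 ?mulr0.
move=> /integrableP[_]; exact: le_lt_trans.
Qed.

Lemma cvg_harmonic_right : (harmonic n : R) @[n --> \oo] --> (0 : R)^'+.
Proof.
move=> A [e /= e0 eA].
have /cvgrPdist_lt /(_ e e0) := @cvg_harmonic R.
by apply: filterS => n nn; apply: eA => //; exact: harmonic_gt0'.
Qed.

Lemma lebesgue_avg f : sqint f ->
  {ae mu, forall x, (harmonic n + harmonic n)^-1 *
    int (fun y => f y * itvI (x - harmonic n) (x + harmonic n) y) @[n --> \oo] --> f x}.
Proof.
move=> f2; apply: ae_impl (lebesgue_differentiation (locally_integrable_sqint f2)) => x xL.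
apply/subr_cvg0; apply/norm_cvg0P.
pose v n := `|(harmonic n + harmonic n)^-1 *
    int (fun y => f y * itvI (x - harmonic n) (x + harmonic n) y) - f x|.
suff : (v n)%:E @[n --> \oo] --> 0%E by move=> /fine_cvg.
have d0 : davg f x (harmonic n) @[n --> \oo] --> 0%E.
  exact: (cvg_comp _ _ cvg_harmonic_right xL).
apply: (@squeeze_cvge _ _ _ _ (fun=> 0%E) _ (fun n => davg f x (harmonic n)));
  [apply: nearW => n|exact: cvg_cst|exact: d0].
rewrite lee_fin normr_ge0/= /v /harmonic/=.
have r0 : 0 < (n.+1%:R^-1 : R) by rewrite invr_gt0.
set r : R := n.+1%:R^-1 in r0 *.
have i1 := intg_trunc_itv (x - r) (x + r) f2.
have i2 := intgZ (f x) (intg_itvI (x - r) (x + r)).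
have int1 : int (itvI (x - r) (x + r)) = r + r.
  have := @hartley0_itvI0 (x - r) (x + r); rewrite /hartley0.
  under eq_Rintegral do rewrite mul0r /cas cos0 sin0 addr0 mulr1.
  by move=> -> //; lra.
have i3 := intgB i1 i2.
have i4 : intg (fun y => `|f y * itvI (x - r) (x + r) y - f x * itvI (x - r) (x + r) y|).
  exact: (integrable_abse i3).
have -> : (r + r)^-1 * int (fun y => f y * itvI (x - r) (x + r) y) - f x =
  (r + r)^-1 * int (fun y => f y * itvI (x - r) (x + r) y - f x * itvI (x - r) (x + r) y).
  rewrite intB// intZ; last exact: intg_itvI.
  by rewrite int1; field; rewrite gt_eqF//; lra.
rewrite normrM ger0_norm ?invr_ge0; last lra.
rewrite /davg /iavg.
have -> : lebesgue_measure (ball x r) = (r + r)%:E.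
  by rewrite lebesgue_measure_ball// ltW.
rewrite inver gt_eqF; last lra.
rewrite EFinM lee_pmul2l ?lte_fin ?invr_gt0//; last lra.
apply: (@le_trans _ _ (int (fun y => `|f y * itvI (x - r) (x + r) y - f x * itvI (x - r) (x + r) y|))%:E).
  by rewrite lee_fin; apply: le_normr_Rintegral.
have mfx : measurable_fun setT (fun y => `|(center (f x) \o f) y|%:E).
  apply/measurable_EFinP; apply: measurableT_comp => //; apply: measurable_funB => //.
  exact: f2.1.
(* The ball is an open interval while [itvI] is closed; the endpoints have measure zero. *)
rewrite EFin_int// ball_itv integral_itv_obnd_cbnd; last exact: measurable_funTS.
rewrite integral_itv_bndo_bndc; last exact: measurable_funTS.
rewrite [leRHS]integral_mkcond; apply: ge0_le_integral => //.
- by case/integrableP : i4.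
- by apply/(measurable_restrictT _ _).1 => //; exact: measurable_funTS.
- move=> y _; rewrite patchE -mulrBl normrM /itvI indicE; case: ifP => _ /=.
    by rewrite normr1 mulr1.
  by rewrite normr0 mulr0.
Qed.

(** A smoothed inversion formula: Parseval's identity against the interval around [x], whose
    translation gives the factor [cas (xi * x)]. The multiplier of [h] is a cardinal sine, square
    integrable and bounded by 1. *)
Lemma avg_hartley f h x r : 0 < r -> sqint f -> is_hartley f h ->
  (r + r)^-1 * int (fun y => f y * itvI (x - r) (x + r) y) =
  hartley (fun xi => h xi * ((r + r)^-1 * hartley0 (itvI (- r) r) xi)) x.
Proof.
move=> r0 f2 fh; rewrite -(parseval_itvI _ f2 fh); last lra.
have h2 := is_hartley_sqint f2 fh.
rewrite -intZ; last exact: sqint_mul h2 (sqint_hartley_itvI _ _).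
rewrite /hartley /hartley0 -intZ.
  apply: eq_Rintegral => xi _; rewrite -/(hartley0 _ _) hartley0_itvI_shift//.
  by rewrite [x * xi]mulrC /hartley0; ring.
have s1 : sqint (hartley0 (itvI (- r) r)).
  by apply: sqint_hartley0; [exact: intg_itvI|exact: sqint_itvI].
apply: (intgM_bd (M := 2)).
- exact: sqint_mul h2 (sqintZ _ s1).
- by under eq_fun do rewrite mulrC; exact: measurable_casM.
- by move=> xi; exact: cas_norm.
Qed.

(** By [avg_hartley] the averages of [f] are transforms of functions dominated by [|h|], so their
    norms are at most that of [h]. They tend to [f] almost everywhere, and Fatou's lemma
    concludes. *)
Lemma is_hartley_norm_ge f h : sqint f -> is_hartley f h ->
  int (fun x => f x ^+ 2) <= int (fun x => h x ^+ 2).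
Proof.
move=> f2 fh; have h2 := is_hartley_sqint f2 fh.
pose A n x := (harmonic n + harmonic n)^-1 *
    int (fun y => f y * itvI (x - harmonic n) (x + harmonic n) y).
pose s n xi : R := (harmonic n + harmonic n)^-1 * hartley0 (itvI (- harmonic n) (harmonic n)) xi.
have s2 n : sqint (s n).
  by apply: sqintZ; apply: sqint_hartley0; [exact: intg_itvI|exact: sqint_itvI].
have s1 n xi : `|s n xi| <= 1.
  rewrite /s normrM ger0_norm ?invr_ge0 ?addr_ge0 ?(ltW (harmonic_gt0' _))//.
  rewrite ler_pdivrMl ?addr_gt0 ?harmonic_gt0'// mulr1.
  by rewrite (le_trans (hartley0_itvI_norm _ (harmonic_gt0' _)))// mulrDl mul1r.
have hsi n : intg (fun xi => h xi * s n xi) by exact: sqint_mul.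
have hsq n : sqint (fun xi => h xi * s n xi).
  apply: (sqint_bd _ h2); first exact: intg_measurable.
  by move=> xi; rewrite normrM ler_piMr.
have AE n : A n = hartley (fun xi => h xi * s n xi).
  by apply/funext => x; rewrite /A (avg_hartley x (harmonic_gt0' n) f2 fh).
have As n : sqint (A n) by rewrite AE; exact: sqint_hartley.
rewrite -lee_fin EFin_int; last exact: f2.2.
apply: (int_fatou (g := fun n x => A n x ^+ 2)).
- by move=> n; apply: measurable_funX; exact: (As n).1.
- by move=> n x; exact: sqr_ge0.
- by apply: measurable_funX; exact: f2.1.
- by apply: ae_impl (lebesgue_avg f2) => x H; rewrite !expr2; exact: cvgM.
- move=> n; rewrite -EFin_int; last exact: (As n).2.
  rewrite lee_fin AE (le_trans (int_hartley_le (hsi n) (hsq n)))//.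
  apply: le_int; [exact: (hsq n).2|exact: h2.2|move=> xi].
  rewrite exprMn ler_piMr ?sqr_ge0// -real_normK ?num_real// expr_le1//.
Qed.

Lemma ae_eq_itv f g : sqint f -> sqint g ->
  (forall a b, a < b -> int (fun x => f x * itvI a b x) = int (fun x => g x * itvI a b x)) ->
  {ae mu, forall x, f x = g x}.
Proof.
move=> f2 g2 fg.
apply: ae_impl (ae_and (lebesgue_avg f2) (lebesgue_avg g2)) => x [H1 H2].
apply: (cvg_unique (@Rhausdorff R) H1).
suff -> : (fun n => (harmonic n + harmonic n)^-1 *
    int (fun y => f y * itvI (x - harmonic n) (x + harmonic n) y)) =
  (fun n => (harmonic n + harmonic n)^-1 *
    int (fun y => g y * itvI (x - harmonic n) (x + harmonic n) y)) by exact: H2.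
by apply/funext => n; rewrite fg//; have := @harmonic_gt0' R n; lra.
Qed.

End Plancherel.

(** * Separation of the low frequencies *)

Section Decomposition.
Context {R : realType}.
Local Notation mu := (@lebesgue_measure R).
Local Notation int f := (Rintegral mu setT f).
Implicit Types f g h : R -> R.

Lemma sqint_scale f c : c != 0 -> sqint f -> sqint (fun x => f (c * x)).
Proof.
move=> c0 [mf f2]; split; first by apply: measurableT_comp => //; exact: measurable_funM.
by have := intg_affine 0 c0 f2; under eq_fun do rewrite addr0.
Qed.

Lemma int_scale f c : c != 0 -> intg f -> int (fun x => f (c * x)) = `|c|^-1 * int f.
Proof.
by move=> c0 fi; rewrite -(int_affine 0 c0 fi); under [RHS]eq_Rintegral do rewrite addr0.
Qed.

Lemma ae_eq_int f g : measurable_fun setT f -> measurable_fun setT g ->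
  {ae mu, forall x, f x = g x} -> int f = int g.
Proof.
move=> mf mg fg; congr fine; apply: ae_eq_integral => //.
- exact/measurable_EFinP.
- exact/measurable_EFinP.
- by apply: ae_impl fg => x -> _.
Qed.

Lemma itvI_scale B a b x : 0 < B -> itvI (B * a) (B * b) (B * x) = itvI a b x :> R.
Proof. by move=> B0; rewrite /itvI !indicE !mem_setE !in_itv/= !ler_pM2l. Qed.

Lemma hartley_itvI_scale B a b xi : 0 < B ->
  hartley (itvI a b) (B * xi) = B^-1 * hartley (itvI (B * a) (B * b)) xi :> R.
Proof.
move=> B0; rewrite /hartley mulrCA; congr (_ * _).
have iF : intg (fun y => itvI (B * a) (B * b) y * cas (xi * y)).
  apply: (intgM_bd (M := 2)); first exact: intg_itvI.
    by under eq_fun do rewrite mulrC; exact: measurable_casM.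
  by move=> y; exact: cas_norm.
have H := int_scale (lt0r_neq0 B0) iF; rewrite (gtr0_norm B0) in H.
apply: etrans H.
by apply: eq_Rintegral => x _; rewrite itvI_scale// mulrCA mulrA.
Qed.

Section decomposition.
Variables (f h G k : R -> R) (B : R).
Hypotheses (B0 : 0 < B) (f2 : sqint f) (fh : is_hartley f h)
  (G2 : sqint G) (Gk : is_hartley G k)
  (Gh : {ae mu, forall xi, 1 < `|xi| -> G xi = h (B * xi)}).

(** By [Gh] the difference already vanishes almost everywhere outside [-B, B]. The indicator makes
    it vanish there at every point, which also makes it integrable. *)
Definition band_part (xi : R) : R := (h xi - G (B^-1 * xi)) * itvI (- B) B xi.
Local Notation d := band_part.

Let h2 : sqint h. Proof. exact: is_hartley_sqint fh. Qed.
Let k2 : sqint k. Proof. exact: is_hartley_sqint Gk. Qed.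
Let Bn0 : B != 0. Proof. exact: lt0r_neq0. Qed.
Let Bin0 : B^-1 != 0. Proof. by rewrite invr_eq0. Qed.
Let GB2 : sqint (fun xi => G (B^-1 * xi)). Proof. exact: sqint_scale. Qed.

Lemma sqint_band_part : sqint d.
Proof. by apply: sqint_trunc_itv; exact: sqintB. Qed.

Lemma intg_band_part : intg d.
Proof. by apply: intg_trunc_itv; exact: sqintB. Qed.

(** Both halves of the isometry enter: [h] is bounded by [f], of which it is the transform, but [G]
    is bounded by its own transform [k]. The factor [B] comes from the dilation. *)
Lemma int_band_part_le : int (fun xi => d xi ^+ 2) <=
  2 * (int (fun x => f x ^+ 2) + B * int (fun x => k x ^+ 2)).
Proof.
apply: (@le_trans _ _ (2 * (int (fun x => h x ^+ 2) + int (fun x => G (B^-1 * x) ^+ 2)))).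
  have i1 := h2.2; have i2 := GB2.2.
  rewrite -intD// -intZ; last exact: intgD.
  apply: le_int; [exact: sqint_band_part.2|by apply: intgZ; exact: intgD|move=> xi].
  rewrite /d exprMn.
  apply: (@le_trans _ _ ((h xi - G (B^-1 * xi)) ^+ 2)).
    by rewrite ler_piMr ?sqr_ge0// -real_normK ?num_real// expr_le1// itvI_norm.
  by have := sqr_ge0 (h xi + G (B^-1 * xi)); nra.
rewrite ler_wpM2l// lerD ?(is_hartley_norm_le f2 fh)//.
rewrite (int_scale Bin0 G2.2) normfV invrK gtr0_norm// ler_wpM2l ?(ltW B0)//.
exact: is_hartley_norm_ge.
Qed.

(** Tested against indicators of intervals, with one identity per term: [parseval_itvI] for [f],
    [parseval_itvI_dual] for [k] and [hartley_swap] for [d]. Both sides become integrals against the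
    transform of the interval, and there [h] and the sum of the dilated [G] and [d] agree almost
    everywhere. *)
Lemma band_decomposition :
  {ae mu, forall x, f x = B * k (B * x) + hartley d x}.
Proof.
have kB2 : sqint (fun x => k (B * x)) by exact: sqint_scale.
have d2 := sqint_band_part; have di := intg_band_part.
have Hd2 := sqint_hartley di d2.
apply: ae_eq_itv => //.
  by apply: sqintD => //; exact: sqintZ.
move=> a b ab; rewrite -(parseval_itvI ab f2 fh).
have Is := sqint_itvI a b : sqint (itvI a b : R -> R).
have HIs := sqint_hartley_itvI a b : sqint (hartley (itvI a b) : R -> R).
have -> : int (fun x => (B * k (B * x) + hartley d x) * itvI a b x) =
   B * int (fun x => k (B * x) * itvI a b x) + int (fun x => itvI a b x * hartley d x).
  have j1 : intg (fun x => k (B * x) * itvI a b x) by exact: sqint_mul.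
  have j2 : intg (fun x => itvI a b x * hartley d x) by exact: sqint_mul.
  rewrite -(intZ B j1) -intD//; last exact: intgZ.
  by apply: eq_Rintegral => x _; ring.
rewrite -(hartley_swap di (intg_itvI a b)).
(* The dilation is moved to the interval, [k] is exchanged for [G], and the dilation is moved
   back. *)
have -> : B * int (fun x => k (B * x) * itvI a b x) =
    int (fun xi => G (B^-1 * xi) * hartley (itvI a b) xi).
  have iF : intg (fun y => k y * itvI (B * a) (B * b) y).
    by apply: sqint_mul => //; exact: sqint_itvI.
  have -> : int (fun x => k (B * x) * itvI a b x) = B^-1 * int (fun y => k y * itvI (B * a) (B * b) y).
    have H := int_scale Bn0 iF; rewrite (gtr0_norm B0) in H; apply: etrans H.
    by apply: eq_Rintegral => x _; rewrite itvI_scale.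
  rewrite mulVKf// -(parseval_itvI_dual _ _ G2 Gk).
  have iK : intg (fun xi => G (B^-1 * xi) * hartley (itvI a b) xi) by exact: sqint_mul.
  have H := int_scale Bn0 iK; rewrite (gtr0_norm B0) in H.
  have iL : intg (fun xi => G xi * hartley (itvI (B * a) (B * b)) xi).
    by apply: sqint_mul => //; exact: sqint_hartley_itvI.
  apply: (mulfI Bin0); apply: etrans (esym (intZ _ iL)) _; apply: etrans _ H.
  by apply: eq_Rintegral => x _; rewrite mulKf// hartley_itvI_scale// mulrCA.
rewrite -intD; [|exact: sqint_mul|exact: sqint_mul].
apply: ae_eq_int.
- by apply: measurable_funM; [exact: h2.1|exact: HIs.1].
- by apply: measurable_funD; apply: measurable_funM;
    [exact: GB2.1|exact: HIs.1|exact: d2.1|exact: HIs.1].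
have Gh' : {ae mu, forall xi, 1 < `|B^-1 * xi| -> G (B^-1 * xi) = h (B * (B^-1 * xi))}.
  have := negligible_affine 0 Bin0 Gh; apply: negligibleS => xi /= H H'.
  by apply: H; move: H'; rewrite addr0.
apply: ae_impl Gh' => xi Gxi; rewrite -mulrDl; congr (_ * _).
rewrite /d /itvI indicE mem_setE in_itv/= -ler_norml.
have [xiB|Bxi] := leP `|xi| B; first by rewrite mulr1 addrC subrK.
rewrite mulr0 addr0 Gxi ?mulVKf//.
by rewrite normrM normfV (gtr0_norm B0) ltr_pdivlMl// mulr1.
Qed.

End decomposition.

End Decomposition.

(** * Approximation of band-limited functions *)

Section Approximation.
Context {R : realType}.
Local Notation mu := (@lebesgue_measure R).
Local Notation int f := (Rintegral mu setT f).
Implicit Types f g h : R -> R.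

(** The Taylor polynomial of [cas] with [m] terms, hence of degree below [m]; the signs run + + -
    -. *)
Definition cas_poly (m : nat) : {poly R} :=
  \poly_(n < m) ((-1) ^+ (n./2) / n`!%:R).

(** Mirrors cas'(t) = cas(-t), so that the Taylor bound follows by induction on [m], sine and cosine
    being treated together. *)
Lemma deriv_cas_poly m t : (cas_poly m.+1)^`().[t] = (cas_poly m).[- t].
Proof.
rewrite (@horner_coef_wide _ m); last first.
  by apply/leq_sizeP => j mj; rewrite coef_deriv coef_poly ltnS ltnNge mj /= mul0rn.
rewrite horner_poly; apply: eq_bigr => -[n /= nm] _.
rewrite coef_deriv coef_poly ltnS nm [(- t) ^+ n]exprNn mulrA; congr (_ * _).
rewrite -[LHS]mulr_natr -mulrA (_ : (n.+1)`!%:R^-1 * n.+1%:R = n`!%:R^-1 :> R); last first.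
  rewrite factS natrM; field.
  by rewrite -(natrD _ 1 n) !pnatr_eq0 -lt0n fact_gt0.
rewrite [RHS]mulrAC -exprD; congr (_ / _).
rewrite -signr_odd -[RHS]signr_odd; congr (_ ^+ _).
have := odd_double_half n; move: (n./2) (odd n) => p b <-.
by rewrite -addn1 addnAC -addnA; case: b => /=;
  rewrite ?(addn0, add0n, add1n, addn1, doubleK, oddD, odd_double, uphalf_double) //=;
  rewrite -?doubleS ?doubleK ?oddD ?odd_double ?addbF//= ?uphalf_double// ?addbT ?addbN.
Qed.

Lemma cas_poly0 m : (cas_poly m.+1).[0] = 1.
Proof.
rewrite horner_poly big_ord_recl /= expr0 mul1r mulr1 invr1 big1 ?addr0// => i _.
by rewrite expr0n /= mulr0.
Qed.

Lemma taylor_step (F dF : R -> R) m : (forall x : R, is_derive x 1 F (dF x)) -> F 0 = 0 ->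
  (forall x, `|dF x| <= 2 * (`|x| ^+ m / m`!%:R)) ->
  forall t, `|F t| <= 2 * (`|t| ^+ m.+1 / m.+1`!%:R).
Proof.
move=> dFF F0 dFm.
have pos (H dH : R -> R) : (forall x : R, is_derive x 1 H (dH x)) -> H 0 = 0 ->
    (forall x, `|dH x| <= 2 * (`|x| ^+ m / m`!%:R)) ->
    forall t, 0 <= t -> H t <= 2 * (t ^+ m.+1 / m.+1`!%:R).
  move=> dHH H0 dHm t t0.
  (* [Q] is the primitive of the bound on the derivative, so [Q - H] vanishes at 0 and has a
     nonnegative derivative on the half-line. *)
  pose Q : {poly R} := (2 / m.+1`!%:R) *: 'X^(m.+1).
  pose E x := Q.[x] - H x.
  have dE (x : R) : is_derive x 1 E (2 * (x ^+ m / m`!%:R) - dH x).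
    have ? := dHH x; have ? := is_derive_poly Q x.
    rewrite (_ : 2 * (x ^+ m / m`!%:R) = Q^`().[x]); first exact: is_deriveB.
    rewrite derivZ derivXn hornerZ hornerMn hornerXn factS natrM -mulr_natl; field.
    by rewrite -(natrD _ 1 m) !pnatr_eq0 -lt0n fact_gt0.
  have cE : continuous E.
    move=> x; apply: differentiable_continuous; apply/derivable1_diffP.
    exact: (@ex_derive _ _ _ _ _ _ _ (dE x)).
  have [|c c0] := @MVT_segment R E (fun x => 2 * (x ^+ m / m`!%:R) - dH x) 0 t t0.
    by apply: continuous_subspaceT.
  move: c0; rewrite in_itv/= => /andP[c0 ct].
  rewrite /E /Q !hornerZ !hornerXn H0 expr0n/= mulr0 subrr !subr0 => EE.
  rewrite -subr_ge0 mulrA mulrAC EE mulr_ge0// subr_ge0 (le_trans (ler_norm _))//.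
  by rewrite (le_trans (dHm c))// ger0_norm.
have two (H dH : R -> R) : (forall x : R, is_derive x 1 H (dH x)) -> H 0 = 0 ->
    (forall x, `|dH x| <= 2 * (`|x| ^+ m / m`!%:R)) ->
    forall t, 0 <= t -> `|H t| <= 2 * (t ^+ m.+1 / m.+1`!%:R).
  move=> dHH H0 dHm t t0; rewrite ler_norml (pos _ _ dHH H0 dHm _ t0) andbT lerNl.
  apply: (pos (fun x => - H x) (fun x => - dH x)) => //.
  - by rewrite H0 oppr0.
  - by move=> x; rewrite normrN.
move=> t; have [t0|t0] := leP 0 t.
  by rewrite [`|t|]ger0_norm//; exact: (two F dF).
have := two (fun x => F (- x)) (fun x => - dF (- x)) _ _ _ (- t).
rewrite opprK oppr0 oppr_ge0 (ltW t0) [`|t|]ltr0_norm//; apply => //.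
- move=> x; have d1 := dFF (- x).
  have d2 : is_derive x 1 (fun x : R => - x) (-1) by exact: is_deriveNid.
  by have := @is_derive1_comp _ F (fun x : R => - x) x _ _ d1 d2; rewrite mulrN1.
- by move=> x; rewrite normrN (le_trans (dFm _))// normrN.
Qed.

Lemma cas_taylor m t : `|cas t - (cas_poly m).[t]| <= 2 * (`|t| ^+ m / m`!%:R).
Proof.
elim: m t => [|m IH] t.
  by rewrite horner_poly big_ord0 subr0 expr0 mul1r invr1 mulr1 cas_norm.
apply: (@taylor_step (fun t => cas t - (cas_poly m.+1).[t])
  (fun x => cas (- x) - (cas_poly m).[- x])) => //.
- move=> x; rewrite -deriv_cas_poly.
  have ? := is_derive_poly (cas_poly m.+1) x.
  have dc : is_derive x 1 (cas : R -> R) (cas (- x)).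
    apply: (@is_derive_eq _ _ _ (cos + sin)%R) => //.
    by rewrite /cas cosN sinN addrC.
  exact: is_deriveB.
- by rewrite cas_poly0 /cas cos0 sin0 addr0 subrr.
- by move=> x; rewrite (le_trans (IH _))// normrN.
Qed.

(** * Bounds on the truncated exponential series *)

Definition exp_poly (K : nat) : {poly R} := \poly_(n < K.+1) (n`!%:R)^-1.

Lemma exp_polyE K (l : R) : (exp_poly K).[l] = \sum_(n < K.+1) l ^+ n / n`!%:R.
Proof. by rewrite horner_poly; apply: eq_bigr => n _; rewrite mulrC. Qed.

Lemma exp_series K (l : R) : (exp_poly K).[l] = series (exp_coeff l) K.+1.
Proof. by rewrite exp_polyE /series /= big_mkord. Qed.

Lemma exp_poly_le K (l : R) : 0 <= l -> (exp_poly K).[l] <= expR l.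
Proof.
move=> l0; rewrite exp_series; apply: nondecreasing_cvgn_le.
  by apply/nondecreasing_seqP => n; rewrite /series/= big_nat_recr//= lerDl exp_coeff_ge0.
exact: is_cvg_series_exp_coeff.
Qed.

Lemma exp_term_le n (l : R) : 0 <= l -> l ^+ n / n`!%:R <= expR l.
Proof.
move=> l0; rewrite (le_trans _ (exp_poly_le n l0))// exp_polyE big_ord_recr /= lerDr.
by apply: sumr_ge0 => i _; rewrite divr_ge0// exprn_ge0.
Qed.

Lemma exp_poly_ge0 K (l : R) : 0 <= l -> 0 <= (exp_poly K).[l].
Proof.
by move=> l0; rewrite exp_polyE; apply: sumr_ge0 => i _; rewrite divr_ge0// exprn_ge0.
Qed.

(** Term by term, l^n <= 4^K (l/4)^n for n <= K. This leaves three quarters of the Gaussian exponent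
    for the Taylor error. *)
Lemma exp_poly_le4 K (l : R) : 0 <= l -> (exp_poly K).[l] <= 4 ^+ K * expR (l / 4).
Proof.
move=> l0; have l40 : 0 <= l / 4 by rewrite divr_ge0.
apply: (le_trans _ (ler_wpM2l _ (exp_poly_le K l40))); last by rewrite exprn_ge0.
rewrite !exp_polyE mulr_sumr; apply: ler_sum => -[n /= nK] _.
rewrite mulrA ler_wpM2r ?invr_ge0// exprMn exprVn mulrCA ler_peMr ?exprn_ge0//.
by rewrite ler_pdivlMr ?exprn_gt0// mul1r ler_weXn2l ?ler1n// -ltnS.
Qed.

(** Term by term, l^n <= (2 l)^n / 2^(K+1) for n > K: the Chernoff method with ratio 2. *)
Lemma exp_poly_ge K (l : R) : 0 <= l -> expR l - (exp_poly K).[l] <= expR (2 * l) / 2 ^+ K.+1.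
Proof.
move=> l0; rewrite lerBlDl; apply: limr_le; first exact: is_cvg_series_exp_coeff.
near=> n.
have Kn : (K.+1 <= n)%N by near: n; exact: nbhs_infty_ge.
rewrite exp_series /series /= (big_cat_nat _ Kn)//= lerD2l.
have l20 : 0 <= 2 * l by rewrite mulr_ge0.
rewrite ler_pdivlMr ?exprn_gt0//; apply: le_trans (exp_poly_le n l20).
rewrite exp_series /series /= (@big_cat_nat _ _ _ K.+1 0 n.+1)//=; last exact: leqW.
rewrite -[leLHS]add0r lerD ?sumr_ge0//.
  by move=> i _; exact: exp_coeff_ge0.
rewrite big_nat_recr//= -[leLHS]addr0 lerD ?exp_coeff_ge0// mulr_suml.
rewrite !big_nat; apply: ler_sum => i /andP[Ki _].
rewrite /exp_coeff mulrAC ler_wpM2r ?invr_ge0// exprMn mulrC ler_wpM2r ?exprn_ge0//.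
by rewrite ler_weXn2l ?ler1n.
Unshelve. all: by end_near. Qed.

(** From 1 + x <= e^x at x = -1/16 one has e^(1/16) <= 16/15, and the 32nd power of 16/15 is below
    8. The cube root, e^(2/3) <= 2, later turns powers of 2 into exponentials. *)
Lemma expR2_le8 : expR 2 <= 8 :> R.
Proof.
have h0 : expR (1 / 16) <= 16 / 15 :> R.
  have h := expR_ge1Dx (- (1 / 16) : R); rewrite expRN in h.
  rewrite -[expR _]invrK -[16 / 15]invrK lef_pV2 ?posrE ?invr_gt0 ?expR_gt0//.
  by apply: le_trans h; rewrite invf_div; lra.
have -> : 2 = 1 / 16 * 32%:R :> R by field.
rewrite expRM_natr (le_trans (lerXn2r 32 _ _ h0)) ?nnegrE ?expR_ge0//.
rewrite expr_div_n ler_pdivrMr ?exprn_gt0// -!natrX -natrM ler_nat.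
lia.
Qed.

Lemma expR23_le2 : expR (2 / 3) <= 2 :> R.
Proof.
rewrite -(@ler_pXn2r _ 3) ?nnegrE ?expR_ge0// -expRM_natl.
have -> : 3 * (2 / 3) = 2 :> R by field.
by rewrite (le_trans expR2_le8)// -natrX ler_nat.
Qed.

Lemma exprV2_le n : (2 ^+ n)^-1 <= expR (- (2 / 3 * n%:R)) :> R.
Proof.
rewrite expRN lef_pV2 ?posrE ?expR_gt0 ?exprn_gt0//.
by rewrite mulrC expRM_natl lerXn2r ?nnegrE ?expR_ge0// expR23_le2.
Qed.


Section cutoff.
Variables (beta B : R) (N : nat).
Hypotheses (beta0 : 0 < beta) (B0 : 0 <= B) (BN : 12 * B ^+ 2 = N%:R * beta ^+ 2).

(** Two demands fix this value: the Chernoff bound at l <= N/24 uses K + 1 >= N/8, and the Taylor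
    error uses m - 2K >= N/2, that is essentially K <= N/8. With [m] Taylor terms, the degrees 2K
    and m - 1 add up to N. *)
Let K := (N %/ 8)%N.
Let m := (N - 2 * K).+1.

Definition cutoff (l : R) : R := expR (- l) * (exp_poly K).[l].

Lemma cutoff_ge0 l : 0 <= l -> 0 <= cutoff l.
Proof. by move=> l0; rewrite mulr_ge0 ?expR_ge0 ?exp_poly_ge0. Qed.

Lemma cutoff_le1 l : 0 <= l -> cutoff l <= 1.
Proof.
by move=> l0; rewrite /cutoff mulrC expRN ler_pdivrMr ?expR_gt0// mul1r exp_poly_le.
Qed.

(* Chernoff bound for the Poisson tail *)
Lemma cutoff_ge l : 0 <= l -> l <= N%:R / 24 -> 1 - cutoff l <= expR (- (N%:R / 24)).
Proof.
move=> l0 lN.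
have -> : 1 - cutoff l = expR (- l) * (expR l - (exp_poly K).[l]).
  by rewrite mulrBr -expRD addNr expR0.
apply: (le_trans (ler_wpM2l (expR_ge0 _) (exp_poly_ge K l0))).
rewrite mulrA -expRD.
apply: (@le_trans _ _ (expR (- l + 2 * l) * expR (- (2 / 3 * K.+1%:R)))).
  by rewrite ler_wpM2l ?expR_ge0// exprV2_le.
(* The exponent is l - (2/3)(K + 1), at most N/24 - N/12. *)
rewrite -expRD ler_expR.
have : N%:R <= 8 * K.+1%:R :> R by rewrite -natrM ler_nat /K; lia.
lra.
Qed.

(** The exponents collect to 2|x|B - 3l/4 - N/3, where N/3 comes from 4^K / 2^m = 2^-(m - 2K). Since
    2|x|B <= beta^2 x^2 / 3 + N/4, what remains is -N/12 and (1/3 - 3/8) beta^2 x^2, that is -beta^2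
    x^2 / 24. *)
Lemma cutoff_taylor x xi : `|xi| <= B ->
  `|cas (x * xi) - (cas_poly m).[x * xi]| * cutoff (beta ^+ 2 * x ^+ 2 / 2) <=
  2 * expR (- (N%:R / 12)) * expR (- (beta ^+ 2 * x ^+ 2 / 24)).
Proof.
move=> xiB; set l := beta ^+ 2 * x ^+ 2 / 2.
have l0 : 0 <= l by rewrite divr_ge0// mulr_ge0 ?sqr_ge0.
have r0 : 0 <= `|x| * B by rewrite mulr_ge0.
(* Using y^m / m! <= e^y at y = 2|x|B rather than |x|B gains the factor 2^-m. *)
have T : `|cas (x * xi) - (cas_poly m).[x * xi]| <= 2 * (expR (2 * (`|x| * B)) / 2 ^+ m).
  rewrite (le_trans (cas_taylor _ _))// ler_wpM2l// ler_pdivlMr ?exprn_gt0//.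
  apply: (@le_trans _ _ ((2 * (`|x| * B)) ^+ m / m`!%:R)); last first.
    by apply: exp_term_le; rewrite mulr_ge0.
  rewrite mulrAC ler_wpM2r ?invr_ge0// exprMn mulrC ler_wpM2l ?exprn_ge0//.
  by rewrite lerXn2r ?nnegrE// normrM ler_wpM2l.
have Q : cutoff l <= expR (- l) * (4 ^+ K * expR (l / 4)).
  by rewrite ler_wpM2l ?expR_ge0// exp_poly_le4.
apply: (@le_trans _ _ (2 * (expR (2 * (`|x| * B)) / 2 ^+ m) * (expR (- l) * (4 ^+ K * expR (l / 4))))).
  by rewrite ler_pM// cutoff_ge0.
have -> : 2 * (expR (2 * (`|x| * B)) / 2 ^+ m) * (expR (- l) * (4 ^+ K * expR (l / 4))) =
  2 * ((4 ^+ K / 2 ^+ m) * expR (2 * (`|x| * B) - l + l / 4)).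
  by rewrite !expRD; ring.
rewrite -[leRHS]mulrA ler_wpM2l// -[leRHS]expRD.
have E4 : 4 ^+ K / 2 ^+ m = (2 ^+ (m - 2 * K))^-1 :> R.
  have -> : 4 = 2 ^+ 2 :> R by rewrite -natrX.
  have mK : (2 * K <= m)%N by rewrite /m /K; lia.
  rewrite -exprM -{1}(subnK mK) exprD invfM mulrCA mulfV ?mulr1//.
rewrite E4; apply: (le_trans (ler_wpM2r (expR_ge0 _) (exprV2_le _))).
rewrite -expRD ler_expR.
have mK : N%:R <= 2 * (m - 2 * K)%:R :> R by rewrite -natrM ler_nat /m /K; lia.
(* In terms of [w] one has N/4 = 3 w^2, and the bound on 2|x|B is the square of beta|x| - 3w being
   nonnegative. *)
pose w := B / beta.
have Bw : B = w * beta by rewrite /w divfK// gt_eqF.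
have wN : N%:R = 12 * w ^+ 2.
  apply: (mulIf (_ : beta ^+ 2 != 0)); first by rewrite expf_neq0// gt_eqF.
  by rewrite -BN Bw; ring.
have key : 2 * (`|x| * B) <= beta ^+ 2 * x ^+ 2 / 3 + N%:R / 4.
  rewrite Bw wN -(real_normK (num_real x)).
  have := sqr_ge0 (beta * `|x| - 3 * w); lra.
rewrite /l; lra.
Qed.

Lemma int_sum n (F : nat -> R -> R) : (forall i, intg (F i)) ->
  int (fun x => \sum_(i < n) F i x) = \sum_(i < n) int (F i) /\
  intg (fun x => \sum_(i < n) F i x).
Proof.
move=> Fi; elim: n => [|n [IH IHi]].
  rewrite big_ord0; under eq_Rintegral do rewrite big_ord0.
  split; last by under eq_fun do rewrite big_ord0; exact: integrable0.
  by rewrite /Rintegral integral0.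
split.
  by under eq_Rintegral do rewrite big_ord_recr/=; rewrite intD// IH big_ord_recr.
by under eq_fun do rewrite big_ord_recr/=; exact: intgD.
Qed.

Lemma bandlimited_approx d : intg d -> (forall xi, B < `|xi| -> d xi = 0) ->
  exists P : {poly R}, (size P <= N.+1)%N /\ forall x,
    `|cutoff (beta ^+ 2 * x ^+ 2 / 2) * hartley d x
      - expR (- (beta ^+ 2 * x ^+ 2) / 2) * P.[x]| <=
    2 * (Num.sqrt (2 * pi))^-1 * expR (- (N%:R / 12)) * int (fun xi => `|d xi|) *
      expR (- (beta ^+ 2 * x ^+ 2 / 24)).
Proof.
move=> di dB; set c0 : R := (Num.sqrt (2 * pi))^-1.
have c00 : 0 <= c0 by rewrite invr_ge0 sqrtr_ge0.
(* [P2] is the transform of [d] with [cas] replaced by its Taylor polynomial: its coefficients are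
   moments of [d], finite because [d] vanishes outside [-B, B]. [P1] is the truncated exponential at
   l, of degree at most 2K in x. *)
pose P2 : {poly R} := \poly_(n < m) (c0 * ((cas_poly m)`_n * int (fun xi => d xi * xi ^+ n))).
pose P1 : {poly R} := exp_poly K \Po ((beta ^+ 2 / 2) *: 'X^2).
have P1E x : P1.[x] = (exp_poly K).[beta ^+ 2 * x ^+ 2 / 2].
  by rewrite horner_comp hornerZ hornerXn mulrAC.
have ip n : intg (fun xi => d xi * xi ^+ n).
  apply: (intg_bd (g := fun xi => B ^+ n * `|d xi|)).
  - by apply: measurable_funM; [exact: intg_measurable|exact: measurable_funX].
  - by apply: intgZ; exact: (integrable_abse di).
  - move=> xi; rewrite normrM normrX mulrC.
    have [xiB|/dB ->] := leP `|xi| B; last by rewrite normr0 !mulr0.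
    by rewrite ler_wpM2r// lerXn2r ?nnegrE.
have P2E x : P2.[x] = c0 * int (fun xi => d xi * (cas_poly m).[x * xi]) /\
    intg (fun xi => d xi * (cas_poly m).[x * xi]).
  have [S1 S2] := @int_sum m (fun n xi => (cas_poly m)`_n * x ^+ n * (d xi * xi ^+ n))
    (fun n => intgZ _ (ip n)).
  have E : (fun xi => d xi * (cas_poly m).[x * xi]) =
    (fun xi => \sum_(i < m) (cas_poly m)`_i * x ^+ i * (d xi * xi ^+ i)).
    apply/funext => xi; rewrite (@horner_coef_wide _ m) ?size_poly// mulr_sumr.
    by apply: eq_bigr => i _; rewrite exprMn; ring.
  rewrite E; split=> //; rewrite S1 horner_poly mulr_sumr; apply: eq_bigr => i _.
  by rewrite intZ//; ring.
have icas x : intg (fun xi => d xi * cas (x * xi)).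
  apply: (intgM_bd (M := 2)) => //; last by move=> ?; exact: cas_norm.
  by under eq_fun do rewrite mulrC; exact: measurable_casM.
exists (P1 * P2); split.
  rewrite (leq_trans (size_polyMleq _ _))//.
  have s1 : (size P1 <= (2 * K).+1)%N.
    rewrite (leq_trans (size_comp_poly_leq _ _))// ltnS mulnC leq_mul//.
      rewrite -subn1 leq_subLR addnC addn1 (leq_trans (size_scale_leq _ _))//.
      by rewrite size_polyXn.
    by rewrite -subn1 leq_subLR add1n size_poly.
  have s2 : (size P2 <= m)%N by exact: size_poly.
  by move: s1 s2; rewrite /m /K; lia.
move=> x; rewrite hornerM P1E (P2E x).1.
have l0 : 0 <= beta ^+ 2 * x ^+ 2 / 2 by rewrite divr_ge0// mulr_ge0 ?sqr_ge0.
have i2 := (P2E x).2; have i3 := intgB (icas x) i2.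
have -> : cutoff (beta ^+ 2 * x ^+ 2 / 2) * hartley d x -
  expR (- (beta ^+ 2 * x ^+ 2) / 2) * ((exp_poly K).[beta ^+ 2 * x ^+ 2 / 2] *
    (c0 * int (fun xi => d xi * (cas_poly m).[x * xi]))) =
  c0 * (cutoff (beta ^+ 2 * x ^+ 2 / 2) *
    int (fun xi => d xi * cas (x * xi) - d xi * (cas_poly m).[x * xi])).
  by rewrite intB// /cutoff /hartley /hartley0 -/c0 mulNr; ring.
rewrite normrM (ger0_norm c00) normrM (ger0_norm (cutoff_ge0 l0)).
set E1 := expR (- (N%:R / 12)); set E2 := expR (- (beta ^+ 2 * x ^+ 2 / 24)).
rewrite [leRHS](_ : _ = c0 * (2 * E1 * int (fun xi => `|d xi|) * E2)); last by ring.
rewrite ler_wpM2l//.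
rewrite (le_trans (ler_wpM2l (cutoff_ge0 l0) (le_normr_Rintegral measurableT i3)))//.
have i4 : intg (fun xi => `|d xi * cas (x * xi) - d xi * (cas_poly m).[x * xi]|).
  exact: (integrable_abse i3).
have i5 : intg (fun xi => `|d xi|) by exact: (integrable_abse di).
rewrite -(intZ _ i4) [leRHS](_ : _ = int (fun xi => 2 * E1 * E2 * `|d xi|)); last first.
  by rewrite (intZ _ i5); ring.
apply: le_int; [exact: intgZ|exact: intgZ|move=> xi].
have [xiB|/dB ->] := leP `|xi| B; last by rewrite !mul0r subrr normr0 !mulr0.
rewrite -mulrBr normrM mulrCA [leRHS]mulrC ler_wpM2l// mulrC.
exact: cutoff_taylor.
Qed.

End cutoff.

End Approximation.

(** * The estimate for real functions *)

Section RealTheorem.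
Context {R : realType}.
Local Notation mu := (@lebesgue_measure R).
Local Notation int f := (Rintegral mu setT f).
Implicit Types f g h : R -> R.

(** * Gaussian moments and weights *)

Lemma powR_gauss (s c : R) : 0 <= s -> 0 < c ->
  exists2 C, 0 < C & forall y, 0 <= y -> y `^ s <= C * expR (c * y ^+ 2).
Proof.
move=> s0 c0; pose n := (Num.truncn s).+1.
have sn : s <= n%:R by apply: ltW; exact: truncnS_gt.
have cn0 : 0 < c ^+ n by rewrite exprn_gt0.
have C0 : 0 <= n`!%:R / c ^+ n by rewrite divr_ge0// ltW.
exists (1 + n`!%:R / c ^+ n); first by rewrite ltr_wpDr.
move=> y y0; have cy0 : 0 <= c * y ^+ 2 by rewrite mulr_ge0 ?sqr_ge0// ltW.
have e1 : 1 <= expR (c * y ^+ 2) by rewrite -expR0 ler_expR.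
have [y1|y1] := leP y 1.
  apply: (@le_trans _ _ 1); last first.
    by rewrite -[leLHS]mulr1 ler_pM// lerDl.
  by rewrite -[leRHS](congr1 (fun F => F s) (powR1 R)) ge0_ler_powR ?nnegrE.
apply: (@le_trans _ _ (y `^ (2 * n)%:R)).
  apply: ler_powR; first exact: ltW.
  by rewrite (le_trans sn)// ler_nat leq_pmull.
rewrite powR_mulrn// exprM mulrDl mul1r ler_wpDl ?expR_ge0//.
have := exp_term_le n cy0; rewrite ler_pdivrMr ?ltr0n ?fact_gt0// => H.
by rewrite mulrAC ler_pdivlMr// -exprMn [y ^+ 2 * c]mulrC [leRHS]mulrC.
Qed.

Lemma measurable_hweight s : measurable_fun setT (fun x : R => `|x| `^ s).
Proof. by apply: (measurableT_comp (measurable_powR s)). Qed.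

Lemma measurable_gauss c : measurable_fun setT (fun y : R => expR (- (c * y ^+ 2))).
Proof.
apply: measurableT_comp => //; apply: measurableT_comp => //.
by apply: measurable_funM => //; exact: measurable_funX.
Qed.

(** The Gaussian is at most 1 / (1 + c y^2), a multiple of the Poisson kernel with parameter
    c^(-1/2), already known to be integrable. *)
Lemma intg_gauss c : 0 < c -> intg (fun y : R => expR (- (c * y ^+ 2))).
Proof.
move=> c0; pose e := Num.sqrt c^-1.
have e0 : 0 < e by rewrite sqrtr_gt0 invr_gt0.
apply: (intg_bd (g := fun y => (2 * c * e)^-1 * poisson e y)).
- exact: measurable_gauss.
- by apply: intgZ; exact: intg_poisson.
move=> y; rewrite ger0_norm ?expR_ge0// expRN.
have p : 0 < 1 + c * y ^+ 2 by rewrite ltr_wpDr// mulr_ge0 ?sqr_ge0// ltW.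
apply: (@le_trans _ _ (1 + c * y ^+ 2)^-1).
  by rewrite lef_pV2 ?posrE ?expR_gt0// expR_ge1Dx.
have ce : c = e ^- 2 by rewrite sqr_sqrtr ?invr_ge0 ?(ltW c0)// invrK.
move: p; rewrite /poisson ce => p; rewrite le_eqVlt; apply/orP; left; apply/eqP.
have en : e != 0 by rewrite gt_eqF.
have q : e ^+ 2 + y ^+ 2 != 0 by rewrite gt_eqF// ltr_wpDr ?sqr_ge0// exprn_gt0.
have q' : y ^+ 2 + e ^+ 2 != 0 by rewrite addrC.
by field; rewrite ?q ?q' ?en.
Qed.

Lemma intg_gauss_powR s c : 0 <= s -> 0 < c ->
  intg (fun y : R => expR (- (c * y ^+ 2)) * `|y| `^ s).
Proof.
move=> s0 c0; have c20 : 0 < c / 2 by rewrite divr_gt0.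
have [C C0 HC] := powR_gauss s0 c20.
apply: (intg_bd (g := fun y => C * expR (- (c / 2 * y ^+ 2)))).
- by apply: measurable_funM; [exact: measurable_gauss|exact: measurable_hweight].
- by apply: intgZ; exact: intg_gauss.
move=> y; rewrite ger0_norm ?mulr_ge0 ?expR_ge0 ?powR_ge0//.
rewrite (le_trans (ler_wpM2l (expR_ge0 _) (HC _ (normr_ge0 y))))//.
rewrite mulrCA ler_wpM2l ?(ltW C0)// -expRD ler_expR real_normK ?num_real//.
by rewrite le_eqVlt; apply/orP; left; apply/eqP; field.
Qed.

Lemma measurable_if_norm f (M : R) : measurable_fun setT f ->
  measurable_fun setT (fun x : R => if M < `|x| then f x else 0).
Proof.
move=> mf; apply: measurable_fun_ifT => //.
by apply: measurable_fun_ltr.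
Qed.

Lemma ge1_powR_weight m (x : R) : 0 <= m -> 1 <= (1 + x ^+ 2) `^ m.
Proof.
by move=> m0; rewrite -[leLHS](powRr0 (1 + x ^+ 2)) ler_powR// lerDl sqr_ge0.
Qed.

Lemma powR_norm_weight m (x : R) : 0 <= m -> `|x| `^ (2 * m) <= (1 + x ^+ 2) `^ m.
Proof.
move=> m0; rewrite powRrM powR_mulrn// real_normK ?num_real//.
by rewrite ge0_ler_powR ?nnegrE ?addr_ge0 ?sqr_ge0// lerDr.
Qed.

Lemma measurable_powR_weight m : measurable_fun setT (fun x : R => (1 + x ^+ 2) `^ m).
Proof.
apply: (measurableT_comp (measurable_powR m)).
by apply: measurable_funD => //; exact: measurable_funX.
Qed.

Section estimate.
Variables (m : R).
Hypothesis m0 : 0 <= m.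
Let om (x : R) := `|x| `^ (2 * m).
Let om0 x : 0 <= om x. Proof. exact: powR_ge0. Qed.
Let mom : measurable_fun setT om. Proof. exact: measurable_hweight. Qed.
Let m20 : 0 <= 2 * m. Proof. by rewrite mulr_ge0. Qed.

(** The exponent of [B] collects 2 from the prefactor, -2m from the weight and -1 from the change of
    variable. The homogeneous weight is then bounded by the Sobolev weight. *)
Lemma integral_dilated_sqr_le k B : 0 < B -> measurable_fun setT k ->
  (\int[mu]_x ((B * k (B * x)) ^+ 2 * om x)%:E <=
   (B `^ (1 - 2 * m))%:E * \int[mu]_x ((1 + x ^+ 2) `^ m * k x ^+ 2)%:E)%E.
Proof.
move=> B0 mk.
have mF : measurable_fun setT (fun y => (B `^ (2 - 2 * m) * (k y ^+ 2 * om y))%:E).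
  apply/measurable_EFinP; apply: measurable_funM => //.
  by apply: measurable_funM => //; exact: measurable_funX.
have H := ge0_int_affine 0 (lt0r_neq0 B0) mF.
have -> : (\int[mu]_x ((B * k (B * x)) ^+ 2 * om x)%:E =
   \int[mu]_x (B `^ (2 - 2 * m) * (k (B * x + 0) ^+ 2 * om (B * x + 0)))%:E)%E.
  apply: eq_integral => x _; congr EFin; rewrite addr0 /om normrM (gtr0_norm B0).
  rewrite powRM ?(ltW B0)// [RHS](_ : _ = (B `^ (2 - 2 * m) * B `^ (2 * m)) *
    (k (B * x) ^+ 2 * `|x| `^ (2 * m))); last by ring.
  rewrite -powRD ?(gt_eqF B0) ?implybT// subrK.
  by rewrite (powR_mulrn 2 (ltW B0)) exprMn mulrA.
rewrite H; last by move=> x; rewrite lee_fin mulr_ge0 ?powR_ge0// mulr_ge0 ?sqr_ge0.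
rewrite (gtr0_norm B0).
have mG : measurable_fun setT (fun y => (k y ^+ 2 * om y)%:E).
  by apply/measurable_EFinP; apply: measurable_funM => //; exact: measurable_funX.
under eq_integral do rewrite EFinM.
rewrite ge0_integralZl//; last 2 first.
- by move=> x _; rewrite lee_fin mulr_ge0 ?sqr_ge0.
- by rewrite lee_fin powR_ge0.
rewrite muleA -EFinM.
have -> : B^-1 * B `^ (2 - 2 * m) = B `^ (1 - 2 * m).
  rewrite -powR_inv1 ?(ltW B0)// -powRD ?(gt_eqF B0) ?implybT//.
  by congr (_ `^ _); ring.
apply: lee_wpmul2l; first by rewrite lee_fin powR_ge0.
apply: ge0_le_integral => //.
- by move=> x _; rewrite lee_fin mulr_ge0 ?sqr_ge0.
- apply/measurable_EFinP; apply: measurable_funM; last exact: measurable_funX.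
  exact: measurable_powR_weight.
by move=> x _; rewrite lee_fin mulrC ler_wpM2r ?sqr_ge0// powR_norm_weight.
Qed.

(** The rate 1/12 is twice 1/24, since the error bound of [bandlimited_approx] gets squared. *)
Definition gauss_mass : R := int (fun y : R => expR (- (1 / 12 * y ^+ 2)) * `|y| `^ (2 * m)).

Lemma integral_gauss_scaled beta : 0 < beta ->
  (\int[mu]_x (expR (- (beta ^+ 2 * x ^+ 2 / 12)) * om x)%:E =
   (beta `^ (- (2 * m)) / beta * gauss_mass)%:E)%E.
Proof.
move=> b0.
have iG := intg_gauss_powR m20 (divr_gt0 ltr01 (ltr0n R 12) : 0 < 1 / 12).
have iF := intgZ (beta `^ (- (2 * m))) iG.
have H := int_affine 0 (lt0r_neq0 b0) iF.
have iF' := intg_affine 0 (lt0r_neq0 b0) iF.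
rewrite (intZ _ iG) (gtr0_norm b0) in H.
rewrite (_ : beta `^ (- (2 * m)) / beta * gauss_mass = beta^-1 * (beta `^ (- (2 * m)) * gauss_mass)); last by ring.
rewrite /gauss_mass -H EFin_int//; apply: eq_integral => x _; congr EFin.
rewrite addr0 normrM (gtr0_norm b0) powRM ?(ltW b0)//.
rewrite [RHS](_ : _ = (beta `^ (- (2 * m)) * beta `^ (2 * m)) *
  (expR (- (1 / 12 * (beta * x) ^+ 2)) * `|x| `^ (2 * m))); last by ring.
rewrite -powRD ?(gt_eqF b0) ?implybT// addNr powRr0 mul1r; congr (expR _ * _).
by field.
Qed.

Lemma int_norm_sqr_le d B : 0 < B -> sqint d -> intg d ->
  (forall xi, B < `|xi| -> d xi = 0) ->
  int (fun xi => `|d xi|) ^+ 2 <= 2 * B * int (fun xi => d xi ^+ 2).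
Proof.
move=> B0 d2 di dB.
have nd2 : sqint (fun xi => `|d xi|).
  apply: (sqint_bd _ d2); last by move=> x; rewrite normr_id.
  by apply: measurableT_comp => //; exact: d2.1.
have := cauchy_schwarz (sqint_itvI (- B) B) nd2.
have -> : int (fun x => itvI (- B) B x * `|d x|) = int (fun xi => `|d xi|).
  apply: eq_Rintegral => xi _; rewrite /itvI indicE mem_setE in_itv/= -ler_norml.
  by have [_|/dB ->] := leP `|xi| B; rewrite ?mul1r// normr0 mulr0.
have -> : int (fun x => itvI (- B) B x ^+ 2) = 2 * B.
  have := @hartley0_itvI0 R (- B) B; rewrite /hartley0 => H.
  have E : int (fun x => itvI (- B) B x ^+ 2) = int (fun x => itvI (- B) B x * cas (0 * x)).
    apply: eq_Rintegral => x _; rewrite mul0r /cas cos0 sin0 addr0 mulr1 /itvI indicE.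
    by case: (_ \in _); rewrite ?expr1n ?expr0n.
  by rewrite E H; lra.
by have -> : int (fun x => `|d x| ^+ 2) = int (fun xi => d xi ^+ 2)
  by apply: eq_Rintegral => x _; rewrite real_normK ?num_real.
Qed.

(** Up to constants [T] is the factor of the squared norm of [f], and [T * B] that of [k], in the
    squared error from the Taylor polynomial. Put a = B / beta: then e^(-N/12) = e^(-a^2), M = a /
    beta and B = a beta. One factor e^(-a^2) absorbs a, the other absorbs a^(2m). *)
Lemma scale_bounds : exists2 C, 0 < C &
  forall (beta B : R) (N : nat), 0 < beta -> 0 < B -> (1 <= N)%N ->
  12 * B ^+ 2 = N%:R * beta ^+ 2 ->
  let T := expR (- (N%:R / 6)) * (B / beta) * beta `^ (- (2 * m)) in
  T <= C * (expR (- (N%:R / 12)) * (B / beta ^+ 2) `^ (2 * m)) /\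
  T * B <= C * B `^ (1 - 2 * m).
Proof.
have [Cg Cg0 HCg] := powR_gauss m20 (ltr01 : 0 < 1 :> R).
exists (Cg + 4 `^ (2 * m)); first by rewrite ltr_wpDr ?powR_ge0.
move=> beta B N b0 B0 N1 BN; set C := Cg + _ => T.
pose a := B / beta; have a0 : 0 < a by rewrite divr_gt0.
have bn : beta != 0 by rewrite gt_eqF.
have a2 : a ^+ 2 = N%:R / 12.
  have -> : N%:R = 12 * B ^+ 2 / beta ^+ 2 :> R by rewrite BN mulfK// expf_neq0.
  by rewrite /a; field.
have Ba : B = a * beta by rewrite /a mulfVK.
have N1R : 1 <= N%:R :> R by rewrite (ler_nat R 1).
have a4 : 1 <= 4 * a.
  have a40 : 0 <= 4 * a by rewrite mulr_ge0 ?(ltW a0).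
  by rewrite -(expr_ge1 (isT : (0 < 2)%N) a40) exprMn a2; lra.
have eN : expR (- (N%:R / 6)) = expR (- (a ^+ 2)) * expR (- (N%:R / 12)) :> R.
  by rewrite -expRD a2; congr expR; field.
have ae : a * expR (- (a ^+ 2)) <= 1.
  rewrite expRN ler_pdivrMr ?expR_gt0// mul1r (le_trans _ (expR_ge1Dx _))//.
  have := sqr_ge0 (a - 1); rewrite sqrrB1 => H; have := sqr_ge0 a; lra.
have bm : beta `^ (- (2 * m)) = (beta `^ (2 * m))^-1 by rewrite powRN.
split.
  have -> : B / beta ^+ 2 = a / beta by rewrite /a; field.
  rewrite powRM ?invr_ge0 ?(ltW a0) ?(ltW b0)// -(powR_inv1 (ltW b0)) -powRrM mulN1r.
  have -> : T = beta `^ (- (2 * m)) * expR (- (N%:R / 12)) * (a * expR (- (a ^+ 2))).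
    by rewrite /T eN -/a; ring.
  have -> : C * (expR (- (N%:R / 12)) * (a `^ (2 * m) * beta `^ (- (2 * m)))) =
     beta `^ (- (2 * m)) * expR (- (N%:R / 12)) * (C * a `^ (2 * m)) by ring.
  rewrite ler_wpM2l ?mulr_ge0 ?powR_ge0 ?expR_ge0// (le_trans ae)//.
  apply: (@le_trans _ _ ((4 * a) `^ (2 * m))).
    by rewrite -[leLHS](powRr0 (4 * a)) ler_powR.
  rewrite powRM ?(ltW a0)// ler_wpM2r ?powR_ge0// /C lerDr ltW//.
rewrite powRD ?(gt_eqF B0) ?implybT// powRr1 ?(ltW B0)//.
rewrite [X in B * X `^ _]Ba powRM ?(ltW a0) ?(ltW b0)//.
have -> : T * B = B * beta `^ (- (2 * m)) * (expR (- (N%:R / 6)) * a).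
  by rewrite /T -/a; ring.
have -> : C * (B * (a `^ (- (2 * m)) * beta `^ (- (2 * m)))) =
   B * beta `^ (- (2 * m)) * (C * a `^ (- (2 * m))) by ring.
rewrite ler_wpM2l ?mulr_ge0 ?powR_ge0 ?(ltW B0)// powRN ler_pdivlMr ?powR_gt0//.
rewrite eN -a2.
have -> : expR (- (a ^+ 2)) * expR (- (a ^+ 2)) * a * a `^ (2 * m) =
  (a * expR (- (a ^+ 2))) * (a `^ (2 * m) * expR (- (a ^+ 2))) by ring.
rewrite -[leRHS]mul1r ler_pM//.
- by rewrite mulr_ge0 ?expR_ge0// ltW.
- by rewrite mulr_ge0 ?expR_ge0 ?powR_ge0.
rewrite expRN ler_pdivrMr ?expR_gt0//.
apply: le_trans (HCg _ (ltW a0)) _; rewrite mul1r ler_wpM2r ?expR_ge0// lerDl powR_ge0//.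
Qed.

(* [f = p + q], [X] damps [f] outside the bulk, and [w] approximates [X q] up to [E] *)
Lemma error_split (f p q w X t Q E : R) : f = p + q -> 0 <= X <= 1 ->
  ((1 - X) * f) ^+ 2 <= t ^+ 2 + Q * f ^+ 2 -> `|X * q - w| <= E ->
  (f - w) ^+ 2 <= 3 * (t ^+ 2 + Q * f ^+ 2 + p ^+ 2 + E ^+ 2).
Proof.
move=> fE /andP[X0 X1] Ht Hw.
have Hp : (X * p) ^+ 2 <= p ^+ 2.
  by rewrite exprMn ler_piMl ?sqr_ge0// expr_le1.
have He : (X * q - w) ^+ 2 <= E ^+ 2.
  rewrite -real_normK ?num_real// lerXn2r ?nnegrE//.
  exact: le_trans Hw.
have -> : f - w = (1 - X) * f + X * p + (X * q - w) by rewrite fE; ring.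
move: Ht Hp He; set x := (1 - X) * f; set y := X * p; set z := X * q - w.
move=> Hx Hy Hz; have := sqr_ge0 (x - y); have := sqr_ge0 (x - z); have := sqr_ge0 (y - z).
nra.
Qed.

(** The weighted integrals may be infinite. In that case the right-hand side is infinite as well;
    otherwise the claim is linear arithmetic. *)
Lemma ereal_combine (I1 I2 W : \bar R) (c e S F : R) :
  (0 <= I1)%E -> (0 <= I2)%E -> (0 <= W)%E -> 0 <= c -> 0 < e -> 0 < S -> 0 <= F ->
  (3%:E * (I1 + e%:E * I2 + S%:E * W + c%:E * ((e * F)%:E + S%:E * W)) <=
   (3 * (1 + c))%:E * (I1 + S%:E * W + e%:E * (I2 + F%:E)))%E.
Proof.
move=> I10 I20 W0 c0 e0 S0 F0.
have k0 : 0 < 3 * (1 + c) by rewrite mulr_gt0// ltr_wpDr.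
have oo (x : \bar R) : (x = +oo)%E -> forall y, (y <= (3 * (1 + c))%:E * x)%E.
  by move=> -> y; rewrite gt0_muley ?lte_fin// leey.
case: I1 I10 => [i1| |]// I10; last first.
  by apply: oo; rewrite -addeA addye// -ltNye (lt_le_trans (ltNyr 0))// adde_ge0 ?mule_ge0 ?adde_ge0 ?lee_fin// ltW.
case: I2 I20 => [i2| |]// I20; last first.
  by apply: oo; rewrite addye// gt0_muley ?lte_fin// addey// -ltNye (lt_le_trans (ltNyr 0))// adde_ge0 ?mule_ge0 ?lee_fin// ltW.
case: W W0 => [w| |]// W0; last first.
  apply: oo; rewrite gt0_muley ?lte_fin// addey// addye// -EFinD -EFinM//.
rewrite -?(EFinM, EFinD) lee_fin; rewrite !lee_fin in I10 I20 W0.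
have Sw : 0 <= S * w by rewrite mulr_ge0// ltW.
have ei : 0 <= e * i2 by rewrite mulr_ge0// ltW.
have eF : 0 <= e * F by rewrite mulr_ge0// ltW.
have h1 := mulr_ge0 c0 I10; have h2 := mulr_ge0 c0 ei.
move: Sw ei eF h2; set x := S * w; set y := e * i2; set z := e * F => *.
rewrite [e * (i2 + F)]mulrDr -/y -/z.
have -> : 3 * (1 + c) * (i1 + x + (y + z)) = 3 * (i1 + x + y + z) + 3 * (c * i1 + c * y + c * (z + x)) by ring.
lra.
Qed.

(** Beyond M the factor 1 - X is merely at most 1, which produces the tail term. Up to M one has l
    <= N/24, and the square of the Chernoff bound is e^(-N/12). *)
Lemma damped_sqr_le (beta B : R) (N : nat) (y x : R) : 0 < beta -> 0 <= B ->
  12 * B ^+ 2 = N%:R * beta ^+ 2 ->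
  ((1 - cutoff N (beta ^+ 2 * x ^+ 2 / 2)) * y) ^+ 2 <=
  (if B / beta ^+ 2 < `|x| then y else 0) ^+ 2 + expR (- (N%:R / 12)) * y ^+ 2.
Proof.
move=> b0 B0 BN; set l := _ / 2; have l0 : 0 <= l by rewrite divr_ge0// mulr_ge0 ?sqr_ge0.
have X0 := cutoff_ge0 N l0; have X1 := cutoff_le1 N l0.
have b2 : 0 < beta ^+ 2 by rewrite exprn_gt0.
rewrite exprMn; case: ltP => xM.
  apply: (@le_trans _ _ (y ^+ 2)); last by rewrite lerDl mulr_ge0 ?expR_ge0 ?sqr_ge0.
  by rewrite ler_piMl ?sqr_ge0// expr_le1 ?subr_ge0// gerBl.
rewrite expr0n add0r ler_wpM2r ?sqr_ge0//.
have lN : l <= N%:R / 24.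
  have x2 : x ^+ 2 <= (B / beta ^+ 2) ^+ 2.
    by rewrite -(real_normK (num_real x)) lerXn2r ?nnegrE// divr_ge0// ltW.
  rewrite /l; have : beta ^+ 2 * x ^+ 2 <= beta ^+ 2 * (B / beta ^+ 2) ^+ 2.
    by rewrite ler_wpM2l// ltW.
  have -> : beta ^+ 2 * (B / beta ^+ 2) ^+ 2 = N%:R / 12.
    have -> : N%:R = 12 * B ^+ 2 / beta ^+ 2 by rewrite BN mulfK// gt_eqF.
    by field; rewrite gt_eqF.
  lra.
have H := cutoff_ge b0 B0 l0 lN.
have -> : expR (- (N%:R / 12)) = expR (- (N%:R / 24)) ^+ 2 :> R.
  by rewrite -expRM_natr; congr expR; field.
by rewrite lerXn2r ?nnegrE ?expR_ge0// subr_ge0.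
Qed.

Lemma real_estimate : exists2 C : R, 0 < C &
  forall (beta B : R) (N : nat) (f h G k : R -> R),
  0 < beta -> 0 < B -> (1 <= N)%N -> 12 * B ^+ 2 = N%:R * beta ^+ 2 ->
  sqint f -> is_hartley f h -> sqint G -> is_hartley G k ->
  {ae mu, forall xi, 1 < `|xi| -> G xi = h (B * xi)} ->
  exists P : {poly R}, (size P <= N.+1)%N /\
  (\int[mu]_x ((f x - expR (- (beta ^+ 2 * x ^+ 2) / 2) * P.[x]) ^+ 2 * om x)%:E <=
   C%:E * (\int[mu]_x ((if (B / beta ^+ 2 < `|x|)%R then f x else 0%R) ^+ 2 * om x)%:E
    + (B `^ (1 - 2 * m))%:E * \int[mu]_x ((1 + x ^+ 2) `^ m * k x ^+ 2)%:E
    + (expR (- (N%:R / 12)))%:E * (\int[mu]_x (f x ^+ 2 * om x)%:E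
       + ((B / beta ^+ 2) `^ (2 * m))%:E * \int[mu]_x (f x ^+ 2)%:E)))%E.
Proof.
have [C1 C10 HC1] := scale_bounds.
have kap0 : 0 <= gauss_mass by apply: int_ge0 => x; rewrite mulr_ge0 ?expR_ge0 ?powR_ge0.
exists (3 * (1 + 4 * gauss_mass * C1)).
  by rewrite mulr_gt0// ltr_wpDr// !mulr_ge0// ltW.
move=> beta B N f h G k b0 B0 N1 BN f2 fh G2 Gk Gh.
have k2 := is_hartley_sqint G2 Gk.
pose d := band_part h G B.
have di : intg d := intg_band_part B0 f2 fh G2.
have d2 : sqint d := sqint_band_part B0 f2 fh G2.
have dB xi : B < `|xi| -> d xi = 0.
  move=> Bxi; rewrite /d /band_part /itvI indicE mem_setE in_itv/= -ler_norml.
  by rewrite leNgt Bxi mulr0.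
have [P [sP HP]] := bandlimited_approx b0 (ltW B0) BN di dB.
exists P; split => //.
have dec := band_decomposition B0 f2 fh G2 Gk Gh.
pose A := 2 / Num.sqrt (2 * pi) * expR (- (N%:R / 12)) * int (fun xi => `|d xi|).
set M := B / beta ^+ 2; set q := expR (- (N%:R / 12)).
pose t x := if M < `|x| then f x else 0.
have mf := f2.1; have mk := k2.1.
have mt : measurable_fun setT t by exact: measurable_if_norm.
have mw (F : R -> R) : measurable_fun setT F ->
    measurable_fun setT (fun x => (F x ^+ 2 * om x)%:E).
  move=> mF; apply/measurable_EFinP; apply: measurable_funM => //.
  exact: measurable_funX.
pose s2 x := B * k (B * x).
have ms2 : measurable_fun setT s2.
  apply: measurable_funM => //; apply: (measurableT_comp mk).
  exact: measurable_funM.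
have mgau : measurable_fun setT (fun x : R => expR (- (beta ^+ 2 * x ^+ 2 / 12)) * om x).
  apply: measurable_funM => //; apply: measurableT_comp => //.
  apply: measurableT_comp => //; apply: measurable_funM => //.
  by apply: measurable_funM => //; exact: measurable_funX.
have mgauE : measurable_fun setT (fun x : R => (A ^+ 2 * (expR (- (beta ^+ 2 * x ^+ 2 / 12)) * om x))%:E).
  by apply/measurable_EFinP; exact: measurable_funM.
(* The majorant given by [error_split] at the points where the band decomposition holds, that is
   almost everywhere. *)
pose U x := (3%:E * ((t x ^+ 2 * om x)%:E + q%:E * (f x ^+ 2 * om x)%:E + (s2 x ^+ 2 * om x)%:E
  + (A ^+ 2 * (expR (- (beta ^+ 2 * x ^+ 2 / 12)) * om x))%:E))%E.
have o2 (F : R -> R) x : (0 <= (F x ^+ 2 * om x)%:E)%E by rewrite lee_fin mulr_ge0 ?sqr_ge0.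
have o3 x : (0 <= (A ^+ 2 * (expR (- (beta ^+ 2 * x ^+ 2 / 12)) * om x))%:E)%E.
  by rewrite lee_fin mulr_ge0 ?sqr_ge0// mulr_ge0 ?expR_ge0.
have q0 : 0 < q by exact: expR_gt0.
have oq x : (0 <= q%:E * (f x ^+ 2 * om x)%:E)%E by rewrite mule_ge0// lee_fin ltW.
have mq : measurable_fun setT (fun x => q%:E * (f x ^+ 2 * om x)%:E)%E.
  by apply: measurable_funeM; exact: mw.
have step1 : (\int[mu]_x ((f x - expR (- (beta ^+ 2 * x ^+ 2) / 2) * P.[x]) ^+ 2 * om x)%:E
    <= \int[mu]_x U x)%E.
  apply: ae_ge0_le_integral => //.
  - by move=> x _; exact: (o2 (fun x => f x - expR (- (beta ^+ 2 * x ^+ 2) / 2) * P.[x])).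
  - apply: (mw (fun x => f x - expR (- (beta ^+ 2 * x ^+ 2) / 2) * P.[x])).
    apply: measurable_funB => //; apply: measurable_funM; last first.
      exact: measurable_poly.
    apply: measurableT_comp => //; apply: measurable_funM => //.
    by apply: measurableT_comp => //; exact: measurable_funM.
  - by move=> x _; rewrite mule_ge0// !adde_ge0.
  - apply: measurable_funeM; apply: emeasurable_funD => //.
    by apply: emeasurable_funD; [apply: emeasurable_funD => //; exact: mw|exact: mw].
  apply: ae_impl dec => x fx _.
  rewrite /U -?(EFinM, EFinD) lee_fin.
  have l0 : 0 <= beta ^+ 2 * x ^+ 2 / 2 by rewrite divr_ge0// mulr_ge0 ?sqr_ge0.
  have Hs := @error_split (f x) (s2 x) (hartley d x) (expR (- (beta ^+ 2 * x ^+ 2) / 2) * P.[x])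
    (cutoff N (beta ^+ 2 * x ^+ 2 / 2)) (t x) q (A * expR (- (beta ^+ 2 * x ^+ 2 / 24))) fx.
  have {}Hs := Hs _ (damped_sqr_le _ x b0 (ltW B0) BN) (HP x).
  rewrite cutoff_ge0// cutoff_le1// in Hs; have {}Hs := Hs isT.
  apply: le_trans (ler_wpM2r (om0 x) Hs) _.
  have -> : expR (- (beta ^+ 2 * x ^+ 2 / 12)) = expR (- (beta ^+ 2 * x ^+ 2 / 24)) ^+ 2.
    by rewrite -expRM_natr; congr expR; field.
  by rewrite le_eqVlt; apply/orP; left; apply/eqP; ring.
apply: le_trans step1 _; rewrite /U ge0_integralZl//; last 2 first.
- apply: emeasurable_funD => //.
  by apply: emeasurable_funD; [apply: emeasurable_funD => //; exact: mw|exact: mw].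
- by move=> x _; rewrite !adde_ge0.
rewrite ge0_integralD//; last 2 first.
- by move=> x _; rewrite !adde_ge0.
- by apply: emeasurable_funD; [apply: emeasurable_funD => //; exact: mw|exact: mw].
rewrite ge0_integralD//; last 3 first.
- by move=> x _; rewrite !adde_ge0.
- by apply: emeasurable_funD => //; exact: mw.
- exact: mw.
rewrite ge0_integralD//; last exact: mw.
have -> : (\int[mu]_x (q%:E * (f x ^+ 2 * om x)%:E) = q%:E * \int[mu]_x (f x ^+ 2 * om x)%:E)%E.
  by rewrite ge0_integralZl//; [exact: mw|rewrite lee_fin ltW].
rewrite -(EFin_int f2.2) -EFinM.
set I1 := (\int[mu]_x (t x ^+ 2 * om x)%:E)%E; set I2 := (\int[mu]_x (f x ^+ 2 * om x)%:E)%E.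
set W := (\int[mu]_x ((1 + x ^+ 2) `^ m * k x ^+ 2)%:E)%E.
have I10 : (0 <= I1)%E by apply: integral_ge0 => x _; exact: o2.
have I20 : (0 <= I2)%E by apply: integral_ge0.
have W0 : (0 <= W)%E by apply: integral_ge0 => x _; rewrite lee_fin mulr_ge0 ?powR_ge0 ?sqr_ge0.
have F0 : 0 <= int (fun x => f x ^+ 2) by apply: int_ge0 => x; exact: sqr_ge0.
have c0 : 0 <= 4 * gauss_mass * C1 by rewrite !mulr_ge0// ltW.
apply: le_trans (ereal_combine I10 I20 W0 c0 q0 (powR_gt0 (1 - 2 * m) B0) (mulr_ge0 (powR_ge0 M (2 * m)) F0)).
apply: lee_wpmul2l; first by rewrite lee_fin.
apply: leeD; first by apply: leeD2l; exact: integral_dilated_sqr_le.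
under eq_integral do rewrite EFinM.
rewrite ge0_integralZl//; last 3 first.
- exact/measurable_EFinP.
- by move=> x _; rewrite lee_fin mulr_ge0 ?expR_ge0.
- by rewrite lee_fin sqr_ge0.
rewrite integral_gauss_scaled//.
(* The bound on [d] brings in the unweighted norm of [k]; it is controlled by the Sobolev norm
   because the weight is at least 1. *)
have KW : ((int (fun x => k x ^+ 2))%:E <= W)%E.
  rewrite (EFin_int k2.2); apply: ge0_le_integral => //.
  - by move=> x _; rewrite lee_fin sqr_ge0.
  - by apply/measurable_EFinP; exact: measurable_funX.
  - apply/measurable_EFinP; apply: measurable_funM; last exact: measurable_funX.
    exact: measurable_powR_weight.
  by move=> x _; rewrite lee_fin ler_peMl ?sqr_ge0// ge1_powR_weight.
have K0 : 0 <= int (fun x => k x ^+ 2) by apply: int_ge0 => x; exact: sqr_ge0.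
apply: (@le_trans _ _ ((4 * gauss_mass * C1)%:E * ((q * (M `^ (2 * m) * int (fun x => f x ^+ 2)))%:E
  + (B `^ (1 - 2 * m))%:E * (int (fun x => k x ^+ 2))%:E)))%E; last first.
  apply: lee_wpmul2l; first by rewrite lee_fin.
  by apply: leeD2l; apply: lee_wpmul2l => //; rewrite lee_fin powR_ge0.
rewrite -?(EFinM, EFinD) lee_fin.
(* Cauchy-Schwarz on [-B, B] gives 2B, [int_band_part_le] gives 2, and the normalisation 4 / (2 pi)
   is at most 1. *)
have HA : A ^+ 2 <= 4 * B * expR (- (N%:R / 6)) * (int (fun x => f x ^+ 2) + B * int (fun x => k x ^+ 2)).
  have D1 := int_norm_sqr_le B0 d2 di dB.
  have D2 := int_band_part_le B0 f2 fh G2 Gk; rewrite -/d in D2.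
  rewrite /A !exprMn -expRM_natr exprVn sqr_sqrtr ?mulr_ge0 ?pi_ge0//.
  have -> : - (N%:R / 12) * 2%:R = - (N%:R / 6) :> R by field.
  have p1 : 2 ^+ 2 / (2 * pi) <= 1 :> R.
    rewrite ler_pdivrMr ?mulr_gt0 ?pi_gt0// mul1r.
    have := pi_ge2 R; lra.
  set E := expR _; have E0 : 0 <= E by exact: expR_ge0.
  apply: (@le_trans _ _ (1 * E * (2 * B * (2 * (int (fun x => f x ^+ 2) + B * int (fun x => k x ^+ 2)))))).
    have pp : 0 <= 2 * pi :> R by rewrite mulr_ge0 ?pi_ge0.
    apply: ler_pM; [by rewrite mulr_ge0// mulr_ge0 ?invr_ge0|exact: sqr_ge0| |].
      by rewrite ler_wpM2r.
    by apply: le_trans D1 _; rewrite ler_wpM2l// mulr_ge0// ltW.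
  by rewrite le_eqVlt; apply/orP; left; apply/eqP; ring.
have [T1 T2] := HC1 beta B N b0 B0 N1 BN; move: T1 T2; rewrite -/q -/M /=.
set b := beta `^ _; set E := expR _ in HA *; set F := int _; set K := int _ => T1 T2.
have b00 : 0 <= b by exact: powR_ge0.
apply: (@le_trans _ _ (4 * B * E * (F + B * K) * (b / beta * gauss_mass))).
  by rewrite ler_wpM2r// !mulr_ge0// invr_ge0 ltW.
have -> : 4 * B * E * (F + B * K) * (b / beta * gauss_mass) =
  4 * gauss_mass * (E * (B / beta) * b * F + E * (B / beta) * b * B * K) by ring.
have -> : 4 * gauss_mass * C1 * (q * (M `^ (2 * m) * F) + B `^ (1 - 2 * m) * K) =
  4 * gauss_mass * (C1 * (q * M `^ (2 * m)) * F + C1 * B `^ (1 - 2 * m) * K) by ring.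
by rewrite ler_wpM2l ?mulr_ge0// lerD// ler_wpM2r.
Qed.

End estimate.
End RealTheorem.

(** * Hartley and Fourier transforms *)

Section FourierHartley.
Context {R : realType}.
Local Notation mu := (@lebesgue_measure R).
Local Notation int f := (Rintegral mu setT f).
Implicit Types (f g h p q a b : R -> R) (u : R -> R[i]).

(* If [F[p + i q] = g1 + i g2] with [p], [q] real, then the Hartley transforms of [p] and
   [q] are [parity_mix (-1) g1 g2] and [parity_mix 1 g2 g1]. *)
Definition parity_mix (s : R) a b (x : R) : R :=
  (a x + a (- x)) / 2 + s * ((b x - b (- x)) / 2).

Lemma parity_mixN s a b x : parity_mix s a b (- x) = parity_mix (- s) a b x.
Proof. by rewrite /parity_mix opprK; field. Qed.

(** The mix keeps even parts in place and exchanges odd parts up to sign, so mixing twice restores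
    the function. *)
Lemma parity_mix_inv s a b x : s ^+ 2 = 1 ->
  parity_mix s (parity_mix (- s) a b) (parity_mix s b a) x = a x.
Proof.
move=> s2; rewrite /parity_mix opprK.
transitivity ((a x + a (- x)) / 2 + s ^+ 2 * ((a x - a (- x)) / 2)); first by field.
by rewrite s2; field.
Qed.

Lemma measurable_reflect f : measurable_fun setT f -> measurable_fun setT (fun x : R => f (- x)).
Proof. by move=> mf; apply: (measurableT_comp mf). Qed.

Lemma measurable_parity_mix s a b : measurable_fun setT a -> measurable_fun setT b ->
  measurable_fun setT (parity_mix s a b).
Proof.
move=> ma mb; have ma' := measurable_reflect ma; have mb' := measurable_reflect mb.
apply: measurable_funD; first by apply: measurable_funM => //; exact: measurable_funD.
by apply: measurable_funM => //; apply: measurable_funM => //; exact: measurable_funB.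
Qed.

Lemma ge0_integral_reflect (F : R -> \bar R) : measurable_fun setT F ->
  (forall x, (0 <= F x)%E) -> (\int[mu]_x F (- x)%R = \int[mu]_x F x)%E.
Proof.
move=> mF F0; have n1 : (-1 : R) != 0 by rewrite oppr_eq0 oner_eq0.
have := ge0_int_affine 0 n1 mF F0; rewrite normrN1 invr1 mul1e => <-.
by apply: eq_integral => x _; rewrite addr0 mulN1r.
Qed.

Lemma int_reflect f : intg f -> int (fun x => f (- x)) = int f.
Proof.
move=> fi; have n1 : (-1 : R) != 0 by rewrite oppr_eq0 oner_eq0.
have := int_affine 0 n1 fi; rewrite normrN1 invr1 mul1r => <-.
by apply: eq_Rintegral => x _; rewrite addr0 mulN1r.
Qed.

Lemma intg_reflect f : intg f -> intg (fun x => f (- x)).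
Proof.
move=> fi; have n1 : (-1 : R) != 0 by rewrite oppr_eq0 oner_eq0.
have := intg_affine 0 n1 fi.
by have -> : (fun x => f (-1 * x + 0)) = (fun x => f (- x)) by apply/funext => x; rewrite addr0 mulN1r.
Qed.

Lemma sqint_reflect f : sqint f -> sqint (fun x => f (- x)).
Proof. by move=> [mf fi]; split; [exact: measurable_reflect|exact: (intg_reflect fi)]. Qed.

Lemma sqint_parity_mix s a b : sqint a -> sqint b -> sqint (parity_mix s a b).
Proof.
move=> ha hb; have ha' := sqint_reflect ha; have hb' := sqint_reflect hb.
have -> : parity_mix s a b = (fun x => 2^-1 * (a x + a (- x)) + (s / 2) * (b x - b (- x))).
  by apply/funext => x; rewrite /parity_mix; field.
by apply: sqintD; apply: sqintZ; [exact: sqintD|exact: sqintB].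
Qed.

Lemma L2cvg_reflect (T : nat -> R -> R) g :
  (forall n, measurable_fun setT (T n)) -> measurable_fun setT g ->
  L2cvg T g -> L2cvg (fun n x => T n (- x)) (fun x => g (- x)).
Proof.
move=> mT mg; rewrite /L2cvg.
have -> : (fun n => \int[mu]_x ((T n (- x) - g (- x)) ^+ 2)%:E)%E =
  (fun n => \int[mu]_x ((T n x - g x) ^+ 2)%:E)%E; last by [].
apply/funext => n; apply: (@ge0_integral_reflect (fun x => ((T n x - g x) ^+ 2)%:E)).
  by apply/measurable_EFinP; apply: measurable_funX; exact: measurable_funB.
by move=> x; rewrite lee_fin sqr_ge0.
Qed.

(** The squared difference of two mixes is at most the sum of the four squared differences of the
    functions and their reflections, whose integrals all tend to 0. *)
Lemma L2cvg_parity_mix s (S T : nat -> R -> R) g h : s ^+ 2 = 1 ->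
  (forall n, measurable_fun setT (S n)) -> (forall n, measurable_fun setT (T n)) ->
  measurable_fun setT g -> measurable_fun setT h ->
  L2cvg S g -> L2cvg T h ->
  L2cvg (fun n => parity_mix s (S n) (T n)) (parity_mix s g h).
Proof.
move=> s2 mS mT mg mh Sg Th.
have Sg' := L2cvg_reflect mS mg Sg; have Th' := L2cvg_reflect mT mh Th.
rewrite /L2cvg.
have sq_ge0 (f : R -> R) x : (0 <= (f x ^+ 2)%:E)%E by rewrite lee_fin sqr_ge0.
have msq (f : R -> R) : measurable_fun setT f -> measurable_fun setT (fun x => (f x ^+ 2)%:E).
  by move=> mf; apply/measurable_EFinP; exact: measurable_funX.
pose E n : \bar R := (\int[mu]_x ((S n x - g x) ^+ 2)%:E + \int[mu]_x ((S n (- x) - g (- x)) ^+ 2)%:E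
   + (\int[mu]_x ((T n x - h x) ^+ 2)%:E + \int[mu]_x ((T n (- x) - h (- x)) ^+ 2)%:E))%E.
have H : E n @[n --> \oo] --> 0%E.
  rewrite -[X in _ --> X](adde0 0%E) -[X in _ --> (X + _)%E](adde0 0%E) -[X in _ --> (_ + X)%E](adde0 0%E).
  by apply: cvgeD; [|apply: cvgeD|apply: cvgeD].
apply: (@squeeze_cvge _ _ _ _ (fun=> 0%E) _ E); [apply: nearW => n|exact: cvg_cst|exact: H].
rewrite integral_ge0 /=; last by move=> x _; rewrite lee_fin sqr_ge0.
have dS := msq _ (measurable_funB (mS n) mg).
have dT := msq _ (measurable_funB (mT n) mh).
have dS' := msq _ (measurable_funB (measurable_reflect (mS n)) (measurable_reflect mg)).
have dT' := msq _ (measurable_funB (measurable_reflect (mT n)) (measurable_reflect mh)).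
rewrite /E -ge0_integralD// -[X in (_ <= _ + X)%E]ge0_integralD//.
rewrite -ge0_integralD//; try exact: emeasurable_funD;
  try by move=> x _; rewrite -EFinD lee_fin addr_ge0 ?sqr_ge0.
apply: ge0_le_integral => //.
- apply: (msq (fun x => parity_mix s (S n) (T n) x - parity_mix s g h x)).
  by apply: measurable_funB; exact: measurable_parity_mix.
- by apply: emeasurable_funD; exact: emeasurable_funD.
move=> x _; rewrite -!EFinD lee_fin /parity_mix.
set a := S n x; set a' := S n (- x); set b := T n x; set b' := T n (- x).
set c := g x; set c' := g (- x); set d := h x; set d' := h (- x).
have -> : (a + a') / 2 + s * ((b - b') / 2) - ((c + c') / 2 + s * ((d - d') / 2)) =
  ((a - c) + (a' - c') + s * ((b - d) - (b' - d'))) / 2 by field.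
move: (a - c) (a' - c') (b - d) (b' - d') => {}a {}a' {}b {}b'.
have e : (s * (b - b')) ^+ 2 = (b - b') ^+ 2 by rewrite exprMn s2 mul1r.
have := sqr_ge0 (a - a'); have := sqr_ge0 (b + b'); have := sqr_ge0 (a + a' - s * (b - b')).
move: e; set y := s * (b - b') => e.
nra.
Qed.

Lemma intg_cas f xi : intg f -> intg (fun x => f x * cas (xi * x)).
Proof.
move=> fi; apply: (intgM_bd (M := 2) fi); last by move=> x; exact: cas_norm.
have := @measurable_casM R xi.
by have -> : (fun x => cas (x * xi)) = (fun x => cas (xi * x)) by apply/funext => x; rewrite mulrC.
Qed.

Lemma hartley0_reflect f xi : intg f -> hartley0 (fun x => f (- x)) xi = hartley0 f (- xi).
Proof.
move=> fi; rewrite /hartley0 -(int_reflect (intg_cas (- xi) fi)).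
by apply: eq_Rintegral => x _; rewrite mulrNN.
Qed.

Lemma hartley_parity_mix s a b xi : intg a -> intg b ->
  hartley (parity_mix s a b) xi = parity_mix s (hartley a) (hartley b) xi.
Proof.
move=> ha hb; have ha' := intg_reflect ha; have hb' := intg_reflect hb.
rewrite /hartley /parity_mix -!mulrDr -mulrBr.
rewrite -!hartley0_reflect//.
have E : hartley0 (parity_mix s a b) xi = 2^-1 * (hartley0 a xi + hartley0 (fun x => a (- x)) xi)
  + s / 2 * (hartley0 b xi - hartley0 (fun x => b (- x)) xi).
  have i1 := intg_cas xi ha; have i2 := intg_cas xi hb.
  have i3 := intg_cas xi ha'; have i4 := intg_cas xi hb'.
  rewrite /hartley0 -(intD i1 i3) -(intB i2 i4) -(intZ _ (intgD i1 i3)) -(intZ _ (intgB i2 i4)).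
  rewrite -(intD (intgZ _ (intgD i1 i3)) (intgZ _ (intgB i2 i4))).
  by apply: eq_Rintegral => x _; rewrite /parity_mix; field.
rewrite (_ : hartley0 _ xi = hartley0 (parity_mix s a b) xi)// E.
by move: (Num.sqrt _)^-1 => c0; field.
Qed.

Lemma itvI_sym (c x : R) : itvI (- c) c (- x) = itvI (- c) c x.
Proof. by rewrite /itvI !indicE !mem_setE !in_itv/= -!ler_norml normrN. Qed.

Lemma hartley_trunc_parity_mix s a b n xi : sqint a -> sqint b ->
  hartley (trunc (parity_mix s a b) n) xi =
  parity_mix s (hartley (trunc a n)) (hartley (trunc b n)) xi.
Proof.
move=> ha hb; rewrite -hartley_parity_mix; last 2 first.
- exact: intg_trunc_itv.
- exact: intg_trunc_itv.
congr (hartley _ _); apply/funext => x.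
by rewrite /trunc /parity_mix itvI_sym; field.
Qed.

Lemma Rintegral_trunc f n : Rintegral mu `[(- n%:R), n%:R] f = int (trunc f n).
Proof.
rewrite Rintegral_mkcond; apply: eq_Rintegral => x _.
by rewrite /trunc /itvI patchE indicE; case: ifP; rewrite ?mulr1 ?mulr0.
Qed.

(** The cosine integral of [p] is the even part of its Hartley transform, the sine integral of [q]
    the odd part of its own. *)
Lemma int_cos_sin p q xi : intg p -> intg q ->
  (Num.sqrt (2 * pi))^-1 * int (fun x => cos (xi * x) * p x + sin (xi * x) * q x) =
  parity_mix 1 (hartley p) (hartley q) xi.
Proof.
move=> ip iq; rewrite /parity_mix /hartley.
have i1 := intg_cas xi ip; have i2 := intg_cas xi iq.
have i3 := intg_cas (- xi) ip; have i4 := intg_cas (- xi) iq.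
have E : int (fun x => cos (xi * x) * p x + sin (xi * x) * q x) =
  2^-1 * (hartley0 p xi + hartley0 p (- xi)) + 2^-1 * (hartley0 q xi - hartley0 q (- xi)).
  rewrite /hartley0 -(intD i1 i3) -(intB i2 i4) -(intZ _ (intgD i1 i3)) -(intZ _ (intgB i2 i4)).
  rewrite -(intD (intgZ _ (intgD i1 i3)) (intgZ _ (intgB i2 i4))).
  by apply: eq_Rintegral => x _; rewrite /cas mulNr cosN sinN; field.
by rewrite E; move: (Num.sqrt _)^-1 => c0; field.
Qed.

Lemma Re_ft_trunc u n xi :
  sqint (fun x => complex.Re (u x)) -> sqint (fun x => complex.Im (u x)) ->
  complex.Re (ft_trunc u n xi) =
  parity_mix 1 (hartley (trunc (fun x => complex.Re (u x)) n))
    (hartley (trunc (fun x => complex.Im (u x)) n)) xi.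
Proof.
move=> hp hq; rewrite -int_cos_sin; last 2 first.
- exact: intg_trunc_itv.
- exact: intg_trunc_itv.
rewrite /ft_trunc /cint /= mul0r subr0; congr (_ * _).
rewrite Rintegral_trunc; apply: eq_Rintegral => x _; rewrite /trunc.
by case: (u x) => c d /=; rewrite cosN sinN; ring.
Qed.

Lemma Im_ft_trunc u n xi :
  sqint (fun x => complex.Re (u x)) -> sqint (fun x => complex.Im (u x)) ->
  complex.Im (ft_trunc u n xi) =
  parity_mix (-1) (hartley (trunc (fun x => complex.Im (u x)) n))
    (hartley (trunc (fun x => complex.Re (u x)) n)) xi.
Proof.
move=> hp hq; have i1 := intg_trunc_itv (- n%:R) n%:R hp; have i2 := intg_trunc_itv (- n%:R) n%:R hq.
rewrite -[RHS]opprK -[- _ in RHS]mul1r.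
(* The imaginary part involves cosine minus sine, which is the combination of [int_cos_sin] at
   [- xi]. *)
have -> : parity_mix (-1) (hartley (trunc (fun x => complex.Im (u x)) n))
    (hartley (trunc (fun x => complex.Re (u x)) n)) xi =
  (Num.sqrt (2 * pi))^-1 * int (fun x => cos (- xi * x) * trunc (fun x => complex.Im (u x)) n x
     + sin (- xi * x) * trunc (fun x => complex.Re (u x)) n x).
  by rewrite int_cos_sin// parity_mixN.
rewrite mul1r opprK /ft_trunc /cint /= mul0r addr0; congr (_ * _).
rewrite Rintegral_trunc; apply: eq_Rintegral => x _; rewrite /trunc mulNr.
by case: (u x) => c d /=; ring.
Qed.

Lemma is_fourier_L2cvg u (g : R -> R[i]) :
  sqint (fun x => complex.Re (u x)) -> sqint (fun x => complex.Im (u x)) ->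
  is_fourier u g ->
  L2cvg (fun n => parity_mix 1 (hartley (trunc (fun x => complex.Re (u x)) n))
    (hartley (trunc (fun x => complex.Im (u x)) n))) (fun x => complex.Re (g x)) /\
  L2cvg (fun n => parity_mix (-1) (hartley (trunc (fun x => complex.Im (u x)) n))
    (hartley (trunc (fun x => complex.Re (u x)) n))) (fun x => complex.Im (g x)).
Proof.
move=> hp hq [[mg1 mg2] H].
have m1 n := (sqint_hartley_trunc n hp).1; have m2 n := (sqint_hartley_trunc n hq).1.
pose T1 n := parity_mix 1 (hartley (trunc (fun x => complex.Re (u x)) n))
    (hartley (trunc (fun x => complex.Im (u x)) n)).
pose T2 n := parity_mix (-1) (hartley (trunc (fun x => complex.Im (u x)) n))
    (hartley (trunc (fun x => complex.Re (u x)) n)).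
have mT1 n : measurable_fun setT (T1 n) by exact: measurable_parity_mix.
have mT2 n : measurable_fun setT (T2 n) by exact: measurable_parity_mix.
have d1 n : measurable_fun setT (fun x => ((T1 n x - complex.Re (g x)) ^+ 2)%:E).
  by apply/measurable_EFinP; apply: measurable_funX; exact: measurable_funB.
have d2 n : measurable_fun setT (fun x => ((T2 n x - complex.Im (g x)) ^+ 2)%:E).
  by apply/measurable_EFinP; apply: measurable_funX; exact: measurable_funB.
have E n : (\int[mu]_xi (cabs2 (ft_trunc u n xi - g xi))%:E =
    \int[mu]_xi (((T1 n xi - complex.Re (g xi)) ^+ 2)%:E + ((T2 n xi - complex.Im (g xi)) ^+ 2)%:E))%E.
  apply: eq_integral => xi _; rewrite -EFinD /T1 /T2 -Re_ft_trunc// -Im_ft_trunc//.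
  by congr EFin; rewrite /cabs2; case: (ft_trunc u n xi) (g xi) => c d [c' d'].
(* Real and imaginary errors are each dominated by the squared modulus of the complex error. *)
have K (D : nat -> R -> \bar R) : (forall n, measurable_fun setT (D n)) ->
    (forall n x, (0 <= D n x <= ((T1 n x - complex.Re (g x)) ^+ 2)%:E +
                 ((T2 n x - complex.Im (g x)) ^+ 2)%:E)%E) ->
    ((\int[mu]_x D n x)%E @[n --> \oo] --> 0%E).
  move=> mD HD; apply: (squeeze_cvge _ (cvg_cst 0%E) H); apply: nearW => n.
  rewrite integral_ge0 /=; last by move=> x _; case/andP: (HD n x).
  rewrite E; apply: ge0_le_integral => //; try (by move=> x _; case/andP: (HD n x));
    [exact: mD|exact: (emeasurable_funD (d1 n) (d2 n))].
split; apply: K => // n x; rewrite -EFinD !lee_fin sqr_ge0/= ?lerDl ?lerDr sqr_ge0//.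
Qed.

Lemma L2cvg_ext (S T : nat -> R -> R) g h : (forall n x, S n x = T n x) ->
  (forall x, g x = h x) -> L2cvg S g -> L2cvg T h.
Proof.
move=> ST gh; suff -> : S = T by suff -> : g = h by []; apply/funext.
by apply/funext => n; apply/funext => x.
Qed.

Lemma is_fourier_hartley u (g : R -> R[i]) :
  sqint (fun x => complex.Re (u x)) -> sqint (fun x => complex.Im (u x)) ->
  is_fourier u g ->
  is_hartley (fun x => complex.Re (u x))
    (parity_mix (-1) (fun x => complex.Re (g x)) (fun x => complex.Im (g x))) /\
  is_hartley (fun x => complex.Im (u x))
    (parity_mix 1 (fun x => complex.Im (g x)) (fun x => complex.Re (g x))).
Proof.
move=> hp hq ug; have [C1 C2] := is_fourier_L2cvg hp hq ug.
have [[mg1 mg2] _] := ug.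
have m1 n := (sqint_hartley_trunc n hp).1; have m2 n := (sqint_hartley_trunc n hq).1.
have mT1 n := measurable_parity_mix 1 (m1 n) (m2 n).
have mT2 n := measurable_parity_mix (-1) (m2 n) (m1 n).
have s1 : (-1 : R) ^+ 2 = 1 by rewrite sqrrN expr1n.
split; split; try exact: measurable_parity_mix.
- apply: L2cvg_ext (L2cvg_parity_mix s1 mT1 mT2 mg1 mg2 C1 C2) => // n x.
  by rewrite -[RHS](parity_mix_inv _ (hartley (trunc (fun x => complex.Im (u x)) n)) _ s1) opprK.
- apply: L2cvg_ext (L2cvg_parity_mix (expr1n _ 2) mT2 mT1 mg2 mg1 C2 C1) => // n x.
  by rewrite -[RHS](parity_mix_inv _ (hartley (trunc (fun x => complex.Re (u x)) n)) _ (expr1n _ 2)).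
Qed.

(** The counterpart of [is_fourier_hartley] used for the extension [G]: there the mixes of the
    components of [G] must extend the dilated Hartley transforms of the components of [u], so the
    mixing is on the input side. The reflection of the output is harmless, the Sobolev weight being
    even. *)
Lemma is_fourier_hartley_mix u (g : R -> R[i]) :
  sqint (fun x => complex.Re (u x)) -> sqint (fun x => complex.Im (u x)) ->
  is_fourier u g ->
  is_hartley (parity_mix (-1) (fun x => complex.Re (u x)) (fun x => complex.Im (u x)))
    (fun x => complex.Re (g (- x))) /\
  is_hartley (parity_mix 1 (fun x => complex.Im (u x)) (fun x => complex.Re (u x)))
    (fun x => complex.Im (g (- x))).
Proof.
move=> hp hq ug; have [C1 C2] := is_fourier_L2cvg hp hq ug.
have [[mg1 mg2] _] := ug.
have m1 n := (sqint_hartley_trunc n hp).1; have m2 n := (sqint_hartley_trunc n hq).1.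
have mT1 n := measurable_parity_mix 1 (m1 n) (m2 n).
have mT2 n := measurable_parity_mix (-1) (m2 n) (m1 n).
split; split.
- exact: (measurable_reflect mg1).
- apply: L2cvg_ext (L2cvg_reflect mT1 mg1 C1) => // n x.
  by rewrite parity_mixN hartley_trunc_parity_mix.
- exact: (measurable_reflect mg2).
- apply: L2cvg_ext (L2cvg_reflect mT2 mg2 C2) => // n x.
  by rewrite parity_mixN opprK hartley_trunc_parity_mix.
Qed.

Lemma ae_reflect (P : R -> Prop) : {ae mu, forall x, P x} -> {ae mu, forall x, P (- x)}.
Proof.
move=> H; have n1 : (-1 : R) != 0 by rewrite oppr_eq0 oner_eq0.
have := negligible_affine 0 n1 H.
have -> : [set x : R | (~` P) (-1 * x + 0)] = [set x | ~ P (- x)].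
  by apply/seteqP; split => x /=; rewrite addr0 mulN1r.
by [].
Qed.

Lemma ae_parity_mix s a b c d (A : set R) : (forall x, A x -> A (- x)) ->
  {ae mu, forall x, A x -> a x = c x /\ b x = d x} ->
  {ae mu, forall x, A x -> parity_mix s a b x = parity_mix s c d x}.
Proof.
move=> Asym H; apply: ae_impl (ae_and H (ae_reflect H)) => x [h1 h2] Ax.
have [e1 e2] := h1 Ax; have [e3 e4] := h2 (Asym _ Ax).
by rewrite /parity_mix e1 e2 e3 e4.
Qed.

End FourierHartley.

(** * The estimate for complex functions *)

Section ExtendedSqrt.
Context {R : realType}.
Implicit Types x y : \bar R.

Lemma esqrt_ge0 x : (0 <= esqrt x)%E.
Proof. by case: x => [r| |] //=; rewrite lee_fin sqrtr_ge0. Qed.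

Lemma le_esqrt x y : (0 <= x)%E -> (x <= y)%E -> (esqrt x <= esqrt y)%E.
Proof.
case: x => [r| |]//; case: y => [s| |]//=; rewrite ?leey// !lee_fin => r0 rs.
by rewrite ler_wsqrtr.
Qed.

Lemma esqrtD x y : (0 <= x)%E -> (0 <= y)%E -> (esqrt (x + y) <= esqrt x + esqrt y)%E.
Proof.
case: x => [r| |]//; case: y => [s| |]//=; rewrite ?leey// !lee_fin => r0 s0.
rewrite -[leRHS]ger0_norm ?addr_ge0 ?sqrtr_ge0// -sqrtr_sqr ler_wsqrtr//.
rewrite sqrrD !sqr_sqrtr// -addrA lerD2l lerDr mulrn_wge0// mulr_ge0 ?sqrtr_ge0//.
Qed.

Lemma esqrtZ (c : R) x : 0 < c -> (0 <= x)%E ->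
  esqrt (c%:E * x)%E = ((Num.sqrt c)%:E * esqrt x)%E.
Proof.
move=> c0; have s0 : 0 < Num.sqrt c by rewrite sqrtr_gt0.
case: x => [r| |]//=; last by rewrite !gt0_muley.
by rewrite lee_fin => r0; rewrite sqrtrM// ltW.
Qed.

Lemma ereal_sum2 (c S e M : R) (t t' w w' i i' f f' : \bar R) :
  0 <= c -> 0 <= S -> 0 <= e -> 0 <= M ->
  (0 <= t)%E -> (0 <= t')%E -> (0 <= w)%E -> (0 <= w')%E ->
  (0 <= i)%E -> (0 <= i')%E -> (0 <= f)%E -> (0 <= f')%E ->
  (c%:E * (t + S%:E * w + e%:E * (i + M%:E * f)) + c%:E * (t' + S%:E * w' + e%:E * (i' + M%:E * f'))
  <= c%:E * (t + t' + S%:E * (w + w') + e%:E * (i + i' + M%:E * (f + f'))))%E.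
Proof.
move=> c0 S0 e0 M0 *.
rewrite -ge0_muleDr; last 2 first.
- by rewrite !adde_ge0 ?mule_ge0 ?adde_ge0 ?mule_ge0 ?lee_fin.
- by rewrite !adde_ge0 ?mule_ge0 ?adde_ge0 ?mule_ge0 ?lee_fin.
rewrite addeACA [X in (_ * (X + _) <= _)%E]addeACA -(ge0_muleDr S%:E)//.
rewrite -(ge0_muleDr e%:E) ?adde_ge0 ?mule_ge0 ?lee_fin//.
by rewrite [X in (_ * (_ + _ * X) <= _)%E]addeACA -(ge0_muleDr M%:E).
Qed.

(** Passes from a bound for every extension to the infimum. If the infimum is infinite, in
    particular if there is no extension, positivity of [b] and [c] makes the bound trivial. *)
Lemma le_ereal_inf_affine (S : set (\bar R)) (y A : \bar R) (c b : R) :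
  0 < c -> 0 < b -> (0 <= A)%E -> (forall e, S e -> (0 <= e)%E) ->
  (forall e, S e -> (y <= c%:E * (A + b%:E * e))%E) ->
  (y <= c%:E * (A + b%:E * ereal_inf S))%E.
Proof.
move=> c0 b0 A0 S0 HS.
have i0 : (0 <= ereal_inf S)%E by apply: le_ereal_inf_tmp => e /S0.
have A0' : A != -oo%E by rewrite -ltNye (lt_le_trans (ltNyr 0)).
case E : (ereal_inf S) i0 => [i| |]// i0; last first.
  by rewrite gt0_muley ?lte_fin// addey// gt0_muley ?lte_fin// leey.
apply/lee_addgt0Pr => e e0.
have fi : ereal_inf S \is a fin_num by rewrite E.
have d0 : 0 < e / (c * b) by rewrite divr_gt0// mulr_gt0.
have [z Sz] := lb_ereal_inf_adherent d0 fi; rewrite E => /ltW zi.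
apply: le_trans (HS _ Sz) _.
apply: (@le_trans _ _ (c%:E * (A + b%:E * (i + e / (c * b))%:E))%E).
  apply: lee_wpmul2l; first by rewrite lee_fin ltW.
  by apply: leeD2l; apply: lee_wpmul2l; rewrite ?lee_fin ?(ltW b0).
case: A A0 A0' {HS} => [a| |]// _ _; last first.
  by rewrite !addye// !gt0_muley ?lte_fin// addye.
rewrite -!(EFinM, EFinD) lee_fin le_eqVlt; apply/orP; left; apply/eqP.
by field; rewrite !gt_eqF.
Qed.

End ExtendedSqrt.

Section ComplexTheorem.
Context {R : realType}.
Local Notation mu := (@lebesgue_measure R).
Local Notation int f := (Rintegral mu setT f).
Implicit Types (u v g : R -> R[i]).

Lemma ReB (z w : R[i]) : complex.Re (z - w) = complex.Re z - complex.Re w.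
Proof. by case: z w => a b [c d]. Qed.

Lemma ImB (z w : R[i]) : complex.Im (z - w) = complex.Im z - complex.Im w.
Proof. by case: z w => a b [c d]. Qed.

Lemma cabs2_ge0 (z : R[i]) : 0 <= cabs2 z.
Proof. by rewrite addr_ge0 ?sqr_ge0. Qed.

Lemma measurable_cabs2 u : cmeasurable u -> measurable_fun setT (fun x => cabs2 (u x)).
Proof. by move=> [m1 m2]; apply: measurable_funD; exact: measurable_funX. Qed.

Lemma sqint_le (f F : R -> R) : measurable_fun setT f -> measurable_fun setT F ->
  (\int[mu]_x (F x)%:E < +oo)%E -> (forall x, f x ^+ 2 <= F x) -> sqint f.
Proof.
move=> mf mF Foo fF; apply: sqint_lty => //; apply: le_lt_trans Foo.
apply: ge0_le_integral => //.
- by move=> x _; rewrite lee_fin sqr_ge0.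
- by apply/measurable_EFinP; exact: measurable_funX.
- exact/measurable_EFinP.
- by move=> x _; rewrite lee_fin.
Qed.

Lemma integral_cabs2 u (w : R -> R) : cmeasurable u -> measurable_fun setT w ->
  (forall x, 0 <= w x) ->
  (\int[mu]_x (cabs2 (u x) * w x)%:E =
   \int[mu]_x (complex.Re (u x) ^+ 2 * w x)%:E + \int[mu]_x (complex.Im (u x) ^+ 2 * w x)%:E)%E.
Proof.
move=> [m1 m2] mw w0; rewrite -ge0_integralD//; first by
  apply: eq_integral => x _; rewrite -EFinD mulrDl.
- by move=> x _; rewrite lee_fin mulr_ge0 ?sqr_ge0.
- by apply/measurable_EFinP; apply: measurable_funM => //; exact: measurable_funX.
- by move=> x _; rewrite lee_fin mulr_ge0 ?sqr_ge0.
- by apply/measurable_EFinP; apply: measurable_funM => //; exact: measurable_funX.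
Qed.

Lemma horner_complexE (p : {poly R[i]}) : exists P Q : {poly R},
  forall x, p.[x%:C%C] = (P.[x] +i* Q.[x])%C.
Proof.
exists (\poly_(i < size p) complex.Re p`_i), (\poly_(i < size p) complex.Im p`_i) => y.
rewrite !horner_poly horner_coef; elim: (size p) => [|n IH]; first by rewrite !big_ord0.
by rewrite !big_ord_recr /= IH -rmorphXn /=; case: (p`_n) => a b; simpc.
Qed.

(** * The weighted space, best approximation and the complex estimate *)

Section weight.
Variable m : R.
Hypothesis m0 : 0 <= m.
Let m20 : 0 <= 2 * m. Proof. by rewrite mulr_ge0. Qed.

Lemma hweight_sqr (x : R) : hweight m x = (`|x| `^ m) ^+ 2.
Proof. by rewrite /hweight -powR_mulrn ?powR_ge0// -powRrM mulrC. Qed.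

Lemma sqint_gauss_monomial (beta c : R) n : 0 < beta ->
  sqint (fun x : R => expR (- (beta ^+ 2 * x ^+ 2) / 2) * (c * x ^+ n) * `|x| `^ m).
Proof.
move=> b0.
have mf : measurable_fun setT (fun x : R => expR (- (beta ^+ 2 * x ^+ 2) / 2) * (c * x ^+ n) * `|x| `^ m).
  apply: measurable_funM; last exact: measurable_hweight.
  apply: measurable_funM; last by apply: measurable_funM => //; exact: measurable_funX.
  apply: measurableT_comp => //; apply: measurable_funM => //.
  by apply: measurableT_comp => //; apply: measurable_funM => //; exact: measurable_funX.
split=> //.
have b20 : 0 < beta ^+ 2 by rewrite exprn_gt0.
have i1 := intgZ (c ^+ 2) (intg_gauss_powR (addr_ge0 (ler0n R (2 * n)) m20) b20).
have -> : (fun x : R => (expR (- (beta ^+ 2 * x ^+ 2) / 2) * (c * x ^+ n) * `|x| `^ m) ^+ 2) =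
  (fun x => c ^+ 2 * (expR (- (beta ^+ 2 * x ^+ 2)) * `|x| `^ ((2 * n)%:R + 2 * m))); last by [].
apply/funext => x; have -> : - (beta ^+ 2 * x ^+ 2) = - (beta ^+ 2 * x ^+ 2) / 2 * 2%:R by field.
rewrite expRM_natr [X in X / 2](_ : _ = - (beta ^+ 2 * x ^+ 2)); last by field.
have -> : `|x| `^ ((2 * n)%:R + 2 * m) = (x ^+ n) ^+ 2 * (`|x| `^ m) ^+ 2.
  have -> : (x ^+ n) ^+ 2 = `|x| `^ (2 * n)%:R.
    by rewrite powR_mulrn// -exprM mulnC exprM -(real_normK (num_real x)) -exprM.
  rewrite -hweight_sqr /hweight.
  (* Adding exponents could fail at base 0 if they sum to 0; as both are nonnegative, this forces n
     = m = 0. *)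
  have [|e] := boolP ((2 * n)%:R + 2 * m == 0 :> R); last by rewrite powRD// (negbTE e).
  by rewrite paddr_eq0 ?ler0n// => /andP[/eqP-> /eqP->]; rewrite addr0 powRr0 mulr1.
by ring.
Qed.

Lemma sqint_gauss_poly (beta : R) (P : {poly R}) : 0 < beta ->
  sqint (fun x : R => expR (- (beta ^+ 2 * x ^+ 2) / 2) * P.[x] * `|x| `^ m).
Proof.
move=> b0.
have -> : (fun x : R => expR (- (beta ^+ 2 * x ^+ 2) / 2) * P.[x] * `|x| `^ m) =
  (fun x => expR (- (beta ^+ 2 * x ^+ 2) / 2) * (\sum_(i < size P) P`_i * x ^+ i) * `|x| `^ m).
  by apply/funext => x; rewrite horner_coef.
elim: (size P) => [|n IH].
  have := sqint_gauss_monomial 0 0 b0.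
  by under eq_fun do rewrite mul0r mulr0 mul0r; under [in X in _ -> X]eq_fun do rewrite big_ord0 mulr0 mul0r.
have := sqintD IH (sqint_gauss_monomial P`_n n b0).
set F := (fun x => _ + _); set F' := (fun x => _); suff -> : F = F' by [].
by apply/funext => x; rewrite /F /F' big_ord_recr/=; ring.
Qed.

Lemma hspace_sqint (beta : R) N v : 0 < beta -> hspace beta N v ->
  sqint (fun x => complex.Re (v x) * `|x| `^ m) /\ sqint (fun x => complex.Im (v x) * `|x| `^ m).
Proof.
move=> b0 [p [_ ->]]; have [P [Q PQ]] := horner_complexE p.
split; [have := sqint_gauss_poly P b0|have := sqint_gauss_poly Q b0];
  set F := (fun x => _); set F' := (fun x => _); suff -> : F = F' by [];
  by apply/funext => x; rewrite /F /F' PQ; simpc.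
Qed.

Lemma hspaceB (beta : R) N v w : hspace beta N v -> hspace beta N w ->
  hspace beta N (fun x => v x - w x).
Proof.
move=> [p [sp ->]] [q [sq ->]]; exists (p - q); split.
  by rewrite (leq_trans (size_polyD _ _))// size_polyN geq_max sp sq.
by apply/funext => x; rewrite hornerD hornerN mulrBr.
Qed.

Lemma hspace_polys (beta : R) N (P Q : {poly R}) : (size P <= N.+1)%N -> (size Q <= N.+1)%N ->
  hspace beta N (fun x => (expR (- (beta ^+ 2 * x ^+ 2) / 2) * P.[x]
    +i* (expR (- (beta ^+ 2 * x ^+ 2) / 2) * Q.[x]))%C).
Proof.
move=> sP sQ.
exists (map_poly (real_complex R) P + (0 +i* 1)%C *: map_poly (real_complex R) Q); split.
  rewrite (leq_trans (size_polyD _ _))// geq_max size_map_poly sP.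
  by rewrite (leq_trans (size_scale_leq _ _))// size_map_poly.
by apply/funext => x; rewrite hornerD hornerZ !horner_map /=; simpc.
Qed.

Section integrable.
Variable u : R -> R[i].
Hypothesis mu_u : cmeasurable u.
Hypothesis u2 : (\int[mu]_x (cabs2 (u x) * (1 + x ^+ 2) `^ m)%:E < +oo)%E.

Lemma sqint_dominated (f : R -> R) : measurable_fun setT f ->
  (forall x, f x ^+ 2 <= cabs2 (u x) * (1 + x ^+ 2) `^ m) -> sqint f.
Proof.
move=> mf fu; apply: sqint_le u2 fu => //.
apply: measurable_funM; last exact: measurable_powR_weight.
exact: measurable_cabs2.
Qed.

Lemma sqint_components : sqint (fun x => complex.Re (u x)) /\ sqint (fun x => complex.Im (u x)).
Proof.
split; apply: sqint_dominated; try by [exact: mu_u.1|exact: mu_u.2];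
  move=> x; rewrite (@le_trans _ _ (cabs2 (u x)))// ?lerDl ?lerDr ?sqr_ge0// ler_peMr ?cabs2_ge0// ge1_powR_weight//.
Qed.

Lemma sqint_components_weight : sqint (fun x => complex.Re (u x) * `|x| `^ m) /\
  sqint (fun x => complex.Im (u x) * `|x| `^ m).
Proof.
have mw := @measurable_hweight R m.
split; apply: sqint_dominated; try by [apply: measurable_funM => //; exact: mu_u.1|apply: measurable_funM => //; exact: mu_u.2];
  move=> x; rewrite exprMn -hweight_sqr; apply: ler_pM; rewrite ?sqr_ge0 ?powR_ge0 ?lerDl ?lerDr ?sqr_ge0//;
  exact: powR_norm_weight.
Qed.

(** Pythagoras for u - w = (u - v) + (v - w): the cross term is twice the real part of the inner
    product of u - v with v - w, an element of the space. *)
Lemma best_approx (beta : R) (N : nat) v w : 0 < beta ->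
  is_wproj m beta N u v -> hspace beta N w ->
  (\int[mu]_x (cabs2 (u x - v x) * hweight m x)%:E <=
   \int[mu]_x (cabs2 (u x - w x) * hweight m x)%:E)%E.
Proof.
move=> b0 [hv orth] hw; have hvw := hspaceB hv hw.
have [ov _] := orth _ hvw.
have [u1 u2'] := sqint_components_weight.
have [v1 v2] := hspace_sqint b0 hv.
have [w1 w2] := hspace_sqint b0 hvw.
pose s (x : R) := `|x| `^ m.
pose a x := complex.Re (u x) * s x - complex.Re (v x) * s x.
pose b x := complex.Im (u x) * s x - complex.Im (v x) * s x.
pose c x := complex.Re (v x - w x) * s x.
pose d x := complex.Im (v x - w x) * s x.
have a2 : sqint a by exact: sqintB.
have b2 : sqint b by exact: sqintB.
have iab := intgD a2.2 b2.2; have icd := intgD w1.2 w2.2.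
have iac := sqint_mul a2 w1; have ibd := sqint_mul b2 w2.
have ix := intgZ 2 (intgD iac ibd).
have E0 : int (fun x => 2 * (a x * c x + b x * d x)) = 0.
  rewrite (intZ _ (intgD iac ibd)) [X in _ * X](_ : _ = 0) ?mulr0// -[RHS]ov.
  apply: eq_Rintegral => x _; rewrite hweight_sqr /a /b /c /d -/(s x).
  by case: (u x) (v x) (w x) => ? ? [? ?] [? ?] /=; ring.
have -> : (\int[mu]_x (cabs2 (u x - v x) * hweight m x)%:E = (int (fun x => a x ^+ 2 + b x ^+ 2))%:E)%E.
  rewrite (EFin_int iab); apply: eq_integral => x _; congr EFin.
  by rewrite /cabs2 ReB ImB hweight_sqr /a /b -/(s x); ring.
have -> : (\int[mu]_x (cabs2 (u x - w x) * hweight m x)%:E =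
   (int (fun x => (a x ^+ 2 + b x ^+ 2) + (c x ^+ 2 + d x ^+ 2) + 2 * (a x * c x + b x * d x)))%:E)%E.
  rewrite (EFin_int (intgD (intgD iab icd) ix)); apply: eq_integral => x _; congr EFin.
  by rewrite /cabs2 /c /d !ReB !ImB hweight_sqr /a /b -/(s x); ring.
rewrite lee_fin (intD (intgD iab icd) ix) E0 addr0 (intD iab icd) lerDl.
by apply: int_ge0 => x; rewrite addr_ge0 ?sqr_ge0.
Qed.

End integrable.

Lemma weighted_estimate : exists2 C : R, 0 < C &
  forall (beta B : R) (N : nat) (u v g G k : R -> R[i]),
  0 < beta -> 0 < B -> (1 <= N)%N -> 12 * B ^+ 2 = N%:R * beta ^+ 2 ->
  cmeasurable u -> (\int[mu]_x (cabs2 (u x) * (1 + x ^+ 2) `^ m)%:E < +oo)%E ->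
  is_wproj m beta N u v -> is_fourier u g ->
  cmeasurable G -> (\int[mu]_x (cabs2 (G x))%:E < +oo)%E ->
  {ae mu, forall x, Omega x -> G x = g (B * x)} -> is_fourier G k ->
  (\int[mu]_x (cabs2 (u x - v x) * hweight m x)%:E <=
   C%:E * (\int[mu]_x (cabs2 (if (B / beta ^+ 2 < `|x|)%R then u x else 0%R) * hweight m x)%:E
    + (B `^ (1 - 2 * m))%:E * \int[mu]_x ((1 + x ^+ 2) `^ m * cabs2 (k x))%:E
    + (expR (- (N%:R / 12)))%:E * (\int[mu]_x (cabs2 (u x) * hweight m x)%:E
       + ((B / beta ^+ 2) `^ (2 * m))%:E * \int[mu]_x (cabs2 (u x) * 1)%:E)))%E.
Proof.
have [C C0 HC] := real_estimate m0; exists C => //.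
move=> beta B N u v g G k b0 B0 N1 BN mu_u u2 pv ug mG G2 GO Gk.
have [p2 q2] := sqint_components mu_u u2.
have [G12 G22] : sqint (fun x => complex.Re (G x)) /\ sqint (fun x => complex.Im (G x)).
  have mc := measurable_cabs2 mG.
  by split; [apply: sqint_le mG.1 mc G2 _ => x|apply: sqint_le mG.2 mc G2 _ => x]; rewrite ?lerDl ?lerDr sqr_ge0.
have [h1 h2] := is_fourier_hartley p2 q2 ug.
have [k1 k2] := is_fourier_hartley_mix G12 G22 Gk.
have dil s a b (x : R) : parity_mix s (fun x => a (B * x)) (fun x => b (B * x)) x = parity_mix s a b (B * x).
  by rewrite /parity_mix mulrN.
have Osym x : Omega x -> Omega (- x : R) by rewrite /Omega/= normrN.
have ae1 : {ae mu, forall xi, 1 < `|xi| -> parity_mix (-1) (fun x => complex.Re (G x)) (fun x => complex.Im (G x)) xi =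
   parity_mix (-1) (fun x => complex.Re (g x)) (fun x => complex.Im (g x)) (B * xi)}.
  have aeG : {ae mu, forall x, Omega x -> complex.Re (G x) = complex.Re (g (B * x)) /\
      complex.Im (G x) = complex.Im (g (B * x))}.
    by apply: ae_impl GO => x H Ox; rewrite (H Ox).
  by apply: ae_impl (ae_parity_mix (-1) Osym aeG) => x H Ox; rewrite -dil; exact: H.
have ae2 : {ae mu, forall xi, 1 < `|xi| -> parity_mix 1 (fun x => complex.Im (G x)) (fun x => complex.Re (G x)) xi =
   parity_mix 1 (fun x => complex.Im (g x)) (fun x => complex.Re (g x)) (B * xi)}.
  have aeG : {ae mu, forall x, Omega x -> complex.Im (G x) = complex.Im (g (B * x)) /\
      complex.Re (G x) = complex.Re (g (B * x))}.
    by apply: ae_impl GO => x H Ox; rewrite (H Ox).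
  by apply: ae_impl (ae_parity_mix 1 Osym aeG) => x H Ox; rewrite -dil; exact: H.
have [P [sP HP]] := HC beta B N _ _ _ _ b0 B0 N1 BN p2 h1 (sqint_parity_mix _ G12 G22) k1 ae1.
have [Q [sQ HQ]] := HC beta B N _ _ _ _ b0 B0 N1 BN q2 h2 (sqint_parity_mix _ G22 G12) k2 ae2.
(* The real approximants of Re u and Im u together form one complex competitor for the
   projection. *)
have hw := hspace_polys beta sP sQ.
apply: le_trans (best_approx mu_u u2 b0 pv hw) _.
have mom := @measurable_hweight R (2 * m).
have om0 x : 0 <= hweight m x by exact: powR_ge0.
have mgau (S : {poly R}) : measurable_fun setT (fun x : R => expR (- (beta ^+ 2 * x ^+ 2) / 2) * S.[x]).
  apply: measurable_funM; last exact: measurable_poly.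
  apply: measurableT_comp => //; apply: measurable_funM => //.
  by apply: measurableT_comp => //; exact: measurable_funM.
rewrite (integral_cabs2 (u := fun x => u x - _)) //; last first.
  by split; [under eq_fun do rewrite ReB|under eq_fun do rewrite ImB]; apply: measurable_funB;
    by [exact: mu_u.1|exact: mu_u.2|exact: mgau].
under eq_integral do rewrite ReB /=.
under [X in (_ + X)%E]eq_integral do rewrite ImB /=.
apply: le_trans (leeD HP HQ) _.
have mut : cmeasurable (fun x => if B / beta ^+ 2 < `|x| then u x else 0).
  split; [have := measurable_if_norm (B / beta ^+ 2) mu_u.1|have := measurable_if_norm (B / beta ^+ 2) mu_u.2];
  set F := (fun x => _); set F' := (fun x => _); suff -> : F = F' by [];
  by apply/funext => x; rewrite /F /F'; case: ifP.
have [[mk1 mk2] _] := Gk.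
have mw := @measurable_powR_weight R m.
rewrite (integral_cabs2 mut)// (integral_cabs2 mu_u)// (integral_cabs2 (w := fun=> 1) mu_u)//.
have -> : (\int[mu]_x ((1 + x ^+ 2) `^ m * cabs2 (k x))%:E =
    \int[mu]_x (cabs2 (k x) * (1 + x ^+ 2) `^ m)%:E)%E.
  by apply: eq_integral => x _; rewrite mulrC.
rewrite (integral_cabs2 (u := k))//; last by move=> x; exact: powR_ge0.
have reflect (a : R -> R) : measurable_fun setT a ->
    (\int[mu]_x ((1 + x ^+ 2) `^ m * a (- x) ^+ 2)%:E = \int[mu]_x (a x ^+ 2 * (1 + x ^+ 2) `^ m)%:E)%E.
  move=> ma; rewrite -(@ge0_integral_reflect R (fun x => (a x ^+ 2 * (1 + x ^+ 2) `^ m)%:E)).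
  - by apply: eq_integral => x _; rewrite sqrrN mulrC.
  - by apply/measurable_EFinP; apply: measurable_funM => //; exact: measurable_funX.
  - by move=> x; rewrite lee_fin mulr_ge0 ?sqr_ge0 ?powR_ge0.
rewrite (reflect (fun x => complex.Re (k x)))// (reflect (fun x => complex.Im (k x)))//.
have tail (a : R[i] -> R) : a 0 = 0 ->
    (\int[mu]_x (a (if (B / beta ^+ 2 < `|x|)%R then u x else 0%R) ^+ 2 * hweight m x)%:E =
     \int[mu]_x ((if (B / beta ^+ 2 < `|x|)%R then a (u x) else 0%R) ^+ 2 * `|x| `^ (2 * m))%:E)%E.
  by move=> a0; apply: eq_integral => x _; case: ifP; rewrite ?a0.
rewrite (tail (@complex.Re R))// (tail (@complex.Im R))//.
have mul1 (a : R -> R) : (\int[mu]_x (a x ^+ 2 * 1)%:E = \int[mu]_x (a x ^+ 2)%:E)%E.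
  by apply: eq_integral => x _; rewrite mulr1.
rewrite (mul1 (fun x => complex.Re (u x))) (mul1 (fun x => complex.Im (u x))).
apply: ereal_sum2; rewrite ?powR_ge0 ?expR_ge0 ?(ltW C0)//; apply: integral_ge0 => x _;
  rewrite lee_fin; first [exact: sqr_ge0|apply: mulr_ge0; [exact: sqr_ge0|exact: powR_ge0]].
Qed.

End weight.
End ComplexTheorem.

Unset Implicit Arguments.
Local Open Scope complex_scope.

Theorem mainTheorem3 (R : realType) (mu : R) : 0 <= mu ->
  exists C : R, forall (beta : R) (N : nat) (u v g : R -> R[i]),
    0 < beta -> (1 <= N)%N ->
    cmeasurable u ->
    (\int[leb]_x ((cabs2 (u x) * (1 + x ^+ 2) `^ mu)%:E) < +oo)%E ->
    is_wproj mu beta N u v ->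
    is_fourier u g ->
    let M : R := Num.sqrt N%:R / (2 * Num.sqrt 3 * beta) in
    let B : R := Num.sqrt N%:R * beta / (2 * Num.sqrt 3) in
    (wnorm (hweight mu) (fun x => u x - v x)%R <=
     C%:E * (wnorm (hweight mu) (fun x => if (M < `|x|)%R then u x else 0%R)
             + (B `^ (1 / 2 - mu))%:E * hnorm_ext mu (fun xi => g (B * xi)%R)
             + (expR (- (N%:R / 24)))%:E
               * (wnorm (hweight mu) u + l2norm u * (M `^ mu)%:E)))%E.
Proof.
move=> mu0; have [C C0 HC] := weighted_estimate mu0.
exists (Num.sqrt C) => beta N u v g b0 N1 mu_u u2 pv ug; lazy zeta.
set M := Num.sqrt N%:R / (2 * Num.sqrt 3 * beta).
set B := Num.sqrt N%:R * beta / (2 * Num.sqrt 3).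
have sN : 0 < Num.sqrt (N%:R : R) by rewrite sqrtr_gt0 ltr0n.
have s3 : 0 < Num.sqrt (3 : R) by rewrite sqrtr_gt0.
have B0 : 0 < B by rewrite divr_gt0 ?mulr_gt0.
have M0 : 0 < M by rewrite divr_gt0 ?mulr_gt0.
have BN : 12 * B ^+ 2 = N%:R * beta ^+ 2.
  rewrite /B expr_div_n !exprMn !sqr_sqrtr ?ler0n//.
  by field.
have BM : B / beta ^+ 2 = M.
  by rewrite /B /M; field; rewrite !gt_eqF.
have sC : 0 < Num.sqrt C by rewrite sqrtr_gt0.
have sqrt_powR (x a : R) : 0 < x -> Num.sqrt (x `^ (2 * a)) = x `^ a.
  by move=> x0; rewrite mulrC powRrM powR_mulrn ?powR_ge0// sqrtr_sqr ger0_norm ?powR_ge0.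
have S0 : 0 < B `^ (1 - 2 * mu) by rewrite powR_gt0.
have SE : Num.sqrt (B `^ (1 - 2 * mu)) = B `^ (1 / 2 - mu).
  have -> : 1 - 2 * mu = 2 * (1 / 2 - mu) by field.
  exact: sqrt_powR.
have qE : Num.sqrt (expR (- (N%:R / 12))) = expR (- (N%:R / 24)) :> R.
  rewrite [X in expR X](_ : _ = - (N%:R / 24) * 2%:R); last by field.
  by rewrite expRM_natr sqrtr_sqr ger0_norm ?expR_ge0.
(* The Sobolev term is moved to the end so that its infimum can be replaced by the value at an
   arbitrary extension. *)
rewrite addeAC; apply: le_ereal_inf_affine => //.
- by rewrite powR_gt0.
- by rewrite adde_ge0 ?mule_ge0 ?adde_ge0 ?mule_ge0 ?esqrt_ge0 ?lee_fin ?expR_ge0 ?powR_ge0.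
- by move=> e [G [k [_ _ _ _ ->]]]; exact: esqrt_ge0.
move=> e [G [k [mG G2 GO Gk ->]]].
have X0 : (0 <= \int[leb]_x (cabs2 (u x - v x) * hweight mu x)%:E)%E.
  by apply: integral_ge0 => x _; rewrite lee_fin mulr_ge0 ?cabs2_ge0 ?powR_ge0.
have := HC beta B N u v g G k b0 B0 N1 BN mu_u u2 pv ug mG G2 GO Gk.
rewrite BM /l2norm /wnorm /= -/(leb).
set X := (\int[_]_x _)%E in X0 *; set T := (\int[_]_x _)%E; set W := (\int[_]_x _)%E.
set I := (\int[_]_x _)%E; set F := (\int[_]_x _)%E.
have T0 : (0 <= T)%E by apply: integral_ge0 => x _; rewrite lee_fin mulr_ge0 ?cabs2_ge0 ?powR_ge0.
have W0 : (0 <= W)%E by apply: integral_ge0 => x _; rewrite lee_fin mulr_ge0 ?cabs2_ge0 ?powR_ge0.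
have I0 : (0 <= I)%E by apply: integral_ge0 => x _; rewrite lee_fin mulr_ge0 ?cabs2_ge0 ?powR_ge0.
have F0 : (0 <= F)%E by apply: integral_ge0 => x _; rewrite lee_fin mulr_ge0 ?cabs2_ge0.
(* Square roots of the squared estimate: subadditivity splits the sum, and each factor becomes the
   one in the claim, e^(-N/12) turning into e^(-N/24). *)
move=> /(le_esqrt X0) H; apply: le_trans H _.
have MF0 : (0 <= (M `^ (2 * mu))%:E * F)%E by rewrite mule_ge0 ?lee_fin ?powR_ge0.
have SW0 : (0 <= (B `^ (1 - 2 * mu))%:E * W)%E by rewrite mule_ge0 ?lee_fin ?powR_ge0.
have q0 : 0 < expR (- (N%:R / 12)) :> R by exact: expR_gt0.
have qI0 : (0 <= (expR (- (N%:R / 12)))%:E * (I + (M `^ (2 * mu))%:E * F))%E.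
  by apply: mule_ge0; [rewrite lee_fin ltW|exact: adde_ge0].
rewrite esqrtZ//; last exact: adde_ge0 (adde_ge0 T0 SW0) qI0.
apply: lee_wpmul2l; first by rewrite lee_fin sqrtr_ge0.
apply: le_trans (esqrtD _ qI0) _; first exact: adde_ge0.
rewrite [leRHS]addeAC; apply: leeD.
  by apply: le_trans (esqrtD T0 SW0) _; rewrite esqrtZ// SE.
rewrite esqrtZ//; last exact: adde_ge0.
rewrite qE; apply: lee_wpmul2l; first by rewrite lee_fin expR_ge0.
apply: le_trans (esqrtD I0 MF0) _; rewrite esqrtZ ?powR_gt0// sqrt_powR//.
by rewrite [in leRHS]muleC.
Qed.
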